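(* Let $\mathscr X$ be a rigid $C^*$-tensor category with simple unit object such that $Irr(\mathscr X)$ is finite. Let $A$ be an algebra over $\mathbb C$, let $p\ge 1$, and let $(\mathbf H,\mathbf F)$ be a $p$-summable Fredholm module over $A$ taking values in $\mathbf{Hilb}(\mathscr X)$. Let $n=2m$ be an even integer with $n\ge p-1$. Then $$ch^{n+2}(\mathbf H,\mathbf F)=S\left(ch^{n}(\mathbf H,\mathbf F)\right)\quad\text{in } H^{n+2}_\lambda(A),$$ where $ch^{k}$ denotes the $k$-dimensional Chern character and $S:H^n_\lambda(A)\to H^{n+2}_\lambda(A)$ is the periodicity operator.
   Context: **Rigid $C^*$-tensor category.** $\mathscr X$ is an abelian $\mathbb C$-linear strict monoidal category $(\mathscr X,\otimes,1)$ with finite-dimensional hom-spaces, equipped with antilinear maps $(\cdot)^*:\mathscr X(a,b)\to\mathscr X(b,a)$ with $f^{**}=f$, $(g\circ f)^*=f^*\circ g^*$, $(g\otimes f)^*=g^*\otimes f^*$ (structure isomorphisms unitary), such that (i) for each $f\in\mathscr X(a,b)$ there is $g\in\mathscr X(a,a)$ with $f^*\circ f=g^*\circ g$; (ii) $\|f\|^2:=\sup\{|\xi|: f^*\circ f-\xi 1_a \text{ not invertible}\}$ defines complete submultiplicative norms with $\|f^*\circ f\|=\|f\|^2$. Every object has a dual and a predual, and the unit object $1$ is simple. (Then $\mathscr X$ is semisimple: each object is a finite direct sum of simple objects.) $Irr(\mathscr X)$ is a fixed set of representatives of isomorphism classes of simple objects. **$\mathbf{Hilb}(\mathscr X)$.**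 $\mathbf{Hilb}$ is the category of separable complex Hilbert spaces and bounded operators. Objects of $\mathbf{Hilb}(\mathscr X)$ are linear dagger functors $\mathbf H:\mathscr X^{op}\to\mathbf{Hilb}$; morphisms $\mathbf H\to\mathbf K$ are natural transformations $\theta=(\theta_c)_c$ with $\sup_{c\in\mathscr X}|\theta_c|<\infty$, $|\cdot|$ the operator norm. **Schatten classes.** For $p\in[1,\infty)$, $\mathcal S_p(\mathbf H)$ is the set of $\theta\in\mathbf{Hilb}(\mathscr X)(\mathbf H,\mathbf H)$ with $\theta_c$ compact for all $c\in\mathscr X$ and $\sup_{c\in Irr(\mathscr X)}\|\theta_c\|_p<\infty$, where $\|T\|_p=(\sum_n s_n(T)^p)^{1/p}$ with $s_n(T)$ the singular values of $T$. **Fredholm modules.** A $p$-summable Fredholm module $(\mathbf H,\mathbf F)$ over an algebra $A$ consists of: a $\mathbb Z_2$-graded object $\mathbf H=\mathbf H^+\oplus\mathbf H^-$ of $\mathbf{Hilb}(\mathscr X)$ with grading operator $\varepsilon$ ($\varepsilon=\pm1$ on $\mathbf H^\pm$); an algebra homomorphism $\rho:A\to\mathbf{Hilb}(\mathscr X)(\mathbf H,\mathbf H)$ of degree zero ($A$ concentrated in degree zero, i.e. each $\rho(a)$ commutes with $\varepsilon$); and $\mathbf F\in\mathbf{Hilb}(\mathscr X)(\mathbf H,\mathbf H)$ with $\mathbf F^2=id$, $\mathbf F\varepsilon=-\varepsilon\mathbf F$, and $\mathbf F\rho(a)-\rho(a)\mathbf F\in\mathcal S_p(\mathbf H)$ for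 all $a\in A$. **Character.** An element $\theta\in\mathbf{Hilb}(\mathscr X)(\mathbf H,\mathbf H)$ is even (resp. odd) if it commutes (resp. anticommutes) with $\varepsilon$. The graded commutator is $[\mathbf F,\theta]=\mathbf F\theta-(-1)^{\deg\theta}\theta\mathbf F$ for homogeneous $\theta$, extended linearly, and $d\theta:=i[\mathbf F,\theta]$. For $\theta\in\mathcal S_1(\mathbf H)$, $Trace(\theta):=\sum_{c\in Irr(\mathscr X)}trace(\theta_c)$. If $[\mathbf F,\theta]\in\mathcal S_1(\mathbf H)$, $Tr_s(\theta):=\frac12Trace(\varepsilon\mathbf F[\mathbf F,\theta])$. For an even integer $n=2m\ge p-1$, the $n$-dimensional character of $(\mathbf H,\mathbf F)$ is the linear map $\tau^n:A^{\otimes(n+1)}\to\mathbb C$, $$\tau^n(a_0\otimes\dots\otimes a_n)=(2i\pi)^m\,m!\,Tr_s\big(\rho(a_0)d\rho(a_1)\cdots d\rho(a_n)\big).$$ It is a cyclic cocycle, $\tau^n\in Z^n_\lambda(A)$, and $ch^n(\mathbf H,\mathbf F):=[\tau^n]\in H^n_\lambda(A)$. **Cyclic cohomology.** $C^k(A)$ is the space of linear maps $A^{\otimes(k+1)}\to\mathbb C$; $C^k_\lambda(A)$ is the subspace of $\psi$ with $\psi(x_0,\dots,x_k)=(-1)^k\psi(x_1,\dots,x_k,x_0)$; the differential is $(b\psi)(x_0,\dots,x_{k+1})=\sum_{i=0}^k(-1)^i\psi(x_0,\dots,x_ix_{i+1},\dots,x_{k+1})+(-1)^{k+1}\psi(x_{k+1}x_0,x_1,\dots,x_k)$.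 The cocycles, coboundaries and cohomology of $(C^\bullet_\lambda(A),b)$ are $Z^\bullet_\lambda(A)$, $B^\bullet_\lambda(A)$, $H^\bullet_\lambda(A)$. **Periodicity operator.** Let $\sigma\in Z^2_\lambda(\mathbb C)$ be determined by $\sigma(1,1,1)=2i\pi$. $S:Z^r_\lambda(A)\to Z^{r+2}_\lambda(A)$ is $S\psi=\psi\#\sigma$ (Connes' cup product). Explicitly: let $\Omega(A)$ be the universal differential graded algebra of $A$, with $\Omega^r(A)$ spanned by $\tilde a_0\,da_1\cdots da_r$, $\tilde a_0=a_0+\mu 1\in A\oplus\mathbb C$, $a_i\in A$, and let $\hat\psi(\tilde a_0da_1\cdots da_r)=\psi(a_0,\dots,a_r)$; then $$(S\psi)(a_0,\dots,a_{r+2})=2i\pi\sum_{j=1}^{r+1}\hat\psi\big(a_0\,da_1\cdots da_{j-1}\,(a_ja_{j+1})\,da_{j+2}\cdots da_{r+2}\big).$$ $S$ maps $B^r_\lambda(A)$ into $B^{r+2}_\lambda(A)$; the induced map $H^r_\lambda(A)\to H^{r+2}_\lambda(A)$ is again denoted $S$. *)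

(* Defs.v *)
From HB Require Import structures.
From mathcomp Require Import all_boot all_order all_algebra.
From mathcomp Require Import complex.
From mathcomp Require Import all_classical all_reals all_analysis.

Set Implicit Arguments.
Unset Strict Implicit.
Unset Printing Implicit Defensive.

Import Order.TTheory GRing.Theory Num.Theory numFieldNormedType.Exports.
Local Open Scope classical_set_scope.
Local Open Scope complex_scope.
Local Open Scope ring_scope.

(* Hom-spaces are finite-dimensional because they are [vectType]s. *)
Record linear_category (R : realType) := LinearCategory {
  obj :> Type;
  hom : obj -> obj -> vectType R[i];
  idm : forall a, hom a a;
  comp : forall a b c, hom b c -> hom a b -> hom a c;
  compA : forall a b c d (h : hom c d) (g : hom b c) (f : hom a b),
    comp h (comp g f) = comp (comp h g) f;
  comp1m : forall a b (f : hom a b), comp (idm b) f = f;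
  compm1 : forall a b (f : hom a b), comp f (idm a) = f;
  comp_linl : forall a b c (z : R[i]) (g g' : hom b c) (f : hom a b),
    comp (z *: g + g') f = z *: comp g f + comp g' f;
  comp_linr : forall a b c (z : R[i]) (g : hom b c) (f f' : hom a b),
    comp g (z *: f + f') = z *: comp g f + comp g f'
}.
Arguments idm {R l} a.
Arguments comp {R l a b c} g f.

Notation "g \oc f" := (comp g f) (at level 40, left associativity).

Section LinearCategory.
Context {R : realType} {X : linear_category R}.
Implicit Types a b c : X.

Definition is_iso a b (f : hom a b) : Prop :=
  exists g : hom b a, g \oc f = idm a /\ f \oc g = idm b.

Definition isomorphic a b : Prop := exists f : hom a b, is_iso f.

Definition is_mono a b (f : hom a b) : Prop :=
  forall c (g h : hom c a), f \oc g = f \oc h -> g = h.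

Definition is_epi a b (f : hom a b) : Prop :=
  forall c (g h : hom b c), g \oc f = h \oc f -> g = h.

Definition is_zero_obj a : Prop := idm a = 0.

Definition is_kernel a b k (f : hom a b) (i : hom k a) : Prop :=
  f \oc i = 0 /\
  forall c (g : hom c a), f \oc g = 0 -> exists! h : hom c k, i \oc h = g.

Definition is_cokernel a b k (f : hom a b) (q : hom b k) : Prop :=
  q \oc f = 0 /\
  forall c (g : hom b c), g \oc f = 0 -> exists! h : hom k c, h \oc q = g.

Definition is_biproduct a b s (ia : hom a s) (ib : hom b s)
    (pa : hom s a) (pb : hom s b) : Prop :=
  [/\ pa \oc ia = idm a, pb \oc ib = idm b, pa \oc ib = 0, pb \oc ia = 0
    & ia \oc pa + ib \oc pb = idm s].

Definition simple a : Prop :=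
  ~ is_zero_obj a /\
  forall b (i : hom b a), is_mono i -> is_zero_obj b \/ is_iso i.

(* The identity, viewed as a morphism between two objects that are equal. *)
Definition idto a b (e : a = b) : hom a b :=
  match e in _ = y return hom a y with erefl => idm a end.

End LinearCategory.

Record is_abelian (R : realType) (X : linear_category R) : Prop := IsAbelian {
  abelian_zero : exists z : X, is_zero_obj z;
  abelian_biproduct : forall a b : X, exists s (ia : hom a s) (ib : hom b s)
    (pa : hom s a) (pb : hom s b), is_biproduct ia ib pa pb;
  abelian_kernel : forall (a b : X) (f : hom a b),
    exists k (i : hom k a), is_kernel f i;
  abelian_cokernel : forall (a b : X) (f : hom a b),
    exists k (q : hom b k), is_cokernel f q;
  abelian_mono : forall (a b : X) (i : hom a b), is_mono i ->
    exists c (f : hom b c), is_kernel f i;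
  abelian_epi : forall (a b : X) (q : hom a b), is_epi q ->
    exists c (f : hom c a), is_cokernel f q
}.

Record strict_monoidal (R : realType) (X : linear_category R) :=
    StrictMonoidal {
  unit_obj : X;
  tenso : X -> X -> X;
  tensm : forall a b a' b' : X,
    hom a b -> hom a' b' -> hom (tenso a a') (tenso b b');
  tensm1 : forall a a' : X, tensm (idm a) (idm a') = idm (tenso a a');
  tensm_comp : forall (a b c a' b' c' : X) (g : hom b c) (f : hom a b)
      (g' : hom b' c') (f' : hom a' b'),
    tensm (g \oc f) (g' \oc f') = tensm g g' \oc tensm f f';
  tensm_linl : forall (a b a' b' : X) (z : R[i]) (f g : hom a b)
      (h : hom a' b'),
    tensm (z *: f + g) h = z *: tensm f h + tensm g h;
  tensm_linr : forall (a b a' b' : X) (z : R[i]) (h : hom a b)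
      (f g : hom a' b'),
    tensm h (z *: f + g) = z *: tensm h f + tensm h g;
  tensoA : forall a b c : X, tenso a (tenso b c) = tenso (tenso a b) c;
  tenso1o : forall a : X, tenso unit_obj a = a;
  tensoo1 : forall a : X, tenso a unit_obj = a;
  tensmA : forall (a a' b b' c c' : X)
      (f : hom a a') (g : hom b b') (h : hom c c'),
    idto (tensoA a' b' c') \oc tensm f (tensm g h)
    = tensm (tensm f g) h \oc idto (tensoA a b c);
  tensm1m : forall (a b : X) (f : hom a b),
    idto (tenso1o b) \oc tensm (idm unit_obj) f = f \oc idto (tenso1o a);
  tensmm1 : forall (a b : X) (f : hom a b),
    idto (tensoo1 b) \oc tensm f (idm unit_obj) = f \oc idto (tensoo1 a)
}.

(* The structure isomorphisms of a strict monoidal category are identities,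
   so their unitarity needs no separate clause. *)
Record dagger_structure (R : realType) (X : linear_category R)
    (T : strict_monoidal X) := DaggerStructure {
  dagger : forall a b : X, hom a b -> hom b a;
  dagger_antilinear : forall (a b : X) (z : R[i]) (f g : hom a b),
    dagger (z *: f + g) = z^* *: dagger f + dagger g;
  daggerK : forall (a b : X) (f : hom a b), dagger (dagger f) = f;
  dagger_comp : forall (a b c : X) (g : hom b c) (f : hom a b),
    dagger (g \oc f) = dagger f \oc dagger g;
  dagger_tens : forall (a b a' b' : X) (g : hom a b) (f : hom a' b'),
    dagger (tensm T g f) = tensm T (dagger g) (dagger f)
}.

Section CStar.
Context {R : realType} {X : linear_category R} {T : strict_monoidal X}.
Variable D : dagger_structure T.
Implicit Types a b c : X.

Definition cnorm a b (f : hom a b) : R :=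
  Num.sqrt (sup [set Normc.normc xi | xi in
    [set xi : R[i] | ~ is_iso (dagger D f \oc f - xi *: idm a)]]).

Record is_cstar : Prop := IsCStar {
  cstar_positive : forall a b (f : hom a b),
    exists g : hom a a, dagger D f \oc f = dagger D g \oc g;
  cnorm_eq0 : forall a b (f : hom a b), cnorm f = 0 -> f = 0;
  cnormZ : forall a b (z : R[i]) (f : hom a b),
    cnorm (z *: f) = Normc.normc z * cnorm f;
  cnormD : forall a b (f g : hom a b), cnorm (f + g) <= cnorm f + cnorm g;
  cnormM : forall a b c (g : hom b c) (f : hom a b),
    cnorm (g \oc f) <= cnorm g * cnorm f;
  cnorm_cstar : forall a b (f : hom a b),
    cnorm (dagger D f \oc f) = cnorm f ^+ 2;
  cnorm_complete : forall a b (u : nat -> hom a b),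
    (forall e : R, 0 < e -> exists N, forall j k,
       (N <= j)%N -> (N <= k)%N -> cnorm (u j - u k) < e) ->
    exists l : hom a b, forall e : R, 0 < e -> exists N, forall j,
       (N <= j)%N -> cnorm (u j - l) < e
}.

End CStar.

Section Rigid.
Context {R : realType} {X : linear_category R}.
Variable T : strict_monoidal X.
Local Notation "a \ox b" := (tenso T a b) (at level 40, left associativity).
Local Notation "f \om g" := (tensm T f g) (at level 40, left associativity).

(* [b] is a dual of [a]: both composites
   [a = 1 \ox a -> (a \ox b) \ox a = a \ox (b \ox a) -> a \ox 1 = a] and
   [b = b \ox 1 -> b \ox (a \ox b) = (b \ox a) \ox b -> 1 \ox b = b]
   are identities. *)
Definition is_dual (a b : X) : Prop :=
  exists (ev : hom (b \ox a) (unit_obj T)) (coev : hom (unit_obj T) (a \ox b)),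
    idto (tensoo1 T a) \oc (idm a \om ev) \oc idto (esym (tensoA T a b a))
      \oc (coev \om idm a) \oc idto (esym (tenso1o T a)) = idm a /\
    idto (tenso1o T b) \oc (ev \om idm b) \oc idto (tensoA T b a b)
      \oc (idm b \om coev) \oc idto (esym (tensoo1 T b)) = idm b.

Definition is_rigid : Prop :=
  forall a : X, (exists b, is_dual a b) /\ (exists b, is_dual b a).

End Rigid.

Record rigid_cstar_tensor_category (R : realType) :=
    RigidCStarTensorCategory {
  rct_cat :> linear_category R;
  rct_tensor : strict_monoidal rct_cat;
  rct_dagger : dagger_structure rct_tensor;
  rct_abelian : is_abelian rct_cat;
  rct_cstar : is_cstar rct_dagger;
  rct_rigid : is_rigid rct_tensor;
  rct_unit_simple : simple (unit_obj rct_tensor)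
}.

Definition is_Irr (R : realType) (X : linear_category R) (I : Type)
    (irr : I -> X) : Prop :=
  [/\ forall i, simple (irr i),
      forall i j, isomorphic (irr i) (irr j) -> i = j
    & forall a : X, simple a -> exists i, isomorphic a (irr i)].

(* Inner products are linear in the first variable. *)
Record hilbert (R : realType) := Hilbert {
  hilbert_car :> completeNormedModType R[i];
  dot : hilbert_car -> hilbert_car -> R[i];
  dot_linear : forall (z : R[i]) (x x' y : hilbert_car),
    dot (z *: x + x') y = z * dot x y + dot x' y;
  dotC : forall x y : hilbert_car, dot x y = (dot y x)^*;
  dot_norm : forall x : hilbert_car, dot x x = `|x| ^+ 2;
  hilbert_separable : exists2 S : set hilbert_car, countable S & dense S
}.
Arguments dot {R h} x y.

Section Operators.
Context {R : realType}.

Definition norm_le (H K : hilbert R) (M : R) (f : H -> K) : Prop :=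
  forall x, `|f x| <= M%:C * `|x|.

Definition bounded_op (H K : hilbert R) (f : H -> K) : Prop :=
  linear f /\ exists M : R, norm_le M f.

Context {H : hilbert R}.
Implicit Types T : H -> H.

Definition compact_op T : Prop :=
  precompact [set T x | x in [set x : H | `|x| <= 1]].

(* [s_0(T) >= s_1(T) >= ...] are the eigenvalues of [(T^*T)^(1/2)], repeated
   according to multiplicity and padded with zeros. Hence [s_n(T) >= l] iff
   there are [n + 1] orthonormal eigenvectors of [T^*T] whose eigenvalues are
   [mu^2] with [mu >= l]; the equation [T^*T e = mu^2 e] is tested against all
   vectors [y]. *)
Definition singular_value T (n : nat) : R :=
  sup [set l : R | 0 <= l /\
    exists (e : 'I_n.+1 -> H) (mu : 'I_n.+1 -> R),
      (forall j k, dot (e j) (e k) = (j == k)%:R) /\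
      (forall j, l <= mu j /\
         forall y, dot (T (e j)) (T y) = ((mu j) ^+ 2)%:C * dot (e j) y)].

Definition schatten_norm (p : R) T : \bar R :=
  poweR (\sum_(0 <= n <oo) (singular_value T n `^ p)%:E)%E p^-1.

(* Bases are indexed by a set of naturals, which covers finite dimension. *)
Definition orthonormal_basis (J : set nat) (e : nat -> H) : Prop :=
  (forall j k, J j -> J k -> dot (e j) (e k) = (j == k)%:R) /\
  (forall x, (forall j, J j -> dot x (e j) = 0) -> x = 0).

Definition has_trace T (t : R[i]) : Prop :=
  forall (J : set nat) (e : nat -> H), orthonormal_basis J e ->
    series (fun k => (if k \in J then dot (T (e k)) (e k) else 0) : (R[i])^o)
      @ \oo --> (t : (R[i])^o).

Definition trace T : R[i] := xget 0 [set t | has_trace T t].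

End Operators.

Record hilb_functor (R : realType) (X : rigid_cstar_tensor_category R) :=
    HilbFunctor {
  fobj :> X -> hilbert R;
  fmap : forall a b : X, hom a b -> fobj b -> fobj a;
  fmap_bounded : forall (a b : X) (f : hom a b), bounded_op (fmap f);
  fmap_linear : forall (a b : X) (z : R[i]) (f g : hom a b) (x : fobj b),
    fmap (z *: f + g) x = z *: fmap f x + fmap g x;
  fmap1 : forall (a : X) (x : fobj a), fmap (idm a) x = x;
  fmap_comp : forall (a b c : X) (g : hom b c) (f : hom a b) (x : fobj c),
    fmap (g \oc f) x = fmap f (fmap g x);
  fmap_dagger : forall (a b : X) (f : hom a b) (x : fobj b) (y : fobj a),
    dot (fmap f x) y = dot x (fmap (dagger (rct_dagger X) f) y)
}.

Section HilbX.
Context {R : realType} {X : rigid_cstar_tensor_category R}.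
Implicit Types H K L : hilb_functor X.

Record hilb_hom H K := HilbHom {
  nt :> forall c : X, H c -> K c;
  nt_linear : forall c, linear (@nt c);
  nt_natural : forall (a b : X) (f : hom a b) (x : H b),
    nt (fmap f x) = fmap f (nt x);
  nt_bounded : exists M : R, forall c, norm_le M (@nt c)
}.
Arguments nt {H K} _ c.

Lemma hilb_hom_eq H K (s t : hilb_hom H K) :
  (forall c x, s c x = t c x) -> s = t.
Proof.
case: s t => [s s1 s2 s3] [t t1 t2 t3] /= st.
have e : s = t by apply: functional_extensionality_dep => c; exact/funext.
by subst t; congr HilbHom; exact: Prop_irrelevance.
Qed.

Lemma fmap_lin H (a b : X) (f : hom a b) : linear (@fmap _ _ H a b f).
Proof. by have [] := fmap_bounded H f. Qed.

Lemma linear_map0 (U V : lmodType R[i]) (f : U -> V) : linear f -> f 0 = 0.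
Proof. by move=> fl; have := fl (-1) 0 0; rewrite !scaleN1r !addNr. Qed.

Lemma hom_zero_proof H K : let t := fun c : X => (fun=> 0) : H c -> K c in
  [/\ forall c, linear (t c),
      forall (a b : X) (f : hom a b) x, t a (fmap f x) = fmap f (t b x)
    & exists M : R, forall c, norm_le M (t c)].
Proof.
split=> /=.
- by move=> c z x y; rewrite scaler0 addr0.
- by move=> a b f x; rewrite (linear_map0 (@fmap_lin K a b f)).
- by exists 0 => c x; rewrite normr0 mul0r.
Qed.

Lemma hom_lin_proof H K (z : R[i]) (s t : hilb_hom H K) :
  let u := fun (c : X) (x : H c) => z *: s c x + t c x in
  [/\ forall c, linear (u c),
      forall (a b : X) (f : hom a b) x, u a (fmap f x) = fmap f (u b x)
    & exists M : R, forall c, norm_le M (u c)].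
Proof.
split=> /=.
- move=> c w x y; rewrite !nt_linear !scalerDr !scalerA (mulrC z w).
  by rewrite addrACA.
- by move=> a b f x; rewrite !nt_natural -fmap_lin.
- have [M sM] := nt_bounded s; have [N tN] := nt_bounded t.
  exists (Normc.normc z * M + N) => c x; apply: (le_trans (ler_normD _ _)).
  rewrite normrZ rmorphD rmorphM /= mulrDl -mulrA.
  apply: lerD; last exact: tN.
  exact: (ler_wpM2l (normr_ge0 z) (sM c x)).
Qed.

Lemma hom_comp_proof H K L (s : hilb_hom K L) (t : hilb_hom H K) :
  let u := fun (c : X) (x : H c) => s c (t c x) in
  [/\ forall c, linear (u c),
      forall (a b : X) (f : hom a b) x, u a (fmap f x) = fmap f (u b x)
    & exists M : R, forall c, norm_le M (u c)].
Proof.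
split=> /=.
- by move=> c w x y; rewrite !nt_linear.
- by move=> a b f x; rewrite !nt_natural.
- have [M sM] := nt_bounded s; have [N tN] := nt_bounded t.
  exists (`|M| * N) => c x; apply: (le_trans (sM c _)).
  apply: (@le_trans _ _ (`|M|%:C * `|t c x|)).
    by apply: ler_wpM2r => //; rewrite lecR ler_norm.
  rewrite rmorphM /= -mulrA; apply: ler_wpM2l; last exact: tN.
  by rewrite lecR.
Qed.

Lemma hom_id_proof H : let u := fun (c : X) (x : H c) => x in
  [/\ forall c, linear (u c),
      forall (a b : X) (f : hom a b) x, u a (fmap f x) = fmap f (u b x)
    & exists M : R, forall c, norm_le M (u c)].
Proof. by split=> //; exists 1 => c x; rewrite mul1r. Qed.

Definition hom_zero H K : hilb_hom H K :=
  let: And3 l n b := hom_zero_proof H K in HilbHom l n b.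
Definition hom_lin H K z (s t : hilb_hom H K) : hilb_hom H K :=
  let: And3 l n b := hom_lin_proof z s t in HilbHom l n b.
Definition hom_comp H K L (s : hilb_hom K L) (t : hilb_hom H K) :
  hilb_hom H L := let: And3 l n b := hom_comp_proof s t in HilbHom l n b.
Definition hom_id H : hilb_hom H H :=
  let: And3 l n b := hom_id_proof H in HilbHom l n b.

Definition hom_add H K (s t : hilb_hom H K) := hom_lin 1 s t.
Definition hom_scale H K z (s : hilb_hom H K) := hom_lin z s (hom_zero H K).
Definition hom_opp H K (s : hilb_hom H K) := hom_scale (-1) s.

Lemma hom_zeroE H K c x : hom_zero H K c x = 0.
Proof. by rewrite /hom_zero; case: hom_zero_proof. Qed.

Lemma hom_linE H K z (s t : hilb_hom H K) c x :
  hom_lin z s t c x = z *: s c x + t c x.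
Proof. by rewrite /hom_lin; case: hom_lin_proof. Qed.

Lemma hom_compE H K L (s : hilb_hom K L) (t : hilb_hom H K) c x :
  hom_comp s t c x = s c (t c x).
Proof. by rewrite /hom_comp; case: hom_comp_proof. Qed.

Lemma hom_idE H c x : hom_id H c x = x.
Proof. by rewrite /hom_id; case: hom_id_proof. Qed.

Lemma hom_addE H K (s t : hilb_hom H K) c x :
  hom_add s t c x = s c x + t c x.
Proof. by rewrite hom_linE scale1r. Qed.

Lemma hom_scaleE H K z (s : hilb_hom H K) c x :
  hom_scale z s c x = z *: s c x.
Proof. by rewrite hom_linE hom_zeroE addr0. Qed.

Lemma hom_oppE H K (s : hilb_hom H K) c x : hom_opp s c x = - s c x.
Proof. by rewrite hom_scaleE scaleN1r. Qed.

HB.instance Definition _ H K := gen_eqMixin (hilb_hom H K).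
HB.instance Definition _ H K := gen_choiceMixin (hilb_hom H K).

Fact hom_addA H K : associative (@hom_add H K).
Proof. by move=> s t u; apply: hilb_hom_eq => c x; rewrite !hom_addE addrA. Qed.
Fact hom_addC H K : commutative (@hom_add H K).
Proof. by move=> s t; apply: hilb_hom_eq => c x; rewrite !hom_addE addrC. Qed.
Fact hom_add0 H K : left_id (hom_zero H K) (@hom_add H K).
Proof.
by move=> s; apply: hilb_hom_eq => c x; rewrite hom_addE hom_zeroE add0r.
Qed.
Fact hom_addN H K : left_inverse (hom_zero H K) (@hom_opp H K) (@hom_add H K).
Proof.
move=> s; apply: hilb_hom_eq => c x.
by rewrite hom_addE hom_zeroE hom_oppE addNr.
Qed.

HB.instance Definition _ H K := GRing.isZmodule.Build (hilb_hom H K)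
  (@hom_addA H K) (@hom_addC H K) (@hom_add0 H K) (@hom_addN H K).

Lemma nt0E H K c x : (0 : hilb_hom H K) c x = 0.
Proof. exact: hom_zeroE. Qed.
Lemma ntDE H K (s t : hilb_hom H K) c x : (s + t) c x = s c x + t c x.
Proof. exact: hom_addE. Qed.
Lemma ntNE H K (s : hilb_hom H K) c x : (- s) c x = - s c x.
Proof. exact: hom_oppE. Qed.

Fact hom_scaleA H K (z w : R[i]) (s : hilb_hom H K) :
  hom_scale z (hom_scale w s) = hom_scale (z * w) s.
Proof. by apply: hilb_hom_eq => c x; rewrite !hom_scaleE scalerA. Qed.
Fact hom_scale1 H K : left_id 1 (@hom_scale H K).
Proof. by move=> s; apply: hilb_hom_eq => c x; rewrite hom_scaleE scale1r. Qed.
Fact hom_scaleDr H K : right_distributive (@hom_scale H K) +%R.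
Proof.
move=> z s t; apply: hilb_hom_eq => c x.
by rewrite ntDE !hom_scaleE ntDE scalerDr.
Qed.
Fact hom_scaleDl H K (s : hilb_hom H K) :
  {morph (@hom_scale H K)^~ s : z w / z + w}.
Proof.
move=> z w; apply: hilb_hom_eq => c x.
by rewrite ntDE !hom_scaleE scalerDl.
Qed.

HB.instance Definition _ H K :=
  GRing.Zmodule_isLmodule.Build R[i] (hilb_hom H K)
    (@hom_scaleA H K) (@hom_scale1 H K) (@hom_scaleDr H K) (@hom_scaleDl H K).

Lemma ntZE H K z (s : hilb_hom H K) c x : (z *: s) c x = z *: s c x.
Proof. exact: hom_scaleE. Qed.

Fact hom_compA H : associative (@hom_comp H H H).
Proof. by move=> s t u; apply: hilb_hom_eq => c x; rewrite !hom_compE. Qed.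
Fact hom_comp1m H : left_id (hom_id H) (@hom_comp H H H).
Proof. by move=> s; apply: hilb_hom_eq => c x; rewrite hom_compE hom_idE. Qed.
Fact hom_compm1 H : right_id (hom_id H) (@hom_comp H H H).
Proof. by move=> s; apply: hilb_hom_eq => c x; rewrite hom_compE hom_idE. Qed.
Fact hom_compDl H : left_distributive (@hom_comp H H H) +%R.
Proof.
by move=> s t u; apply: hilb_hom_eq => c x; rewrite ntDE !hom_compE ntDE.
Qed.
Fact hom_compDr H : right_distributive (@hom_comp H H H) +%R.
Proof.
move=> s t u; apply: hilb_hom_eq => c x; rewrite ntDE !hom_compE ntDE.
by have := nt_linear s 1 (t c x) (u c x); rewrite !scale1r.
Qed.

HB.instance Definition _ H := GRing.Zmodule_isPzRing.Build (hilb_hom H H)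
  (@hom_compA H) (@hom_comp1m H) (@hom_compm1 H)
  (@hom_compDl H) (@hom_compDr H).

Lemma nt1E H c x : (1 : hilb_hom H H) c x = x.
Proof. exact: hom_idE. Qed.
Lemma ntME H (s t : hilb_hom H H) c x : (s * t) c x = s c (t c x).
Proof. exact: hom_compE. Qed.

Definition hom_adjoint H K (s : hilb_hom H K) (t : hilb_hom K H) : Prop :=
  forall c x y, dot (s c x) y = dot x (t c y).

End HilbX.

Section Schatten.
Context {R : realType} {X : rigid_cstar_tensor_category R}.
Variables (I : finType) (irr : I -> X).

Definition schatten (p : R) (H : hilb_functor X) : set (hilb_hom H H) :=
  [set t | (forall c, compact_op (t c)) /\
    (ereal_sup (range (fun i => schatten_norm p (t (irr i)))) < +oo)%E].

Definition Trace (H : hilb_functor X) (t : hilb_hom H H) : R[i] :=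
  \sum_(i : I) trace (t (irr i)).

End Schatten.
Arguments schatten {R X I} irr p H.
Arguments Trace {R X I} irr {H} t.

(* Associative algebras, not necessarily unital. *)
Record algebra (R : realType) := Algebra {
  alg_car :> lmodType R[i];
  amul : alg_car -> alg_car -> alg_car;
  amulA : associative amul;
  amul_linl : forall (z : R[i]) (a a' b : alg_car),
    amul (z *: a + a') b = z *: amul a b + amul a' b;
  amul_linr : forall (z : R[i]) (a b b' : alg_car),
    amul a (z *: b + b') = z *: amul a b + amul a b'
}.
Arguments amul {R A} x y : rename.

(* The orthogonal direct sum [H = H^+ (+) H^-], with inclusions [gr_i] and
   projections [gr_p = gr_i^*]. *)
Record graded_object (R : realType) (X : rigid_cstar_tensor_category R) :=
    GradedObject {
  gr_tot :> hilb_functor X;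
  gr_pos : hilb_functor X;
  gr_neg : hilb_functor X;
  gr_ipos : hilb_hom gr_pos gr_tot;
  gr_ineg : hilb_hom gr_neg gr_tot;
  gr_ppos : hilb_hom gr_tot gr_pos;
  gr_pneg : hilb_hom gr_tot gr_neg;
  gr_adjpos : hom_adjoint gr_ipos gr_ppos;
  gr_adjneg : hom_adjoint gr_ineg gr_pneg;
  gr_pospos : hom_comp gr_ppos gr_ipos = hom_id gr_pos;
  gr_negneg : hom_comp gr_pneg gr_ineg = hom_id gr_neg;
  gr_posneg : hom_comp gr_ppos gr_ineg = 0;
  gr_negpos : hom_comp gr_pneg gr_ipos = 0;
  gr_sum : hom_comp gr_ipos gr_ppos + hom_comp gr_ineg gr_pneg = hom_id gr_tot
}.

Definition grading (R : realType) (X : rigid_cstar_tensor_category R)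
    (H : graded_object X) : hilb_hom H H :=
  hom_comp (gr_ipos H) (gr_ppos H) - hom_comp (gr_ineg H) (gr_pneg H).

Record fredholm_module (R : realType) (X : rigid_cstar_tensor_category R)
    (I : finType) (irr : I -> X) (A : algebra R) (p : R) := FredholmModule {
  fm_obj :> graded_object X;
  fm_rho : A -> hilb_hom fm_obj fm_obj;
  fm_F : hilb_hom fm_obj fm_obj;
  fm_rho_linear : linear fm_rho;
  fm_rho_mul : forall a b : A, fm_rho (amul a b) = fm_rho a * fm_rho b;
  fm_rho_even : forall a : A,
    fm_rho a * grading fm_obj = grading fm_obj * fm_rho a;
  fm_F2 : fm_F * fm_F = 1;
  fm_F_odd : fm_F * grading fm_obj = - (grading fm_obj * fm_F);
  fm_summable : forall a : A,
    schatten irr p fm_obj (fm_F * fm_rho a - fm_rho a * fm_F)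
}.

Section CyclicCohomology.
Context {R : realType}.
Variable A : algebra R.

(* Linear maps on [A^(\otimes k.+1)] are multilinear maps of [k.+1]
   arguments. *)
Definition cochain (k : nat) := ('I_k.+1 -> A) -> R[i].

Definition upd k (x : 'I_k.+1 -> A) (j : 'I_k.+1) (a : A) : 'I_k.+1 -> A :=
  fun l => if l == j then a else x l.

Definition multilinear k (psi : cochain k) : Prop :=
  forall (x : 'I_k.+1 -> A) (j : 'I_k.+1) (z : R[i]) (a b : A),
    psi (upd x j (z *: a + b)) = z * psi (upd x j a) + psi (upd x j b).

Definition cyclic_cochain k (psi : cochain k) : Prop :=
  multilinear psi /\
  forall x, psi x = (-1) ^+ k * psi (fun j => x (ordS j)).

(* [(x_0, ..., x_i x_{i+1}, ..., x_{k+1})] *)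
Definition face k (i : nat) (x : 'I_k.+2 -> A) : 'I_k.+1 -> A := fun j =>
  if (j < i)%N then x (inord j)
  else if j == i :> nat then amul (x (inord i)) (x (inord i.+1))
  else x (inord j.+1).

(* [(x_{k+1} x_0, x_1, ..., x_k)] *)
Definition last_face k (x : 'I_k.+2 -> A) : 'I_k.+1 -> A := fun j =>
  if j == ord0 then amul (x ord_max) (x ord0) else x (inord j).

Definition hochschild k (psi : cochain k) : cochain k.+1 := fun x =>
  \sum_(i < k.+1) (-1) ^+ i * psi (face i x)
  + (-1) ^+ k.+1 * psi (last_face x).

Definition cyclic_cocycle k : set (cochain k) :=
  [set psi | cyclic_cochain psi /\ hochschild psi = fun=> 0].

Definition cyclic_coboundary k : set (cochain k) :=
  match k return set (cochain k) with
  | 0 => [set fun=> 0]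
  | k'.+1 => [set hochschild beta | beta in @cyclic_cochain k']
  end.

(* Elements of [H^k_lambda(A)] are represented by cosets of
   [B^k_lambda(A)]. *)
Definition cohomology_class k (psi : cochain k) : set (cochain k) :=
  [set phi | cyclic_coboundary (phi \- psi)].

(* [Mono z (a, mu) [:: a_r; ...; a_1]] stands for the element
   [z (a + mu 1) da_1 ... da_r] of [Omega^r(A)]; note the reversed order.
   A [form] is a formal sum of such monomials. *)
Record monomial := Mono { mcoef : R[i]; mhead : A * R[i]; mdiffs : seq A }.
Definition form := seq monomial.

Definition form_of (a : A) : form := [:: Mono 1 (a, 0) [::]].

Definition form_muld (w : form) (b : A) : form :=
  [seq Mono (mcoef t) (mhead t) (b :: mdiffs t) | t <- w].

Definition form_scale (z : R[i]) (w : form) : form :=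
  [seq Mono (z * mcoef t) (mhead t) (mdiffs t) | t <- w].

(* Product [(a + mu 1) da_1 ... da_r b], by the Leibniz rule
   [(da_r) b = d(a_r b) - a_r db]. *)
Fixpoint monomial_mul (h : A * R[i]) (ds : seq A) (b : A) : form :=
  match ds with
  | [::] => [:: Mono 1 (amul h.1 b + h.2 *: b, 0) [::]]
  | a :: ds' => Mono 1 h (amul a b :: ds') ::
      form_scale (-1) (form_muld (monomial_mul h ds' a) b)
  end.

Definition form_mul (w : form) (b : A) : form :=
  flatten [seq form_scale (mcoef t) (monomial_mul (mhead t) (mdiffs t) b)
          | t <- w].

Definition form_eval r (psi : cochain r) (w : form) : R[i] :=
  \sum_(t <- w) mcoef t *
    psi (fun j => nth 0 ((mhead t).1 :: rev (mdiffs t)) j).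

(* [a_0 da_1 ... da_{j-1} (a_j a_{j+1}) da_{j+2} ... da_{r+2}] *)
Definition S_form r (a : 'I_r.+3 -> A) (j : nat) : form :=
  let a_ k := a (inord k) in
  let w := foldl form_muld (form_of (a_ 0%N)) [seq a_ k | k <- iota 1 j.-1] in
  foldl form_muld (form_mul w (amul (a_ j) (a_ j.+1)))
    [seq a_ k | k <- iota j.+2 (r.+1 - j)].

Definition S_cochain r (psi : cochain r) : cochain r.+2 := fun a =>
  2 * 'i * pi%:C * \sum_(1 <= j < r.+2) form_eval psi (S_form a j).

(* The operator induced by [S_cochain] on cosets. *)
Definition S_class r (c : set (cochain r)) : set (cochain r.+2) :=
  \bigcup_(psi in c) cohomology_class (S_cochain psi).

End CyclicCohomology.

Section Character.
Context {R : realType} {X : rigid_cstar_tensor_category R}.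
Context {I : finType} {irr : I -> X} {A : algebra R} {p : R}.
Variable M : fredholm_module irr A p.
Local Notation eps := (grading M).
Local Notation F := (fm_F M).
Implicit Types t : hilb_hom M M.

Definition even_part t : hilb_hom M M := 2^-1 *: (t + eps * t * eps).
Definition odd_part t : hilb_hom M M := 2^-1 *: (t - eps * t * eps).

Definition graded_comm t : hilb_hom M M :=
  (F * even_part t - even_part t * F) + (F * odd_part t + odd_part t * F).

Definition qdiff t : hilb_hom M M := 'i *: graded_comm t.

Definition Tr_s t : R[i] := 2^-1 * Trace irr (eps * F * graded_comm t).

Definition character (m : nat) : cochain A m.*2 := fun a =>
  (2 * 'i * pi%:C) ^+ m * m`!%:R *
  Tr_s (fm_rho M (a ord0) *
        \prod_(j < m.*2) qdiff (fm_rho M (a (lift ord0 j)))).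

Definition chern_character (m : nat) : set (cochain A m.*2) :=
  cohomology_class (@character m).

End Character.
Arguments character {R X I irr A p} M m a.
Arguments chern_character {R X I irr A p} M m.

(* Main.v *)
Require Import Defs.
From HB Require Import structures.
From mathcomp Require Import all_boot all_order all_algebra.
From mathcomp Require Import complex zify ring lra.
From mathcomp Require Import all_classical all_reals all_analysis.

(** The equality of classes follows from an explicit cochain whose coboundary
    separates the two characters. Write [delta a = F rho(a) - rho(a) F]. Up to
    a scalar, the character of even degree [n] is
    [phi_n(a_0, ..., a_n) = Trace (eps F delta a_0 ... delta a_n)]. As [eps F]
    commutes with all [delta a], this is invariant under rotations as soon as
    the trace is cyclic; as [delta] is a derivation, each face of [phi_n] is a
    sum [u_i + u_(i+1)], where [u_i] is the same trace with [rho(a_i)] at the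
    place of [delta a_i] and [i] is read modulo [n + 2] ([split_faces_phi]).
    The alternating sum of the faces cancels, so [phi_n] is a cyclic cocycle.

    The periodicity operator is, up to the factor [- 2 i pi], the sum of
    [(-1)^(i+j) d_i d_j] over [i < j] ([S_cochain_double_face]). On a Hochschild
    cocycle [psi] this is the coboundary of the weighted sum of faces
    [D psi = sum_i (-1)^i i d_i psi] ([hochschild_weighted_face]), which follows
    from the simplicial identities. For [psi = phi_n] the splitting of the faces
    gives [D phi_n = V - (n + 2) u_0] with [V = sum_i (-1)^i u_i], and [V] is
    cyclic. Finally [b u_0 = - phi_(n+2) / 2] ([hochschild_omit0]), so
    [S phi_n] and the multiple of [phi_(n+2)] prescribed by the normalization
    of the characters differ by the coboundary of a multiple of [V]
    ([character_S]).

    That [S] acts on classes is proved in the same language: if [beta] is a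
    cyclic cochain with [k + 1] arguments, then [S (b beta)] is a multiple of
    the coboundary of [D b beta + ((k + 3) / (k + 1)) b D beta], and this
    combination is cyclic ([periodicity_primitive_rot]).

    The analytic input is that the trace is defined on products of [N >= p]
    commutators [delta a] and is cyclic there, even when neither of the factors
    which are exchanged has a trace by itself. Adjoints, polar decompositions
    and the theorem of Lidskii are avoided as follows. A compact operator [T]
    attains its norm on the complement of finitely many vectors, and the
    maximizers [e_0, e_1, ...] found in succession are eigenvectors of [T^*T];
    so the operators [Q_n = T (1 - P_n)], with [P_n] the projection on the first
    [n] of them, have norm at most the singular value [s_n(T)], and
    [Q_n - Q_(n+1)] has rank one ([singular_approximable]). For a product of
    operators one takes the products of the [Q_n]: their increments still have
    bounded rank, and their norms are products of singular values, hence
    summable for [N] factors. Then the operator is the sum of the increments, a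
    series of finite-rank operators with summable nuclear norms, which has a
    trace in every orthonormal basis ([has_trace_series]). Cyclicity holds for
    each increment, being a matter of finite rank ([ideal_traceC]). *)

Import Order.TTheory GRing.Theory Num.Theory numFieldNormedType.Exports.
Local Open Scope classical_set_scope.
Local Open Scope complex_scope.
Local Open Scope ring_scope.

Set Implicit Arguments.
Unset Strict Implicit.
Unset Printing Implicit Defensive.

(** * Norms with real values *)

Section RealNorm.
Context {R : realType}.
Implicit Types V W : normedZmodType R[i].

Definition nrm V (x : V) : R := complex.Re `|x|.

Lemma nrmE V (x : V) : `|x| = (nrm x)%:C.
Proof. by rewrite RRe_real. Qed.

Lemma nrm_ge0 V (x : V) : 0 <= nrm x.
Proof. by rewrite -ler0c -nrmE. Qed.

Lemma nrm0 V : nrm (0 : V) = 0.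
Proof. by rewrite /nrm normr0. Qed.

Lemma nrm_eq0 V (x : V) : (nrm x == 0) = (x == 0).
Proof. by rewrite -(normr_eq0 x) nrmE (inj_eq (@complexI R)). Qed.

Lemma nrmN V (x : V) : nrm (- x) = nrm x.
Proof. by rewrite /nrm normrN. Qed.

Lemma nrmB V (x y : V) : nrm (x - y) = nrm (y - x).
Proof. by rewrite /nrm distrC. Qed.

Lemma nrmD V (x y : V) : nrm (x + y) <= nrm x + nrm y.
Proof. by rewrite -lecR rmorphD /= -!nrmE ler_normD. Qed.

Lemma nrm_sub V (x y : V) : nrm (x - y) <= nrm x + nrm y.
Proof. by rewrite (le_trans (nrmD _ _)) // nrmN. Qed.

Lemma nrm_triangle V (x y z : V) : nrm (x - z) <= nrm (x - y) + nrm (y - z).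
Proof. by rewrite (le_trans _ (nrmD _ _)) // addrA subrK. Qed.

Lemma nrmM (z w : R[i]) : nrm (z * w) = nrm z * nrm w.
Proof. by apply: (@complexI R); rewrite rmorphM /= -!nrmE normrM. Qed.

Lemma nrmZ (V : normedModType R[i]) (z : R[i]) (x : V) :
  nrm (z *: x) = nrm z * nrm x.
Proof. by apply: (@complexI R); rewrite rmorphM /= -!nrmE normrZ. Qed.

Lemma nrm_real (x : R) : 0 <= x -> nrm (x%:C : R[i]) = x.
Proof. by move=> x0; apply: (@complexI R); rewrite -nrmE ger0_norm ?ler0c. Qed.

Lemma nrm_le_norm V W (x : V) (y : W) (c : R) :
  (`|x| <= c%:C * `|y|) = (nrm x <= c * nrm y).
Proof. by rewrite !nrmE -rmorphM lecR. Qed.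

Lemma nrm_sum V (I : Type) (r : seq I) (P : pred I) (F : I -> V) :
  nrm (\sum_(i <- r | P i) F i) <= \sum_(i <- r | P i) nrm (F i).
Proof.
elim/big_rec2: _ => [|i y x _ le_xy]; first by rewrite nrm0.
by rewrite (le_trans (nrmD _ _)) // lerD2l.
Qed.

Lemma nrm_sqr (z : R[i]) : ((nrm z) ^+ 2)%:C = z * z^*.
Proof. by rewrite rmorphXn /= -nrmE sqr_normc. Qed.

Definition tends V (u : nat -> V) (l : V) : Prop :=
  forall e : R, 0 < e -> exists N, forall n, (N <= n)%N -> nrm (u n - l) < e.

Lemma tends_unique V (u : nat -> V) l l' : tends u l -> tends u l' -> l = l'.
Proof.
move=> ul ul'; apply/eqP; rewrite -subr_eq0 -nrm_eq0 -[_ == _]negbK.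
apply/negP => n0; have d0 : 0 < nrm (l - l') by rewrite lt0r n0 nrm_ge0.
have [|N HN] := ul (nrm (l - l') / 2); first by rewrite divr_gt0.
have [|N' HN'] := ul' (nrm (l - l') / 2); first by rewrite divr_gt0.
have h1 := HN _ (leq_maxl N N'); have h2 := HN' _ (leq_maxr N N').
have : nrm (l - l') <= nrm (u (maxn N N') - l) + nrm (u (maxn N N') - l').
  by rewrite (nrmB (u _) l) nrm_triangle.
by lra.
Qed.

Lemma tends_const V (l : V) : tends (fun=> l) l.
Proof. by move=> e e0; exists 0%N => n _; rewrite subrr nrm0. Qed.

Lemma tends_le V (u : nat -> V) l (c : R) N :
  tends u l -> (forall n, (N <= n)%N -> nrm (u n) <= c) -> nrm l <= c.
Proof.
move=> ul uc; rewrite leNgt; apply/negP => lc.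
have [|N1 HN] := ul (nrm l - c); first by rewrite subr_gt0.
have h1 := HN _ (leq_maxl N1 N); have h2 := uc _ (leq_maxr N1 N).
have : nrm l <= nrm (u (maxn N1 N) - l) + nrm (u (maxn N1 N)).
  by rewrite nrmB (le_trans _ (nrmD _ _)) // subrK.
by lra.
Qed.

Lemma tendsD V (u v : nat -> V) l l' :
  tends u l -> tends v l' -> tends (fun n => u n + v n) (l + l').
Proof.
move=> ul vl e e0; have e2 : 0 < e / 2 by rewrite divr_gt0.
have [N HN] := ul _ e2; have [N' HN'] := vl _ e2; exists (maxn N N') => n.
rewrite geq_max => /andP[/HN h1 /HN' h2].
rewrite opprD addrACA (le_lt_trans (nrmD _ _)) //; lra.
Qed.

Lemma tends_lip V W (f : V -> W) (c : R) (u : nat -> V) l :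
  (forall x y, nrm (f x - f y) <= c * nrm (x - y)) -> tends u l ->
  tends (fun n => f (u n)) (f l).
Proof.
move=> fc ul e e0.
have c0 : 0 < `|c| + 1 by rewrite ltr_wpDl.
have [|N HN] := ul (e / (`|c| + 1)); first by rewrite divr_gt0.
exists N => n /HN; rewrite ltr_pdivlMr // => h.
apply: le_lt_trans (fc _ _) _; apply: le_lt_trans h.
rewrite mulrC; apply: ler_wpM2l; first exact: nrm_ge0.
by rewrite (le_trans (ler_norm c)) // lerDl.
Qed.

Lemma eq_tends V (u v : nat -> V) l : u =1 v -> tends u l -> tends v l.
Proof. by move=> uv ul e /ul[N HN]; exists N => n; rewrite -uv; apply: HN. Qed.

Lemma tends_cvg (V : normedModType R[i]) (u : nat -> V) l :
  tends u l <-> u @ \oo --> l.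
Proof.
split=> [ul|/cvgrPdist_lt ul].
- apply/cvgrPdist_lt => e e0.
  have er : e = (complex.Re e)%:C by rewrite RRe_real // gtr0_real.
  have [|N HN] := ul (complex.Re e); first by rewrite -ltcR -er.
  by exists N => // n /= /HN; rewrite -ltcR -nrmE -er distrC.
- move=> e e0; have [|N _ HN] := ul e%:C; first by rewrite ltcR.
  by exists N => n /HN; rewrite /= nrmE ltcR nrmB.
Qed.

Definition nrm_cauchy V (u : nat -> V) : Prop :=
  forall e : R, 0 < e -> exists N, forall m n, (N <= m)%N -> (N <= n)%N ->
    nrm (u m - u n) < e.

Lemma nrm_cauchy_cvg (V : completeNormedModType R[i]) (u : nat -> V) :
  nrm_cauchy u -> exists l, tends u l.
Proof.
move=> uc; suff : cvg (u @ \oo).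
  by move=> /cvg_ex[l /tends_cvg ul]; exists l.
apply/cauchy_cvgP/cauchyP => e e0.
have er : e = (complex.Re e)%:C by rewrite RRe_real // gtr0_real.
have [|N HN] := uc (complex.Re e); first by rewrite -ltcR -er.
exists (u N), N => // n /= Nn; rewrite -ball_normE /=.
by rewrite er nrmE ltcR; apply: HN.
Qed.

Lemma nrm_Re (z : R[i]) : `|complex.Re z| <= nrm z.
Proof. by rewrite -lecR -nrmE normc_ge_Re. Qed.

Lemma nrm_Im (z : R[i]) : `|complex.Im z| <= nrm z.
Proof.
have := nrm_Re (z * 'i%C); rewrite ReiNIm normrN nrmM.
rewrite [nrm 'i%C](_ : _ = 1) ?mulr1 //.
by apply: (@complexI R); rewrite -nrmE normc_def /= expr0n expr1n add0r sqrtr1.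
Qed.

Lemma nrm_le_ReIm (z : R[i]) : nrm z <= `|complex.Re z| + `|complex.Im z|.
Proof.
have i1 : nrm ('i%C : R[i]) = 1.
  apply: (@complexI R).
  by rewrite -nrmE normc_def /= expr0n expr1n add0r sqrtr1.
rewrite {1}[z]complexE (le_trans (nrmD _ _)) // nrmM i1 mul1r.
have nC (x : R) : nrm (x%:C : R[i]) = `|x|.
  have [x0|x0] := leP 0 x; first by rewrite nrm_real ?ger0_norm.
  by rewrite -nrmN -rmorphN /= nrm_real ?ltr0_norm // oppr_ge0 ltW.
by rewrite !nC.
Qed.

End RealNorm.

Section BoundedSeries.
Context {R : realType}.

Definition bounded_sums (g : nat -> R) : Prop :=
  exists S, forall n, \sum_(0 <= k < n) g k <= S.

(** The tails of a series with nonnegative terms and bounded partial sums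
    are uniformly small, which is all that is needed about its sum. *)
Lemma bounded_sums_tail (g : nat -> R) (g0 : forall n, 0 <= g n) :
  bounded_sums g -> forall e, 0 < e -> exists N, forall m n, (N <= m)%N ->
    (m <= n)%N -> \sum_(m <= k < n) g k < e.
Proof.
move=> [S HS] e e0.
have [N HN] : exists N, forall n, (N <= n)%N ->
    \sum_(0 <= k < n) g k - \sum_(0 <= k < N) g k < e.
  apply: contrapT => /forallNP H.
  have step N : exists n, (N <= n)%N /\
      e <= \sum_(0 <= k < n) g k - \sum_(0 <= k < N) g k.
    have /existsNP[n /not_implyP[Nn /negP]] := H N.
    by rewrite -leNgt => h; exists n.
  have grow j : exists n, e * j%:R <= \sum_(0 <= k < n) g k.
    elim: j => [|j [n IH]]; first by exists 0%N; rewrite mulr0 big_geq.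
    have [n' [_ h]] := step n; exists n'; rewrite -natr1 mulrDr mulr1; lra.
  have [n] := grow (Num.bound `|S / e|).
  have := HS n; have : S < e * (Num.bound `|S / e|)%:R.
    rewrite mulrC -ltr_pdivrMr // (le_lt_trans (ler_norm _)) //.
    exact: archi_boundP.
  by lra.
exists N => m n Nm mn.
have := HN n (leq_trans Nm mn).
rewrite (big_cat_nat (leq0n N) (leq_trans Nm mn)) /= addrAC subrr add0r.
rewrite (big_cat_nat Nm mn) /=.
have : 0 <= \sum_(N <= k < m) g k by apply: sumr_ge0.
by lra.
Qed.

End BoundedSeries.

(** * Orthonormal families *)

Section InnerProduct.
Context {R : realType} {H : hilbert R}.
Implicit Types (x y : H) (e : nat -> H).

Lemma dotDl x x' y : dot (x + x') y = dot x y + dot x' y.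
Proof. by have := dot_linear 1 x x' y; rewrite scale1r mul1r. Qed.

Lemma dot0l y : dot 0 y = 0.
Proof. by have := dotDl 0 0 y; rewrite addr0 => /esym/(canRL (addrK _)); rewrite subrr. Qed.

Lemma dotZl z x y : dot (z *: x) y = z * dot x y.
Proof. by have := dot_linear z x 0 y; rewrite addr0 dot0l addr0. Qed.

Lemma dotNl x y : dot (- x) y = - dot x y.
Proof. by rewrite -scaleN1r dotZl mulN1r. Qed.

Lemma dotBl x x' y : dot (x - x') y = dot x y - dot x' y.
Proof. by rewrite dotDl dotNl. Qed.

Lemma dotDr x y y' : dot x (y + y') = dot x y + dot x y'.
Proof. by rewrite dotC dotDl rmorphD /= -!dotC. Qed.

Lemma dotZr z x y : dot x (z *: y) = z^* * dot x y.
Proof. by rewrite dotC dotZl rmorphM /= -dotC. Qed.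

Lemma dot0r x : dot x 0 = 0.
Proof. by rewrite dotC dot0l rmorph0. Qed.

Lemma dotNr x y : dot x (- y) = - dot x y.
Proof. by rewrite dotC dotNl rmorphN /= -dotC. Qed.

Lemma dotBr x y y' : dot x (y - y') = dot x y - dot x y'.
Proof. by rewrite dotDr dotNr. Qed.

Lemma dot_suml (I : Type) (r : seq I) (P : pred I) (F : I -> H) y :
  dot (\sum_(i <- r | P i) F i) y = \sum_(i <- r | P i) dot (F i) y.
Proof.
by elim/big_rec2: _ => [|i y1 y2 _ <-]; rewrite ?dot0l // dotDl.
Qed.

Lemma dotxx x : dot x x = ((nrm x) ^+ 2)%:C.
Proof. by rewrite dot_norm nrmE rmorphXn. Qed.

Lemma dot_eq0C x y : dot x y = 0 -> dot y x = 0.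
Proof. by rewrite dotC => xy; rewrite -[dot y x]conjCK xy conjC0. Qed.

Lemma cauchy_schwarz x y : nrm (dot x y) <= nrm x * nrm y.
Proof.
have [->|y0] := eqVneq y 0; first by rewrite dot0r !nrm0 mulr0.
set b := dot x y; set Y := nrm y ^+ 2; set X := nrm x ^+ 2; set B := nrm b ^+ 2.
have bb : B%:C = b * b^* by apply: nrm_sqr.
have Y0 : 0 < Y by rewrite exprn_gt0 // lt0r nrm_eq0 y0 nrm_ge0.
pose v := Y%:C *: x - b *: y.
have cY : (Y%:C : R[i])^* = Y%:C by apply: conjc_real.
have vv : dot v v = Y%:C * (X%:C * Y%:C - B%:C).
  rewrite /v !(dotBl, dotBr, dotZl, dotZr) !dotxx -/X -/Y.
  by rewrite cY (dotC y x) -/b bb; ring.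
have h : nrm v ^+ 2 = Y * (X * Y - B).
  have cE (r s t : R) : (r * (s * r - t))%:C = r%:C * (s%:C * r%:C - t%:C).
    by rewrite rmorphM rmorphB rmorphM.
  by apply: (@complexI R); rewrite -dotxx vv cE.
have h0 : 0 <= Y * (X * Y - B) by rewrite -h sqr_ge0.
rewrite pmulr_rge0 // subr_ge0 in h0.
rewrite -(@ler_pXn2r _ 2) // ?nnegrE ?mulr_ge0 ?nrm_ge0 //.
by rewrite exprMn.
Qed.

Lemma pythagoras x y : dot x y = 0 ->
  nrm (x + y) ^+ 2 = nrm x ^+ 2 + nrm y ^+ 2.
Proof.
move=> xy; apply: (@complexI R).
by rewrite rmorphD /= -!dotxx dotDl !dotDr xy (dot_eq0C xy) addr0 add0r.
Qed.

Lemma parallelogram x y :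
  nrm (x + y) ^+ 2 + nrm (x - y) ^+ 2 = 2 * (nrm x ^+ 2 + nrm y ^+ 2).
Proof.
apply: (@complexI R).
have cE (a b c d : R) : a%:C + b%:C = 2 * (c%:C + d%:C) ->
    (a + b)%:C = (2 * (c + d))%:C.
  by move=> h; rewrite rmorphD rmorphM rmorph_nat rmorphD.
apply: cE; rewrite -!dotxx !(dotDl, dotDr, dotNl, dotNr); ring.
Qed.

(** Orthonormal up to zeros: the Gram-Schmidt process may be run on dependent
    vectors, and every finite or infinite orthonormal family is then indexed
    by all the natural numbers. *)
Definition ortho0 e : Prop :=
  forall j k, dot (e j) (e k) = ((j == k) && (e k != 0))%:R.

Definition proj e (n : nat) x : H := \sum_(0 <= k < n) dot x (e k) *: e k.

Lemma projS e n x : proj e n.+1 x = proj e n x + dot x (e n) *: e n.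
Proof. by rewrite /proj big_nat_recr. Qed.

Section Ortho0.
Variable e : nat -> H.
Hypothesis e_on : ortho0 e.

Lemma ortho0_unit k : e k != 0 -> nrm (e k) = 1.
Proof.
move=> ek; have := e_on k k; rewrite eqxx ek /= dotxx => /(@complexI R _ 1).
by move=> /eqP; rewrite sqrp_eq1 ?nrm_ge0 // => /eqP.
Qed.

Lemma ortho0_le1 k : nrm (e k) <= 1.
Proof.
have [->|/ortho0_unit -> //] := eqVneq (e k) 0.
by rewrite nrm0.
Qed.

Lemma dot_proj n x k : (k < n)%N -> dot (proj e n x) (e k) = dot x (e k).
Proof.
move=> kn; rewrite dot_suml (bigD1_seq k) ?mem_index_iota ?iota_uniq //=.
rewrite dotZl e_on eqxx /= big1 => [|j jk]; last first.
  by rewrite dotZl e_on (negbTE jk) mulr0.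
by case: eqP => [->|_]; rewrite ?dot0r ?mul0r ?mulr1 addr0.
Qed.

Lemma dot_sub_proj n x k : (k < n)%N -> dot (x - proj e n x) (e k) = 0.
Proof. by move=> kn; rewrite dotBl dot_proj ?subrr. Qed.

Lemma dot_projr n x y : (forall k, (k < n)%N -> dot x (e k) = 0) ->
  dot x (proj e n y) = 0.
Proof.
move=> xe; rewrite dotC dot_suml big_nat big1 ?conjC0 // => k /= kn.
by rewrite dotZl (dot_eq0C (xe k kn)) mulr0.
Qed.

Lemma proj_pythagoras n x :
  nrm x ^+ 2 = nrm (x - proj e n x) ^+ 2 + nrm (proj e n x) ^+ 2.
Proof.
rewrite -pythagoras ?subrK // dot_projr // => k kn.
exact: dot_sub_proj.
Qed.

Lemma le_sqr_nrm x y : nrm x ^+ 2 <= nrm y ^+ 2 -> nrm x <= nrm y.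
Proof. by move=> h; rewrite -(@ler_pXn2r _ 2) // nnegrE nrm_ge0. Qed.

Lemma nrm_sub_proj n x : nrm (x - proj e n x) <= nrm x.
Proof. by apply: le_sqr_nrm; rewrite (proj_pythagoras n x) lerDl sqr_ge0. Qed.

Lemma nrm_proj n x : nrm (proj e n x) <= nrm x.
Proof. by apply: le_sqr_nrm; rewrite (proj_pythagoras n x) lerDr sqr_ge0. Qed.

Lemma proj_cauchy x : nrm_cauchy (fun n => proj e n x).
Proof.
pose g k := nrm (dot x (e k) *: e k) ^+ 2.
have sg n : \sum_(0 <= k < n) g k = nrm (proj e n x) ^+ 2.
  elim: n => [|n IH]; first by rewrite /proj !big_geq // nrm0 expr0n.
  rewrite big_nat_recr //= IH projS pythagoras // dot_suml big_nat big1 //.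
  by move=> k /= kn; rewrite dotZl dotZr e_on ltn_eqF //= !mulr0.
have bg : bounded_sums g.
  exists (nrm x ^+ 2) => n; rewrite sg.
  by rewrite (proj_pythagoras n x) lerDr sqr_ge0.
have dist m n : (m <= n)%N ->
    nrm (proj e n x - proj e m x) ^+ 2 = \sum_(m <= k < n) g k.
  move=> mn; have -> : proj e n x - proj e m x =
      \sum_(m <= k < n) dot x (e k) *: e k.
    by rewrite /proj (big_cat_nat (leq0n m) mn) /= addrAC subrr add0r.
  elim: n mn => [|n IH]; first by rewrite leqn0 => /eqP->; rewrite !big_geq // nrm0 expr0n.
  rewrite leq_eqVlt => /orP[/eqP->|mn]; first by rewrite !big_geq // nrm0 expr0n.
  rewrite !big_nat_recr //= pythagoras ?IH // dot_suml big_nat big1 //.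
  by move=> k /andP[_ /= kn]; rewrite dotZl dotZr e_on ltn_eqF //= !mulr0.
move=> d d0; have [|N HN] := bounded_sums_tail _ bg (exprn_gt0 2 d0).
  by move=> n; apply: sqr_ge0.
exists N => m n Nm Nn.
wlog mn : m n Nm Nn / (m <= n)%N.
  by move=> W; case/orP: (leq_total m n) => h; [|rewrite nrmB]; apply: W.
rewrite nrmB -(@ltr_pXn2r _ 2) // ?nnegrE ?nrm_ge0 ?ltW //.
by rewrite dist // HN.
Qed.

(** Completeness enters here: the partial projections form a Cauchy sequence
    by Bessel's inequality, and their limit differs from [x] by a vector
    orthogonal to a total family. *)
Lemma proj_tends x : (forall y, (forall k, dot y (e k) = 0) -> y = 0) ->
  tends (fun n => proj e n x) x.
Proof.
move=> tot; have [l xl] := nrm_cauchy_cvg (proj_cauchy x).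
suff xl0 : x = l by rewrite [X in tends _ X]xl0.
apply/eqP; rewrite -subr_eq0; apply/eqP/tot => k.
have dl : tends (fun n => dot (proj e n x) (e k)) (dot l (e k)).
  apply: (tends_lip (f := fun y => dot y (e k)) (c := nrm (e k)) _ xl) => u v.
  by rewrite -dotBl mulrC cauchy_schwarz.
apply/eqP; rewrite dotBl subr_eq0; apply/eqP/(tends_unique _ dl).
move=> d d0; exists k.+1 => n kn.
by rewrite dot_proj // subrr nrm0.
Qed.

End Ortho0.

(** Gram-Schmidt: [w_n] is the normalization of the component of [v_n]
    orthogonal to the earlier ones. *)
Lemma gram_schmidt (v : nat -> H) : exists2 w, ortho0 w &
  forall y, (forall k, dot y (w k) = 0) -> forall n, dot y (v n) = 0.
Proof.
pose pr (s : seq H) x := x - \sum_(u <- s) dot x u *: u.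
pose step n s := let x := pr s (v n) in rcons s ((nrm x)^-1%:C *: x).
pose st := fix st n := if n is n'.+1 then step n' (st n') else [::].
pose w n := let x := pr (st n) (v n) in (nrm x)^-1%:C *: x.
have stE n : st n = [seq w k | k <- iota 0 n].
  by elim: n => // n IH; rewrite -addn1 iotaD map_cat -IH addn1 /= cats1.
have wE n : w n = (nrm (v n - proj w n (v n)))^-1%:C *: (v n - proj w n (v n)).
  by rewrite /w /pr stE big_map /proj /index_iota subn0.
have w_on n : forall j k, (j < n)%N -> (k < n)%N ->
    dot (w j) (w k) = ((j == k) && (w k != 0))%:R.
  elim: n => // n IH.
  pose x := v n - proj w n (v n).
  have ox k : (k < n)%N -> dot x (w k) = 0.
    move=> kn; rewrite /x dotBl /proj dot_suml big_nat.
    rewrite (eq_bigr (fun j => dot (v n) (w j) * ((j == k) && (w k != 0))%:R));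
      last by move=> j /= jn; rewrite dotZl IH.
    rewrite -big_nat (bigD1_seq k) ?mem_index_iota ?iota_uniq //= eqxx /=.
    rewrite big1 => [|j jk]; last by rewrite (negbTE jk) mulr0.
    by case: eqP => [->|_]; rewrite ?dot0r ?mul0r ?mulr1 addr0 subrr.
  have ow k : (k < n)%N -> dot (w n) (w k) = 0.
    by move=> kn; rewrite (wE n) dotZl ox ?mulr0.
  move=> j k; rewrite !ltnS (leq_eqVlt j) (leq_eqVlt k) => /orP[/eqP->|jn] /orP[/eqP->|kn].
  - rewrite eqxx /= dotxx (wE n) nrmZ -/x.
    have [->|x0] := eqVneq x 0; first by rewrite nrm0 mulr0 expr0n scaler0 eqxx.
    have nx : nrm x != 0 by rewrite nrm_eq0.
    rewrite nrm_real ?invr_ge0 ?nrm_ge0 // mulVf // expr1n.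
    rewrite scaler_eq0 negb_or x0 andbT.
    by rewrite -nrm_eq0 nrm_real ?invr_ge0 ?nrm_ge0 // invr_eq0 nx.
  - by rewrite ow // gtn_eqF.
  - by rewrite (dot_eq0C (ow _ jn)) ltn_eqF.
  - exact: IH.
exists w => [j k|y yw n].
  by apply: (w_on (maxn j k).+1); rewrite ltnS ?leq_maxl ?leq_maxr.
pose x := v n - proj w n (v n).
have -> : v n = (nrm x)%:C *: w n + proj w n (v n).
  rewrite wE scalerA -/x.
  have [x0|x0] := eqVneq x 0.
    by rewrite x0 scaler0 add0r; apply/eqP; rewrite -subr_eq0 -/x x0.
  by rewrite -rmorphM mulfV ?nrm_eq0 // scale1r /x subrK.
by rewrite dotDr dotZr yw mulr0 add0r dot_projr.
Qed.

Lemma total_ortho0_exists : exists2 w : nat -> H, ortho0 w &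
  forall y, (forall k, dot y (w k) = 0) -> y = 0.
Proof.
have [S cS dS] := hilbert_separable H.
have [v vS] : exists v : nat -> H, S `<=` range v.
  have [S0|[v]] := elimT pfcard_geP cS; first by exists (fun=> 0); rewrite S0.
  by exists v; apply: (@surj _ _ _ _ v).
have [w won wtot] := gram_schmidt v; exists w => // y yw.
have yS s : S s -> dot y s = 0 by move=> /vS[n _ <-]; apply: wtot.
apply/eqP; apply/negPn/negP => y0.
have d0 : 0 < nrm y by rewrite lt0r nrm_eq0 y0 nrm_ge0.
have [||s [/= By Ss]] := dS (ball y (nrm y)%:C).
- by exists y; apply: ballxx; rewrite ltcR.
- exact: ball_open.
move: By; rewrite -ball_normE /= nrmE ltcR; apply/negP; rewrite -leNgt.
apply: le_sqr_nrm; rewrite pythagoras ?nrmN ?lerDl ?sqr_ge0 //.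
by rewrite dotNr yS ?oppr0.
Qed.

(** Sets of indices in [orthonormal_basis] are traded for zero vectors. *)
Lemma orthonormal_basis_ortho0 J e : orthonormal_basis J e ->
  let e' k := if k \in J then e k else 0 in
  ortho0 e' /\ forall y, (forall k, dot y (e' k) = 0) -> y = 0.
Proof.
move=> [on tot] /=; split=> [j k|y ye].
  have e0 i : i \in J -> e i != 0.
    move=> iJ; apply/eqP => ei; have := on i i (set_mem iJ) (set_mem iJ).
    by rewrite ei dot0l eqxx => /esym/eqP; rewrite oner_eq0.
  case: ifPn => [jJ|jJ]; last first.
    rewrite dot0l; case: eqP => //= <-; by rewrite (negbTE jJ) eqxx.
  case: ifPn => [kJ|kJ]; last by rewrite dot0r eqxx andbF.
  by rewrite on ?e0 ?andbT //; apply: set_mem.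
apply: tot => j jJ; have := ye j; by rewrite mem_set.
Qed.

Lemma orthonormal_basis_exists : exists J (e : nat -> H), orthonormal_basis J e.
Proof.
have [w won wtot] := total_ortho0_exists.
exists [set k | w k != 0], w; split=> [j k /= wj wk|y yw].
  by rewrite won wk andbT.
apply: wtot => k; have [->|wk] := eqVneq (w k) 0; first by rewrite dot0r.
exact: yw.
Qed.

End InnerProduct.

(** * Traces of series of finite-rank operators *)

Section ComplexSeries.
Context {R : realType}.

Lemma real_cauchy_cvg (u : nat -> R) :
  (forall e, 0 < e -> exists N, forall m n, (N <= m)%N -> (N <= n)%N ->
    `|u m - u n| < e) ->
  exists l, forall e, 0 < e -> exists N, forall n, (N <= n)%N -> `|u n - l| < e.
Proof.
move=> uc; suff : cvg (u @ \oo).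
  move=> /cvg_ex[l /cvgrPdist_lt ul]; exists l => e /ul[N _ HN].
  by exists N => n /HN; rewrite /= distrC.
apply/cauchy_cvgP/cauchyP => e e0; have [N HN] := uc e e0.
exists (u N), N => // n /= Nn; rewrite -ball_normE /=.
exact: HN.
Qed.

Lemma complex_cauchy_cvg (u : nat -> R[i]) :
  nrm_cauchy u -> exists l, tends u l.
Proof.
move=> uc.
have ReB (z w : R[i]) : complex.Re (z - w) = complex.Re z - complex.Re w.
  by case: z; case: w.
have ImB (z w : R[i]) : complex.Im (z - w) = complex.Im z - complex.Im w.
  by case: z; case: w.
have [a Ha] : exists l, forall e, 0 < e -> exists N, forall n, (N <= n)%N ->
    `|complex.Re (u n) - l| < e.
  apply: real_cauchy_cvg => e /uc[N HN]; exists N => m n Nm Nn.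
  by rewrite -ReB (le_lt_trans (nrm_Re _)) // HN.
have [b Hb] : exists l, forall e, 0 < e -> exists N, forall n, (N <= n)%N ->
    `|complex.Im (u n) - l| < e.
  apply: real_cauchy_cvg => e /uc[N HN]; exists N => m n Nm Nn.
  by rewrite -ImB (le_lt_trans (nrm_Im _)) // HN.
exists (a +i* b) => e e0; have e2 : 0 < e / 2 by rewrite divr_gt0.
have [N HN] := Ha _ e2; have [N' HN'] := Hb _ e2; exists (maxn N N') => n.
rewrite geq_max => /andP[/HN h1 /HN' h2].
apply: le_lt_trans (nrm_le_ReIm _) _; rewrite ReB ImB /=; lra.
Qed.

Lemma series_cvg (z : nat -> R[i]) (g : nat -> R) :
  (forall n, 0 <= g n) -> bounded_sums g -> (forall n, nrm (z n) <= g n) ->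
  exists l, tends (fun m => \sum_(0 <= n < m) z n) l.
Proof.
move=> g0 bg zg; apply: complex_cauchy_cvg => e e0.
have [N HN] := bounded_sums_tail g0 bg e0.
exists N => m n Nm Nn.
wlog mn : m n Nm Nn / (m <= n)%N.
  by move=> W; case/orP: (leq_total m n) => h; [|rewrite nrmB]; apply: W.
rewrite nrmB (big_cat_nat (leq0n m) mn) /= addrAC subrr add0r.
apply: le_lt_trans (nrm_sum _ _ _) _; apply: le_lt_trans (HN m n Nm mn).
exact: ler_sum.
Qed.

End ComplexSeries.

Section TraceIdeals.
Context {R : realType} {H : hilbert R}.
Implicit Types (x y v : H) (e : nat -> H) (T X Y Z D : H -> H).

Definition bop (a : R) X : Prop :=
  [/\ linear X, forall x, nrm (X x) <= a * nrm x & 0 <= a].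

Lemma bop_linear a X : bop a X -> forall z x y, X (z *: x + y) = z *: X x + X y.
Proof. by case. Qed.

Lemma bop0 a X : bop a X -> X 0 = 0.
Proof. by case=> /linear_map0. Qed.

Lemma bopD a X x y : bop a X -> X (x + y) = X x + X y.
Proof. by move=> /bop_linear/(_ 1 x y); rewrite !scale1r. Qed.

Lemma bopZ a X z x : bop a X -> X (z *: x) = z *: X x.
Proof. by move=> hX; have := bop_linear hX z x 0; rewrite (bop0 hX) !addr0. Qed.

Lemma bopB a X x y : bop a X -> X (x - y) = X x - X y.
Proof. by move=> hX; rewrite (bopD _ _ hX) -scaleN1r (bopZ _ _ hX) scaleN1r. Qed.

Lemma bop_id : bop 1 (fun x => x).
Proof. by split=> // x; rewrite mul1r. Qed.

Lemma bop_comp a b X Y : bop a X -> bop b Y -> bop (a * b) (fun x => X (Y x)).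
Proof.
move=> hX hY; split=> [z x y|x|].
- by rewrite (bop_linear hY) (bop_linear hX).
- case: hX hY => _ hX a0 [_ hY _]; rewrite (le_trans (hX _)) // -mulrA.
  by rewrite ler_wpM2l.
- by case: hX hY => _ _ a0 [_ _ b0]; rewrite mulr_ge0.
Qed.

Lemma bop_le a b X : a <= b -> bop a X -> bop b X.
Proof.
move=> ab [lX hX a0]; split=> [//|x|]; last exact: le_trans ab.
by rewrite (le_trans (hX x)) // ler_wpM2r // nrm_ge0.
Qed.

Definition total e : Prop := forall y, (forall k, dot y (e k) = 0) -> y = 0.

Definition diag_sum e T (K : nat) : R[i] :=
  \sum_(0 <= k < K) dot (T (e k)) (e k).

Definition trace_bound (c : R) T (t : R[i]) : Prop :=
  forall e, ortho0 e -> total e ->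
    tends (diag_sum e T) t /\ forall K, nrm (diag_sum e T K) <= c.

Lemma diag_sumD e T T' K :
  diag_sum e (fun x => T x + T' x) K = diag_sum e T K + diag_sum e T' K.
Proof. by rewrite /diag_sum -big_split /=; apply: eq_bigr => k _; rewrite dotDl. Qed.

Lemma trace_boundD c c' T T' t t' : trace_bound c T t -> trace_bound c' T' t' ->
  trace_bound (c + c') (fun x => T x + T' x) (t + t').
Proof.
move=> h h' e eo et; have [ht hc] := h e eo et; have [ht' hc'] := h' e eo et.
split=> [|K]; last by rewrite diag_sumD (le_trans (nrmD _ _)) // lerD.
by apply: eq_tends (tendsD ht ht') => K; rewrite diag_sumD.
Qed.

Lemma trace_bound_le c c' T t : c <= c' -> trace_bound c T t ->
  trace_bound c' T t.
Proof.
move=> cc h e eo et; have [ht hc] := h e eo et.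
by split=> // K; rewrite (le_trans (hc K)).
Qed.

Lemma trace_bound_nrm c T t : trace_bound c T t -> nrm t <= c.
Proof.
move=> h; have [e eo et] := @total_ortho0_exists R H.
by have [ht hc] := h e eo et; apply: (tends_le (N := 0) ht).
Qed.

(** The properties of an operator of finite rank and of nuclear norm at most
    [c] that are used. The second one says more than that traces exist: the
    trace of [X D Y] depends on [X] and [Y] through the product [Y X] only, and
    this is the source of all trace identities below. Rank-one operators satisfy
    it, and it is stable under sums and under products with bounded operators. *)
Definition nuclear (c : R) D : Prop := 0 <= c /\
  exists t : (H -> H) -> R[i], forall X Y a b, bop a X -> bop b Y ->
    trace_bound (c * a * b) (fun x => X (D (Y x))) (t (fun x => Y (X x))).

(** In any orthonormal basis the diagonal sums of [phi(.) v] are the values of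
    [phi] at the projections of [v]. *)
Lemma nuclear_rank1 (phi : H -> R[i]) v (c d : R) : 0 <= c ->
  (forall z x y, phi (z *: x + y) = z * phi x + phi y) ->
  (forall x, nrm (phi x) <= c * nrm x) -> c * nrm v <= d ->
  nuclear d (fun x => phi x *: v).
Proof.
move=> c0 lphi hphi cd; have d0 : 0 <= d.
  by rewrite (le_trans _ cd) // mulr_ge0 // nrm_ge0.
split=> //; exists (fun Z => phi (Z v)) => X Y a b hX hY e eo et.
have phi0 : phi 0 = 0.
  have := hphi 0; rewrite nrm0 mulr0 => h.
  by apply/eqP; rewrite -nrm_eq0 eq_le h nrm_ge0.
have dE K : diag_sum e (fun x => X (phi (Y x) *: v)) K
          = phi (Y (proj e K (X v))).
  elim: K => [|K IH].
    by rewrite /diag_sum /proj !big_geq // (bop0 hY) phi0.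
  rewrite projS addrC (bop_linear hY) lphi addrC -IH.
  by rewrite /diag_sum big_nat_recr //= (bopZ _ _ hX) dotZl mulrC.
have hb x : nrm (phi (Y x)) <= c * b * nrm x.
  by case: hY => _ hY _; rewrite (le_trans (hphi _)) // -mulrA ler_wpM2l.
split=> [|K].
  apply: (eq_tends (fun K => esym (dE K))).
  apply: (tends_lip (f := fun x => phi (Y x)) (c := c * b) _ (proj_tends eo (X v) et)) => x y.
  rewrite [phi (Y x) - _](_ : _ = phi (Y (x - y))) //.
  rewrite (bopB _ _ hY) [Y x - _]addrC -[- Y y]scaleN1r lphi mulN1r addrC //.
rewrite dE (le_trans (hb _)) //; case: hX hY => _ hX a0 [_ _ b0].
apply: (@le_trans _ _ (c * b * (a * nrm v))).
  by rewrite ler_wpM2l ?mulr_ge0 // (le_trans (nrm_proj eo _ _)).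
have -> : d * a * b = d * (a * b) by ring.
have -> : c * b * (a * nrm v) = c * nrm v * (a * b) by ring.
by rewrite ler_wpM2r ?mulr_ge0.
Qed.

Lemma nuclear0 c : 0 <= c -> nuclear c (fun=> 0).
Proof.
move=> c0; have := @nuclear_rank1 (fun=> 0) 0 0 c; rewrite mul0r.
rewrite (_ : (fun _ => _ *: _) = (fun=> 0)); last by apply/funext => x; rewrite scale0r.
by apply=> // [z x y|x]; rewrite ?mulr0 ?addr0 ?nrm0 ?mul0r.
Qed.

Lemma nuclearD c c' D D' : nuclear c D -> nuclear c' D' ->
  nuclear (c + c') (fun x => D x + D' x).
Proof.
move=> [c0 [t ht]] [c0' [t' ht']]; split; first by rewrite addr_ge0.
exists (fun Z => t Z + t' Z) => X Y a b hX hY.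
rewrite !mulrDl; have := trace_boundD (ht _ _ _ _ hX hY) (ht' _ _ _ _ hX hY).
congr (trace_bound _ _ _); apply/funext => x; by rewrite (bopD _ _ hX).
Qed.

Lemma nuclear_le c c' D : c <= c' -> nuclear c D -> nuclear c' D.
Proof.
move=> cc [c0 [t ht]]; split; first exact: le_trans cc.
exists t => X Y a b hX hY; apply: trace_bound_le (ht _ _ _ _ hX hY).
by case: hX hY => _ _ a0 [_ _ b0]; rewrite !ler_wpM2r.
Qed.

Lemma nuclear_compr c D b Y : nuclear c D -> bop b Y ->
  nuclear (c * b) (fun x => D (Y x)).
Proof.
move=> [c0 [t ht]] hY; split; first by case: hY => _ _ b0; rewrite mulr_ge0.
exists (fun Z => t (fun x => Y (Z x))) => X Z a d hX hZ.
have := ht _ _ _ _ hX (bop_comp hY hZ).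
by rewrite (_ : c * b * a * d = c * a * (b * d)) //; ring.
Qed.

Lemma nuclear_compl c D a X : bop a X -> nuclear c D ->
  nuclear (a * c) (fun x => X (D x)).
Proof.
move=> hX [c0 [t ht]]; split; first by case: hX => _ _ a0; rewrite mulr_ge0.
exists (fun Z => t (fun x => Z (X x))) => Z Y b d hZ hY.
have := ht _ _ _ _ (bop_comp hZ hX) hY.
by rewrite (_ : a * c * b * d = c * (b * a) * d) //; ring.
Qed.

(** As the tails of the series are small uniformly in the length of the diagonal
    sums, the trace may be computed termwise. *)
Lemma has_trace_series (Q : nat -> H -> H) (g : nat -> R) (t : nat -> R[i]) s :
  (forall n, 0 <= g n) -> bounded_sums g -> (forall n, bop (g n) (Q n)) ->
  (forall n, trace_bound (g n) (fun x => Q n x - Q n.+1 x) (t n)) ->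
  tends (fun m => \sum_(0 <= n < m) t n) s -> has_trace (Q 0%N) s.
Proof.
move=> g0 bg hQ ht ts J e eb.
have [] := orthonormal_basis_ortho0 eb.
set e' := fun k => _; move=> e'o e't.
rewrite [X in X @ \oo --> _](_ : _ = diag_sum e' (Q 0%N)); last first.
  apply/funext => K; rewrite /series /=; apply: eq_bigr => k _.
  by rewrite /e'; case: ifP => // _; rewrite dot0r.
apply/(@tends_cvg _ (R[i])^o).
pose d K n := diag_sum e' (fun x => Q n x - Q n.+1 x) K.
have dE K m : diag_sum e' (Q 0%N) K =
    \sum_(0 <= n < m) d K n + diag_sum e' (Q m) K.
  elim: m => [|m ->]; first by rewrite big_geq // add0r.
  rewrite big_nat_recr //= -addrA; congr (_ + _); rewrite -diag_sumD.
  by apply: eq_bigr => k _; rewrite subrK.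
have dg K n : nrm (d K n) <= g n by have [_ ->] := ht n e' e'o e't.
have dt n : tends (d^~ n) (t n) by have [] := ht n e' e'o e't.
have Qg K m : nrm (diag_sum e' (Q m) K) <= K%:R * g m.
  apply: (le_trans (nrm_sum _ _ _)).
  rewrite mulr_natl -[X in _ *+ X]subn0 -sumr_const_nat; apply: ler_sum => k _.
  rewrite (le_trans (cauchy_schwarz _ _)) //.
  have h1 := ortho0_le1 e'o k; have [_ h2 gm] := hQ m; have h3 := h2 (e' k).
  have := nrm_ge0 (e' k); have := nrm_ge0 (Q m (e' k)); nra.
move=> eps eps0; have eps3 : 0 < eps / 4 by rewrite divr_gt0.
have [N HN] := bounded_sums_tail g0 bg eps3.
have tailN (z : nat -> R[i]) m : (forall n, nrm (z n) <= g n) -> (N <= m)%N ->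
    nrm (\sum_(0 <= n < m) z n - \sum_(0 <= n < N) z n) < eps / 4.
  move=> zg Nm; rewrite (big_cat_nat (leq0n N) Nm) /= addrAC subrr add0r.
  apply: le_lt_trans (nrm_sum _ _ _) _; apply: le_lt_trans (HN _ _ (leqnn N) Nm).
  exact: ler_sum.
have fin : tends (fun K => \sum_(0 <= n < N) d K n) (\sum_(0 <= n < N) t n).
  elim: (N) => [|n IH].
    by rewrite big_geq //; apply: eq_tends (tends_const 0) => K; rewrite big_geq.
  rewrite big_nat_recr //=; apply: eq_tends (tendsD IH (dt n)) => K.
  by rewrite big_nat_recr.
have [K0 HK0] := fin _ eps3.
have sN : nrm (\sum_(0 <= n < N) t n - s) <= eps / 4.
  rewrite nrmB.
  have ts' : tends (fun m => \sum_(0 <= n < m) t n - \sum_(0 <= n < N) t n)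
      (s - \sum_(0 <= n < N) t n) by apply: tendsD ts (tends_const _).
  apply: (tends_le (N := N) ts') => m Nm; apply/ltW/tailN => // n.
  exact: trace_bound_nrm (ht n).
exists K0 => K KK0.
have TN : nrm (diag_sum e' (Q 0%N) K - \sum_(0 <= n < N) d K n) <= eps / 4 + eps / 4.
  have [M HM] := bounded_sums_tail g0 bg (divr_gt0 eps3 (ltr0Sn R K)).
  pose m := maxn M N.
  have gm : K%:R * g m <= eps / 4.
    have := HM m m.+1 (leq_maxl _ _) (leqnSn _); rewrite big_nat1.
    rewrite ltr_pdivlMr ?ltr0Sn // mulrC => /ltW; apply: le_trans.
    by rewrite ler_wpM2r // ler_nat.
  rewrite (dE K m) addrAC (le_trans (nrmD _ _)) // lerD //.
    by apply/ltW/tailN => //; rewrite leq_maxr.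
  exact: le_trans (Qg _ _) gm.
have h1 := HK0 K KK0.
apply: le_lt_trans (nrm_triangle _ (\sum_(0 <= n < N) d K n) _) _.
have := nrm_triangle (\sum_(0 <= n < N) d K n) (\sum_(0 <= n < N) t n) s.
lra.
Qed.

End TraceIdeals.

(** * Trace ideals *)

Section SchattenIdeals.
Context {R : realType} {H : hilbert R}.
Implicit Types (x y v : H) (e : nat -> H) (T X Y Z D : H -> H).
Variable N : nat.
Hypothesis N_gt0 : (0 < N)%N.

Definition decay (al : nat -> R) : Prop :=
  [/\ forall n, 0 <= al n, forall n, al n.+1 <= al n
    & bounded_sums (fun n => al n ^+ N)].

Definition approximable (c : nat -> R) (Q : nat -> H -> H) : Prop :=
  (forall n, bop (c n) (Q n)) /\
  forall n, nuclear (c n) (fun x => Q n x - Q n.+1 x).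

(** Plays the role of the products of [k] elements of the Schatten class of
    exponent [N]: [Q_n] is the error of the [n]-th approximation, and it
    decreases like the [k]-th power of an [N]-summable sequence. In all examples
    the increments have a rank that does not depend on [n], which is why
    their nuclear norms obey the same bound as the operator norms. *)
Definition ideal (k : nat) T : Prop := exists al C Q,
  [/\ decay al, 0 <= C, Q 0%N = T & approximable (fun n => C * al n ^+ k) Q].

Lemma decayD al be : decay al -> decay be -> decay (fun n => al n + be n).
Proof.
move=> [a0 a1 [S HS]] [b0 b1 [S' HS']]; split=> [n|n|].
- by rewrite addr_ge0.
- by rewrite lerD.
exists (2 ^+ N * (S + S')) => n.
apply: (@le_trans _ _ (\sum_(0 <= k < n) 2 ^+ N * (al k ^+ N + be k ^+ N))); last first.
  by rewrite -mulr_sumr big_split /= ler_wpM2l ?lerD // exprn_ge0.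
apply: ler_sum => k _; have ak := a0 k; have bk := b0 k.
wlog ab : al be a0 b0 {a1 b1 HS HS'} ak bk / al k <= be k.
  move=> W; case/orP: (le_total (al k) (be k)) => h; first exact: W.
  by rewrite addrC [X in _ * X]addrC; apply: W.
apply: (@le_trans _ _ ((2 * be k) ^+ N)).
  by apply: lerXn2r; rewrite ?nnegrE ?addr_ge0 ?mulr_ge0 //; lra.
by rewrite exprMn ler_wpM2l ?exprn_ge0 // lerDr exprn_ge0.
Qed.

Lemma decay_le0 al n : decay al -> al n <= al 0%N.
Proof. by move=> [_ a1 _]; elim: n => // n IH; apply: le_trans IH. Qed.

Lemma decay_mono al k n : decay al -> al n.+1 ^+ k <= al n ^+ k.
Proof. by move=> [a0 a1 _]; apply: lerXn2r; rewrite ?nnegrE. Qed.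

Lemma bop_ideal0 a T : bop a T -> ideal 0 T.
Proof.
move=> hT; have a0 : 0 <= a by case: hT.
exists (fun=> 0), a, (fun=> T); split=> //.
  split=> //; exists 0 => n; rewrite big1 // => i _.
  by rewrite expr0n eqn0Ngt N_gt0.
split=> n; rewrite expr0 mulr1 // (_ : (fun x => _) = fun=> 0); first exact: nuclear0.
by apply/funext => x; rewrite subrr.
Qed.

Lemma approximable_le c c' Q : (forall n, c n <= c' n) -> approximable c Q ->
  approximable c' Q.
Proof.
move=> cc [h1 h2]; split=> n; first exact: bop_le (h1 n).
exact: nuclear_le (h2 n).
Qed.

Lemma ideal_le k l T : (k <= l)%N -> ideal l T -> ideal k T.
Proof.
move=> kl [al [C [Q [da C0 QT aQ]]]].
exists al, (C * al 0%N ^+ (l - k)), Q; have [a0 a1 _] := da.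
split=> //; first by rewrite mulr_ge0 // exprn_ge0.
apply: approximable_le aQ => n; rewrite -mulrA ler_wpM2l // -{1}(subnK kl) exprD.
rewrite ler_wpM2r ?exprn_ge0 //; apply: lerXn2r; rewrite ?nnegrE //.
exact: decay_le0.
Qed.

(* Makes the errors of two operators comparable with powers of one sequence. *)
Lemma approximable_common al be (C : R) k Q : 0 <= C -> decay al -> decay be ->
  approximable (fun n => C * al n ^+ k) Q ->
  approximable (fun n => C * (al n + be n) ^+ k) Q.
Proof.
move=> C0 [a0 _ _] [b0 _ _]; apply: approximable_le => n.
by rewrite ler_wpM2l // lerXn2r ?nnegrE ?addr_ge0 // lerDl.
Qed.

Lemma ideal_common k l T T' : ideal k T -> ideal l T' ->
  exists al C C' Q Q', [/\ decay al, 0 <= C /\ 0 <= C', Q 0%N = T /\ Q' 0%N = T',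
    approximable (fun n => C * al n ^+ k) Q
  & approximable (fun n => C' * al n ^+ l) Q'].
Proof.
move=> [al [C [Q [da C0 QT aQ]]]] [be [C' [Q' [db C0' QT' aQ']]]].
exists (fun n => al n + be n), C, C', Q, Q'; split=> //.
- exact: decayD.
- exact: approximable_common aQ.
- rewrite (_ : (fun n => _) = fun n => C' * (be n + al n) ^+ l).
    exact: approximable_common aQ'.
  by apply/funext => n; rewrite addrC.
Qed.

(* Discrete product rule. *)
Lemma sub_products a b (Q Q' : nat -> H -> H) n : bop a (Q n) -> bop b (Q n.+1) ->
  (fun x => Q n (Q' n x) - Q n.+1 (Q' n.+1 x)) =
  (fun x => (Q n (Q' n x) - Q n.+1 (Q' n x)) + Q n.+1 (Q' n x - Q' n.+1 x)).
Proof.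
by move=> hQ hQ1; apply/funext => x; rewrite (bopB _ _ hQ1) addrA subrK.
Qed.

Lemma idealM k l T T' : ideal k T -> ideal l T' ->
  ideal (k + l) (fun x => T (T' x)).
Proof.
move=> iT iT'; have [al [C [C' [Q [Q' [da [C0 C0'] [<- <-] [h1 h2] [h1' h2']]]]]]] :=
  ideal_common iT iT'.
have a0 n m : 0 <= al n ^+ m by case: da => ? _ _; rewrite exprn_ge0.
have E n : C * C' * al n ^+ (k + l) = C * al n ^+ k * (C' * al n ^+ l).
  by rewrite exprD; ring.
have E2 n : 2 * (C * C') * al n ^+ (k + l) =
    C * al n ^+ k * (C' * al n ^+ l) + C * al n ^+ k * (C' * al n ^+ l).
  by rewrite -E; ring.
exists al, (2 * (C * C')), (fun n x => Q n (Q' n x)); split=> //.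
  by rewrite !mulr_ge0.
split=> n; rewrite E2.
  by apply: (bop_le _ (bop_comp (h1 n) (h1' n))); rewrite lerDl !mulr_ge0.
rewrite (sub_products Q' (h1 n) (h1 n.+1)); apply: nuclearD.
  exact: nuclear_compr (h2 n) (h1' n).
apply: (nuclear_compl _ (h2' n)); apply: (bop_le _ (h1 n.+1)).
by rewrite ler_wpM2l // decay_mono.
Qed.

(** The commutator property holds increment by increment: with
    [D = Q_n - Q_{n+1}] and [D' = Q'_n - Q'_{n+1}], the increments of
    [Q_n Q'_n] and [Q'_n Q_n] are [D Q'_n + Q_{n+1} D'] and
    [Q'_n D + D' Q_{n+1}]. *)
Lemma ideal_traceC k l T T' : (k + l)%N = N -> ideal k T -> ideal l T' ->
  exists t, has_trace (fun x => T (T' x)) t /\ has_trace (fun x => T' (T x)) t.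
Proof.
move=> kl iT iT'.
have [al [C [C' [Q [Q' [da [C0 C0'] [<- <-] [h1 h2] [h1' h2']]]]]]] :=
  ideal_common iT iT'.
have a0 n m : 0 <= al n ^+ m by case: da => ? _ _; rewrite exprn_ge0.
pose g n := C * al n ^+ k * (C' * al n ^+ l) + C * al n ^+ k * (C' * al n ^+ l).
have gE n : g n = 2 * (C * C') * al n ^+ N by rewrite -kl exprD /g; ring.
have g0 n : 0 <= g n by rewrite gE !mulr_ge0.
have gb : bounded_sums g.
  case: da => _ _ [S HS]; exists (2 * (C * C') * S) => n.
  rewrite (eq_bigr _ (fun n _ => gE n)) -mulr_sumr ler_wpM2l // !mulr_ge0 //.
have hQQ' n : bop (g n) (fun x => Q n (Q' n x)).
  by apply: (bop_le _ (bop_comp (h1 n) (h1' n))); rewrite lerDl !mulr_ge0.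
have hQ'Q n : bop (g n) (fun x => Q' n (Q n x)).
  apply: (bop_le _ (bop_comp (h1' n) (h1 n))).
  by rewrite mulrC lerDl !mulr_ge0.
have /choice[z Hz] : forall n, exists z,
    trace_bound (g n) (fun x => Q n (Q' n x) - Q n.+1 (Q' n.+1 x)) z /\
    trace_bound (g n) (fun x => Q' n (Q n x) - Q' n.+1 (Q n.+1 x)) z.
  move=> n; have [_ [t ht]] := h2 n; have [_ [t' ht']] := h2' n.
  have hQ1 : bop (C * al n ^+ k) (Q n.+1).
    by apply: (bop_le _ (h1 n.+1)); rewrite ler_wpM2l // decay_mono.
  exists (t (Q' n) + t' (Q n.+1)); split.
    rewrite (sub_products Q' (h1 n) (h1 n.+1)); apply: trace_boundD.
      by have := ht _ _ _ _ bop_id (h1' n); rewrite mulr1.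
    by have := ht' _ _ _ _ hQ1 bop_id; rewrite mulr1 [X in trace_bound X]mulrC.
  rewrite (_ : (fun x => _) = fun x =>
    Q' n (Q n x - Q n.+1 x) + (Q' n (Q n.+1 x) - Q' n.+1 (Q n.+1 x))); last first.
    by apply/funext => x; rewrite (bopB _ _ (h1' n)) addrA subrK.
  apply: trace_boundD.
    by have := ht _ _ _ _ (h1' n) bop_id; rewrite mulr1.
  by have := ht' _ _ _ _ bop_id hQ1; rewrite mulr1 [X in trace_bound X]mulrC.
have [|s hs] := series_cvg (z := z) g0 gb.
  by move=> n; have [h _] := Hz n; apply: trace_bound_nrm h.
exists s; split.
  by apply: (has_trace_series g0 gb hQQ' _ hs) => n; have [] := Hz n.
by apply: (has_trace_series g0 gb hQ'Q _ hs) => n; have [] := Hz n.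
Qed.

Lemma ideal_has_trace T : ideal N T -> exists t, has_trace T t.
Proof.
by move=> /(ideal_traceC (addn0 N))/(_ (bop_ideal0 bop_id))[t [h _]]; exists t.
Qed.

End SchattenIdeals.

Section Trace.
Context {R : realType} {H : hilbert R}.
Implicit Types T : H -> H.

Lemma has_trace_unique T t t' : has_trace T t -> has_trace T t' -> t = t'.
Proof.
move=> h h'; have [J [e eb]] := @orthonormal_basis_exists R H.
move: (h J e eb) (h' J e eb) => /(tends_cvg (V := (R[i])^o)) h1.
move=> /(tends_cvg (V := (R[i])^o)) h2; exact: tends_unique h1 h2.
Qed.

Lemma trace_eq T t : has_trace T t -> trace T = t.
Proof.
by move=> h; apply: xget_unique => // t' /(has_trace_unique h).
Qed.

Lemma has_traceD T T' z t t' : has_trace T t -> has_trace T' t' ->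
  has_trace (fun x => z *: T x + T' x) (z * t + t').
Proof.
move=> h h' J e eb; move: (h J e eb) (h' J e eb).
move=> /(tends_cvg (V := (R[i])^o)) h1 /(tends_cvg (V := (R[i])^o)) h2.
apply/(@tends_cvg _ (R[i])^o).
have h1z := tends_lip (f := fun w : R[i] => z * w) (c := nrm z) _ h1.
apply: eq_tends (tendsD (h1z _) h2) => [n|x y]; last by rewrite -mulrBr nrmM.
rewrite /series /= mulr_sumr -big_split /=; apply: eq_bigr => k _.
by case: ifP; rewrite ?mulr0 ?addr0 // dotDl dotZl.
Qed.

End Trace.

(** * Maximizers of compact operators *)

Section SingularValues.
Context {R : realType} {H : hilbert R}.
Implicit Types (x y u : H) (s : seq H).

Definition orth s : set H := [set x | forall u, u \in s -> dot x u = 0].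

Lemma orthD s x y : orth s x -> orth s y -> orth s (x + y).
Proof. by move=> hx hy u us; rewrite dotDl hx ?hy ?addr0. Qed.

Lemma orthZ s z x : orth s x -> orth s (z *: x).
Proof. by move=> hx u us; rewrite dotZl hx ?mulr0. Qed.

Lemma inv_succ_small (d : R) : 0 < d -> exists n, forall m, (n <= m)%N ->
  m.+1%:R^-1 < d.
Proof.
move=> d0; exists (Num.bound `|d^-1|) => m nm.
rewrite -[X in _ < X]invrK ltf_pV2 ?posrE ?invr_gt0 //.
rewrite (le_lt_trans (ler_norm _)) // (lt_le_trans (archi_boundP (normr_ge0 _))) //.
by rewrite ler_nat leqW.
Qed.

Definition maximizer (T : H -> H) s x : Prop :=
  [/\ orth s x, nrm x = 1
    & forall y, orth s y -> nrm (T y) <= nrm (T x) * nrm y].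

(** A compact operator attains its norm on the orthogonal complement of a
    finite set: along a maximizing sequence whose images converge, the
    parallelogram law makes the vectors themselves converge. *)
Lemma maximizer_exists (T : H -> H) a s : bop a T -> compact_op T ->
  (exists x, orth s x /\ x != 0) -> exists x, maximizer T s x.
Proof.
move=> hT cT [x0 [sx0 x0n0]].
have unit x : x != 0 -> nrm ((nrm x)^-1%:C *: x) = 1.
  move=> xn0; rewrite nrmZ nrm_real ?invr_ge0 ?nrm_ge0 // mulVf //.
  by rewrite nrm_eq0.
pose E := [set nrm (T x) | x in [set x | orth s x /\ nrm x = 1]].
have E0 : E !=set0.
  by eexists; exists ((nrm x0)^-1%:C *: x0) => //; split; [apply: orthZ|apply: unit].
have Ea : ubound E a.
  by move=> _ [x [_ nx] <-]; have [_ h _] := hT; rewrite -[a]mulr1 -nx.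
have sE : has_sup E by split=> //; exists a.
set mu := sup E.
have Tmu y : orth s y -> nrm (T y) <= mu * nrm y.
  move=> sy; have [->|y0] := eqVneq y 0; first by rewrite (bop0 hT) !nrm0 mulr0.
  have ny : 0 < nrm y by rewrite lt0r nrm_eq0 y0 nrm_ge0.
  rewrite -ler_pdivrMr //; apply: (sup_upper_bound sE).
  exists ((nrm y)^-1%:C *: y); first by split; [apply: orthZ|apply: unit].
  by rewrite (bopZ _ _ hT) nrmZ nrm_real ?invr_ge0 ?nrm_ge0 // mulrC.
have [mu0|mu0] := leP mu 0.
  exists ((nrm x0)^-1%:C *: x0); split; [exact: orthZ|exact: unit|].
  move=> y /Tmu h; rewrite (le_trans h) //.
  by rewrite ler_wpM2r ?nrm_ge0 // (le_trans mu0) ?nrm_ge0.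
pose d (n : nat) : R := n.+1%:R^-1.
have d0 n : 0 < d n by rewrite invr_gt0.
have dd m n : (m <= n)%N -> d n <= d m.
  by move=> mn; rewrite /d lef_pV2 ?posrE // ler_nat ltnS.
have /choice[x Hx] : forall n, exists x, [/\ orth s x, nrm x = 1 & mu - d n < nrm (T x)].
  move=> n; have [_ [x [sx nx] <-] h] := sup_adherent (d0 n) sE.
  by exists x.
have [z Hz] : exists z, forall n, exists x,
    [/\ orth s x, nrm x = 1, mu - d n < nrm (T x) & nrm (T x - z) < d n].
  have := cT; rewrite /compact_op precompactE => /(_ ((T \o x) @ \oo)) [].
    exists 0%N => // n _; apply: subset_closure => /=; exists (x n) => //=.
    by rewrite nrmE lecR; have [_ -> _] := Hx n.
  move=> z [_ cz]; exists z => n.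
  have [||y [/= [m nm <-]]] := cz [set T (x m) | m in [set m | (n <= m)%N]] (ball z (d n)%:C).
  - by exists n => // m nm /=; exists m.
  - by apply: nbhsx_ballx; rewrite ltcR.
  rewrite -ball_normE /= nrmE ltcR nrmB => h.
  exists (x m); have [h1 h2 h3] := Hx m; split=> //.
  by apply: le_lt_trans h3; rewrite lerD2l lerN2 dd.
have /choice[y Hy] := Hz.
have key N m n : (N <= m)%N -> (N <= n)%N ->
    nrm (y m - y n) ^+ 2 <= 16 * d N / mu.
  move=> Nm Nn; have [sm um Mm zm] := Hy m; have [sn un Mn zn] := Hy n.
  have dm := dd _ _ Nm; have dn := dd _ _ Nn; have dN := d0 N.
  have pl := parallelogram (y m) (y n); rewrite um un in pl.
  have hS := Tmu _ (orthD sm sn).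
  have Tb : 2 * (mu - d N) - 2 * d N <= nrm (T (y m + y n)).
    have h1 : nrm (T (y m) - T (y n)) <= nrm (T (y m) - z) + nrm (T (y n) - z).
      by rewrite (nrmB (T (y n))) nrm_triangle.
    have h2 : nrm (T (y n)) *+ 2 <= nrm (T (y m + y n)) + nrm (T (y m) - T (y n)).
      rewrite (bopD _ _ hT) mulr2n -[X in X <= _](_ : nrm (T (y n) *+ 2) = _); last first.
        rewrite -scaler_nat nrmZ -(rmorph_nat (real_complex R)) nrm_real //.
        by rewrite mulr_natl mulr2n.
      rewrite (_ : T (y n) *+ 2 = (T (y m) + T (y n)) - (T (y m) - T (y n))) ?nrm_sub //.
      by rewrite opprB addrC addrA subrK mulr2n.
    lra.
  rewrite ler_pdivlMr //.
  have hq : 0 <= nrm (y m + y n) by apply: nrm_ge0.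
  have hr : 0 <= nrm (T (y m + y n)) by apply: nrm_ge0.
  move: (nrm (y m - y n) ^+ 2) (nrm (y m + y n)) (nrm (T (y m + y n))) pl hS Tb hq hr.
  move=> D q r pl hS Tb hq hr.
  have rq : r ^+ 2 <= mu ^+ 2 * q ^+ 2.
    by rewrite -exprMn lerXn2r ?nnegrE ?mulr_ge0 //; apply: ltW.
  have r4 : 4 * mu ^+ 2 - 16 * mu * d N <= r ^+ 2.
    have [h|h] := leP (4 * d N) (2 * mu).
      apply: (@le_trans _ _ ((2 * mu - 4 * d N) ^+ 2)); last first.
        by apply: lerXn2r; rewrite ?nnegrE ?subr_ge0 //; lra.
      have : 0 <= d N ^+ 2 by apply: sqr_ge0.
      nra.
    apply: (@le_trans _ _ 0); last exact: sqr_ge0.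
    nra.
  have q2 : q ^+ 2 = 4 - D by lra.
  rewrite q2 in rq; have h : mu * (D * mu) <= mu * (16 * d N) by lra.
  by rewrite ler_pM2l in h.
have yc : nrm_cauchy y.
  move=> e e0; have [|N HN] := @inv_succ_small (e ^+ 2 * mu / 16).
    by rewrite !(mulr_gt0, exprn_gt0) // invr_gt0.
  exists N => m n Nm Nn; rewrite -(@ltr_pXn2r _ 2) // ?nnegrE ?nrm_ge0 ?ltW //.
  apply: le_lt_trans (key _ _ _ Nm Nn) _; have := HN N (leqnn N).
  by rewrite -/(d N) ltr_pdivrMr // ltr_pdivlMr // mulrC.
have [x1 yx] := nrm_cauchy_cvg yc.
have Tyx : tends (fun n => T (y n)) (T x1).
  case: (hT) => _ h _; apply: (tends_lip (f := T) (c := a) _ yx) => u v.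
  by rewrite -(bopB _ _ hT).
have sx1 : orth s x1.
  move=> u us; have dl : tends (fun n => dot (y n) u) (dot x1 u).
    apply: (tends_lip (f := fun y => dot y u) (c := nrm u) _ yx) => v w.
    by rewrite -dotBl mulrC cauchy_schwarz.
  apply: (tends_unique dl); apply: eq_tends (tends_const 0) => n.
  by have [-> ] := Hy n.
have nx1 : nrm x1 <= 1.
  by apply: (tends_le (N := 0) yx) => n _; have [_ -> _ _] := Hy n.
have Tx1 : mu <= nrm (T x1).
  rewrite leNgt; apply/negP; rewrite -subr_gt0 => h.
  have h2 : 0 < (mu - nrm (T x1)) / 2 by rewrite divr_gt0.
  have [N1 HN1] := inv_succ_small h2; have [N2 HN2] := Tyx _ h2.
  have k1 := HN1 _ (leq_maxl N1 N2); have k2 := HN2 _ (leq_maxr N1 N2).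
  have [_ _ k3 _] := Hy (maxn N1 N2); rewrite -/(d (maxn N1 N2)) in k1.
  have := nrmD (T (y (maxn N1 N2)) - T x1) (T x1); rewrite subrK.
  lra.
exists x1; split=> //.
  apply/eqP; rewrite eq_le nx1 /=.
  have := Tmu _ sx1; move=> /(le_trans Tx1); by rewrite -{1}[mu]mulr1 ler_pM2l.
by move=> v /Tmu h; rewrite (le_trans h) // ler_wpM2r ?nrm_ge0.
Qed.

(** First-order condition at a maximizer of [|T x|]: there the nonnegative form
    [mu^2 <x,y> - <T x,T y>] vanishes, hence it vanishes against every [y]. *)
Lemma maximizer_eigen (T : H -> H) a s x y : bop a T -> maximizer T s x ->
  orth s y -> dot (T x) (T y) = ((nrm (T x)) ^+ 2)%:C * dot x y.
Proof.
move=> hT [sx nx mx] sy; set mu := nrm (T x).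
pose b := mu%:C ^+ 2 * dot x y - dot (T x) (T y).
pose c := mu ^+ 2 * nrm y ^+ 2 - nrm (T y) ^+ 2.
have psd v : orth s v -> 0 <= mu ^+ 2 * nrm v ^+ 2 - nrm (T v) ^+ 2.
  move=> sv; rewrite subr_ge0 -exprMn lerXn2r ?nnegrE ?mulr_ge0 ?nrm_ge0 //.
  exact: mx.
have c0 : 0 <= c by apply: psd.
pose t : R := (1 + c)^-1.
have t0 : 0 < t by rewrite invr_gt0 ltr_pwDl.
have tr : (t%:C : R[i])^* = t%:C by apply: conjc_real.
have mr : (mu%:C : R[i])^* = mu%:C by apply: conjc_real.
(* A step along the gradient, short enough for the quadratic term [t^2 |b|^2 c]
   to be dominated by the linear one. *)
pose v := x - (t%:C * b) *: y.
have sv : orth s v by apply: orthD => //; rewrite -scaleNr; apply: orthZ.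
suff b0 : nrm b = 0.
  move/eqP: b0; rewrite nrm_eq0 subr_eq0 => /eqP <-.
  by rewrite rmorphXn.
have E : mu ^+ 2 * nrm v ^+ 2 - nrm (T v) ^+ 2 =
    t ^+ 2 * nrm b ^+ 2 * c - 2 * t * nrm b ^+ 2.
  have cE (k l m n o p q : R) :
      k%:C ^+ 2 * l%:C - m%:C =
        n%:C ^+ 2 * o%:C * (k%:C ^+2 * p%:C - q%:C) - 2 * n%:C * o%:C ->
      k ^+ 2 * l - m = n ^+ 2 * o * (k ^+ 2 * p - q) - 2 * n * o.
    move=> h; apply: (@complexI R); move: h.
    by rewrite !(rmorphB, rmorphM, rmorphXn, rmorph_nat) /=.
  apply: cE; rewrite -!dotxx nrm_sqr.
  rewrite {1}/v !(dotBl, dotBr, dotZl, dotZr).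
  rewrite {1}/v (bopB _ _ hT) (bopZ _ _ hT) !(dotBl, dotBr, dotZl, dotZr).
  rewrite (dotC y x) (dotC (T y) (T x)).
  have bc : b^* = mu%:C ^+ 2 * (dot x y)^* - (dot (T x) (T y))^*.
    by rewrite rmorphB rmorphM rmorphXn /= mr.
  rewrite rmorphM /= tr bc /b !dotxx nx -/mu rmorphXn /=.
  ring.
have := psd v sv; rewrite E.
have tc : t * c <= 1.
  by rewrite /t mulrC ler_pdivrMr ?ltr_pwDl // mul1r lerDr.
have -> : t ^+ 2 * nrm b ^+ 2 * c - 2 * t * nrm b ^+ 2 =
    - (t * nrm b ^+ 2 * (2 - t * c)) by ring.
rewrite oppr_ge0 => h; apply/eqP; rewrite -[_ == _]negbK; apply/negP => b0.
have bp : 0 < nrm b by rewrite lt0r b0 nrm_ge0.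
have : 0 < t * nrm b ^+ 2 * (2 - t * c).
  rewrite !mulr_gt0 //; lra.
by move=> /(le_lt_trans h); rewrite ltxx.
Qed.

End SingularValues.

(** * Singular values and approximation *)

Section SingularSystem.
Context {R : realType} {H : hilbert R}.
Variables (T : H -> H) (a : R).
Hypotheses (hT : bop a T) (cT : compact_op T).
Implicit Types x y : H.

(* The default value 0 is taken when the vectors in [s] span the space. *)
Definition next_singular (s : seq H) : H := xget 0 (maximizer T s).

Fixpoint singular_seq n : seq H :=
  if n is n'.+1 then rcons (singular_seq n') (next_singular (singular_seq n'))
  else [::].

Definition singular_vec n : H := next_singular (singular_seq n).
Local Notation e := singular_vec.

Lemma mem_singular_seq n y : y \in singular_seq n -> exists2 k, (k < n)%N & y = e k.
Proof.
elim: n => // n IH; rewrite mem_rcons in_cons => /orP[/eqP->|/IH[k kn ->]].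
  by exists n.
by exists k => //; rewrite ltnW.
Qed.

Lemma singular_vec_mem k n : (k < n)%N -> e k \in singular_seq n.
Proof.
elim: n => // n IH; rewrite ltnS leq_eqVlt => /orP[/eqP->|/IH kn].
  by rewrite mem_rcons mem_head.
by rewrite mem_rcons in_cons kn orbT.
Qed.

Lemma orth_singular n x :
  orth (singular_seq n) x <-> forall k, (k < n)%N -> dot x (e k) = 0.
Proof.
split=> [h k /singular_vec_mem /h //|h u /mem_singular_seq[k kn ->]].
exact: h.
Qed.

Lemma singular_vecP n : e n <> 0 -> maximizer T (singular_seq n) (e n).
Proof. by rewrite /e /next_singular; case: xgetP. Qed.

Lemma singular_vec0 n : e n = 0 -> forall x, orth (singular_seq n) x -> x = 0.
Proof.
move=> en x sx; apply: contrapT => /eqP xn.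
have [|y hy] := maximizer_exists (s := singular_seq n) hT cT; first by exists x.
have : maximizer T (singular_seq n) (e n).
  by rewrite /e /next_singular; case: xgetP => // /(_ y).
by case=> _; rewrite en nrm0 => /esym/eqP; rewrite oner_eq0.
Qed.

Lemma singular_vec_orth n : orth (singular_seq n) (e n).
Proof.
have [->|/eqP/singular_vecP[]//] := eqVneq (e n) 0.
by move=> u _; rewrite dot0l.
Qed.

Lemma singular_vec_dot n k : (k < n)%N -> dot (e n) (e k) = 0.
Proof. by move=> kn; apply: singular_vec_orth; apply: singular_vec_mem. Qed.

Lemma orth_singular_le m n x : (m <= n)%N ->
  orth (singular_seq n) x -> orth (singular_seq m) x.
Proof.
move=> mn sx; apply/orth_singular => k km; apply: sx.
by apply: singular_vec_mem; apply: leq_trans mn.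
Qed.

Lemma singular_vec_max n y : orth (singular_seq n) y ->
  nrm (T y) <= nrm (T (e n)) * nrm y.
Proof.
have [en|/eqP/singular_vecP[_ _]] := eqVneq (e n) 0; last exact.
by move=> /(singular_vec0 en) ->; rewrite (bop0 hT) nrm0 mulr0.
Qed.

Lemma singular_vec_ortho0 : ortho0 e.
Proof.
move=> j k; have [jk|kj|<-] := ltngtP j k.
- by rewrite (dot_eq0C (singular_vec_dot jk)).
- by rewrite singular_vec_dot.
have [->|ej] := eqVneq (e j) 0; first by rewrite dot0l.
have [_ ne _] := singular_vecP (elimN eqP ej).
by rewrite dotxx ne expr1n.
Qed.
Local Notation eo := singular_vec_ortho0.

Definition singular_nrm n : R := nrm (T (e n)).
Local Notation mu := singular_nrm.

Lemma singular_nrm_decr n : mu n.+1 <= mu n.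
Proof.
apply: le_trans (singular_vec_max (n := n) _) _.
  exact: orth_singular_le (leqnSn n) (@singular_vec_orth n.+1).
by rewrite ler_piMr ?nrm_ge0 // ortho0_le1 //; apply: eo.
Qed.

Lemma singular_nrm_le j n : (j <= n)%N -> mu n <= mu j.
Proof.
elim: n => [|n IH]; first by rewrite leqn0 => /eqP ->.
rewrite leq_eqVlt => /orP[/eqP -> //|/IH]; exact: le_trans (singular_nrm_decr n).
Qed.

Lemma singular_vec_eigen n y :
  dot (T (e n)) (T y) = ((mu n) ^+ 2)%:C * dot (e n) y.
Proof.
have [en|/eqP en] := eqVneq (e n) 0; first by rewrite en (bop0 hT) !dot0l mulr0.
have ey k z : orth (singular_seq k) z ->
    dot (T (e k)) (T z) = ((mu k) ^+ 2)%:C * dot (e k) z.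
  have [ek _|/eqP/singular_vecP mk] := eqVneq (e k) 0.
    by rewrite ek (bop0 hT) !dot0l mulr0.
  exact: maximizer_eigen hT mk.
have sub : orth (singular_seq n) (y - proj e n y).
  by apply/orth_singular => k kn; apply: (dot_sub_proj eo).
have Tp : dot (T (e n)) (T (proj e n y)) = 0.
  have -> : T (proj e n y) = \sum_(0 <= k < n) dot y (e k) *: T (e k).
    rewrite /proj; elim: (n) => [|m IH]; first by rewrite !big_geq ?(bop0 hT).
    by rewrite !big_nat_recr //= (bopD _ _ hT) (bopZ _ _ hT) IH.
  rewrite dotC dot_suml big_nat big1 ?conjC0 // => k /= kn.
  rewrite dotZl ey; first by rewrite (dot_eq0C (singular_vec_dot kn)) !mulr0.
  exact: orth_singular_le (ltnW kn) (@singular_vec_orth n).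
have -> : T y = T (y - proj e n y) + T (proj e n y) by rewrite -(bopD _ _ hT) subrK.
rewrite dotDr Tp addr0 ey // dotBr dot_projr ?subr0 // => k kn.
exact: singular_vec_dot.
Qed.

(** The vectors [e_0, ..., e_n] are among the families of eigenvectors over which
    the singular value is a supremum. *)
Lemma singular_nrm_le_value n : mu n <= singular_value T n.
Proof.
rewrite /singular_value; set E := (X in sup X).
have hE : has_ubound E.
  exists a => l [l0 [f [nu [fo hf]]]]; have [h1 h2] := hf ord0.
  apply: (le_trans h1); have := h2 (f ord0); rewrite fo eqxx mulr1 dotxx.
  move=> /complexI h3.
  have f1 : nrm (f ord0) = 1.
    have := fo ord0 ord0; rewrite eqxx dotxx => /(@complexI R _ 1)/eqP.
    by rewrite sqrp_eq1 ?nrm_ge0 // => /eqP.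
  have nu0 : 0 <= nu ord0 by apply: le_trans h1.
  have <- : nrm (T (f ord0)) = nu ord0.
    by apply/eqP; rewrite -(@eqrXn2 _ 2) ?nrm_ge0 //; apply/eqP.
  by have [_ h _] := hT; rewrite -[a]mulr1 -f1.
have [en|/eqP en] := eqVneq (e n) 0.
  rewrite /mu en (bop0 hT) nrm0.
  have [E0|/set0P[l El]] := eqVneq E set0; first by rewrite E0 sup0.
  apply: (@le_trans _ _ l); first by case: El.
  by apply: sup_upper_bound => //; split=> //; exists l.
have ej (j : 'I_n.+1) : e j != 0.
  apply/eqP => ej; apply: en; apply: (singular_vec0 ej).
  apply: orth_singular_le (@singular_vec_orth n).
  by rewrite -ltnS.
have En : E (mu n).
  split; first exact: nrm_ge0.
  exists (fun j => e j), (fun j => mu j); split=> [j k|j].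
    by rewrite eo ej andbT.
  split; first by rewrite singular_nrm_le // -ltnS.
  by move=> y; apply: singular_vec_eigen.
by apply: sup_upper_bound => //; split=> //; exists (mu n).
Qed.

Lemma singular_approximable :
  approximable mu (fun n x => T (x - proj e n x)).
Proof.
have Qb n : bop (mu n) (fun x => T (x - proj e n x)).
  split=> [z x y|x|]; last exact: nrm_ge0.
    have -> : z *: x + y - proj e n (z *: x + y) =
        z *: (x - proj e n x) + (y - proj e n y).
      have -> : proj e n (z *: x + y) = z *: proj e n x + proj e n y.
        rewrite /proj scaler_sumr -big_split /=; apply: eq_bigr => k _.
        by rewrite dotDl dotZl scalerDl scalerA.
      by rewrite opprD scalerBr addrACA.
    exact: (bop_linear hT).
  apply: (@le_trans _ _ (mu n * nrm (x - proj e n x))).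
    by apply: singular_vec_max; apply/orth_singular => k kn; apply: dot_sub_proj eo _ _ _ kn.
  by rewrite ler_wpM2l ?nrm_ge0 // (nrm_sub_proj eo).
split=> // n.
rewrite (_ : (fun x => _) = fun x => dot x (e n) *: T (e n)); last first.
  apply/funext => x; rewrite -(bopB _ _ hT) opprB [X in T X]addrC addrA subrK projS.
  by rewrite addrAC subrr add0r (bopZ _ _ hT).
apply: (@nuclear_rank1 _ _ _ _ 1) => // [z x y|x|]; last by rewrite mul1r.
  by rewrite dotDl dotZl.
rewrite mul1r (le_trans (cauchy_schwarz _ _)) // ler_piMr ?nrm_ge0 //.
exact: ortho0_le1 eo _.
Qed.

(** The sequence [mu] is bounded, so its [N]-th powers are dominated by its
    [p]-th powers, hence by those of the singular values. *)
Lemma schatten_ideal (p : R) N : 1 <= p -> p <= N%:R ->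
  (schatten_norm p T < +oo)%E -> ideal N 1 T.
Proof.
move=> p1 pN; rewrite /schatten_norm => hs.
have p0 : 0 < p by rewrite (lt_le_trans _ p1).
pose s n := singular_value T n `^ p.
have s0 n : (0 <= (s n)%:E)%E by rewrite lee_fin powR_ge0.
have [S HS] : exists S, forall n, \sum_(0 <= k < n) s k <= S.
  have fin : (\sum_(0 <= n <oo) (s n)%:E < +oo)%E.
    by apply: lty_poweRy hs; rewrite invr_eq0 gt_eqF.
  exists (fine (\sum_(0 <= n <oo) (s n)%:E)%E) => n.
  rewrite -lee_fin fineK; last by rewrite ge0_fin_numE // nneseries_ge0.
  rewrite -sumEFin; apply: nneseries_lim_ge => k _ _; exact: s0.
have dmu : decay N mu.
  split; [by move=> n; apply: nrm_ge0|exact: singular_nrm_decr|].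
  exists ((mu 0%N) `^ (N%:R - p) * S) => n.
  apply: (@le_trans _ _ (\sum_(0 <= k < n) mu 0%N `^ (N%:R - p) * s k)); last first.
    by rewrite -mulr_sumr ler_wpM2l ?powR_ge0.
  apply: ler_sum => k _.
  have mk : 0 <= mu k by apply: nrm_ge0.
  have := mk; rewrite le_eqVlt => /orP[/eqP <-|mkp].
    rewrite expr0n; case: eqP => [N0|_].
      by move: pN p1; rewrite N0 => h /(lt_le_trans ltr01)/lt_le_trans/(_ h); rewrite ltxx.
    by rewrite mulr_ge0 ?powR_ge0.
  rewrite -powR_mulrn // -{1}(subrK p N%:R) powRD; last by rewrite (gt_eqF mkp) implybT.
  apply: ler_pM; rewrite ?powR_ge0 //.
    by apply: ge0_ler_powR; rewrite ?nnegrE ?nrm_ge0 ?subr_ge0 // singular_nrm_le.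
  have h := singular_nrm_le_value k.
  by apply: ge0_ler_powR => //; [exact: ltW|rewrite nnegrE (le_trans mk)].
exists mu, 1, (fun n x => T (x - proj e n x)); split=> //.
  by apply/funext => x; rewrite /proj big_geq // subr0.
rewrite (_ : (fun n => _) = mu); first exact: singular_approximable.
by apply/funext => n; rewrite mul1r expr1.
Qed.

End SingularSystem.

(** * Faces, rotations and coboundaries *)

Section CyclicCombinatorics.
Context {R : realType} {A : algebra R}.
Implicit Types (g h : nat -> A) (k i j l : nat).

(** Cochains are evaluated on infinite sequences, of which they read an initial
    segment: face maps are then maps of sequences, with no arithmetic of
    bounds. *)
Definition seq_eval k (psi : cochain A k) g : R[i] :=
  psi (fun j : 'I_k.+1 => g j).

Definition seq_of k (x : 'I_k.+1 -> A) : nat -> A := fun j => x (inord j).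

Definition nface i g : nat -> A := fun j =>
  if (j < i)%N then g j else if j == i then amul (g i) (g i.+1) else g j.+1.

Definition nlast k g : nat -> A := fun j =>
  if j == 0%N then amul (g k.+1) (g 0%N) else g j.

Definition dface k i g : nat -> A := if (i <= k)%N then nface i g else nlast k g.

Definition nrot k g : nat -> A := fun j => if j == k then g 0%N else g j.+1.

Lemma nface_lt i g l : (l < i)%N -> nface i g l = g l.
Proof. by rewrite /nface => ->. Qed.

Lemma nface_eq i g : nface i g i = amul (g i) (g i.+1).
Proof. by rewrite /nface ltnn eqxx. Qed.

Lemma nface_gt i g l : (i < l)%N -> nface i g l = g l.+1.
Proof. by move=> il; rewrite /nface ltnNge (ltnW il) gtn_eqF. Qed.

Lemma nlast_gt k g l : (0 < l)%N -> nlast k g l = g l.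
Proof. by case: l. Qed.

Lemma nrot_lt k g j : (j < k)%N -> nrot k g j = g j.+1.
Proof. by rewrite /nrot; case: eqP => // ->; rewrite ltnn. Qed.

Lemma nrot_eq k g : nrot k g k = g 0%N.
Proof. by rewrite /nrot eqxx. Qed.

Lemma nface_nface i j g l : (i <= j)%N ->
  nface i (nface j.+1 g) l = nface j (nface i g) l.
Proof.
move=> ij; have [li|il|->] := ltngtP l i.
- by rewrite !nface_lt //; lia.
- rewrite nface_gt //; have [lj|jl|lj] := ltngtP l j; last rewrite lj in il *.
  + by rewrite (nface_lt (i := j.+1)) // (nface_lt (i := j)) // nface_gt.
  + by rewrite !nface_gt //; lia.
 + by rewrite !nface_eq !nface_gt // ltnW.
rewrite nface_eq; have [i_j|i_j] := eqVneq i j.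
  by rewrite -i_j (nface_lt (i := i.+1)) // !nface_eq nface_gt // amulA.
by rewrite !(nface_lt (i := j.+1)) ?(nface_lt (i := j)) ?nface_eq //; lia.
Qed.

Lemma nface_nlast k i g l : (i <= k)%N -> (l <= k)%N ->
  nface i (nlast k.+1 g) l = nlast k (nface i g) l.
Proof.
move=> ik lk; have [->|l0] := eqVneq l 0%N.
  case: i ik => [|i] ik; first by rewrite nface_eq /nlast /= nface_eq nface_gt // amulA.
  by rewrite nface_lt // /nlast /= nface_gt // nface_lt.
rewrite [RHS]nlast_gt ?lt0n //; have [li|il|<-] := ltngtP l i.
- by rewrite !nface_lt // nlast_gt ?lt0n.
- by rewrite !nface_gt.
by rewrite !nface_eq !nlast_gt // lt0n.
Qed.

Lemma nlast_nlast k g l : (l <= k)%N ->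
  nlast k (nlast k.+1 g) l = nlast k (nface k.+1 g) l.
Proof.
move=> lk; have [->|l0] := eqVneq l 0%N.
  by rewrite /nlast /= nface_eq nface_lt // amulA.
by rewrite !nlast_gt ?lt0n // nface_lt.
Qed.

Lemma nface_rot k i g l : (i <= k)%N -> (l <= k)%N ->
  dface k i (nrot k.+1 g) l = nrot k (dface k i.+1 g) l.
Proof.
move=> ik lk; rewrite {1}/dface ik /nrot.
have [ik1|ki] := ltnP i k.
  rewrite /dface ik1; have [lk1|lk1] := eqVneq l k.
    by rewrite lk1 nface_gt // eqxx nface_lt.
  have [li|il|->] := ltngtP l i.
  - by rewrite !nface_lt // ifF //; lia.
  - by rewrite !nface_gt // ifF //; lia.
  - by rewrite !nface_eq !ifF //; lia.
have {ik ki} -> : i = k by lia.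
rewrite /dface ltnn; have [->|lk1] := eqVneq l k.
  by rewrite nface_eq eqxx /nlast /= ifF //; lia.
by rewrite nface_lt ?nlast_gt // ?ifF //; lia.
Qed.

Lemma nlast_rot k g l : (l <= k)%N ->
  dface k k.+1 (nrot k.+1 g) l = dface k 0 g l.
Proof.
move=> lk; rewrite /dface ltnn /= /nlast /nrot /=.
case: l lk => [|l] lk /=; first by rewrite eqxx nface_eq.
by rewrite nface_gt // ifF //; lia.
Qed.

Lemma seq_ofK k (x : 'I_k.+1 -> A) : (fun j : 'I_k.+1 => seq_of x j) = x.
Proof. by apply/funext => j; rewrite /seq_of inord_val. Qed.

Lemma seq_of_val k g j : (j <= k)%N ->
  seq_of (fun l : 'I_k.+1 => g l) j = g j.
Proof. by move=> jk; rewrite /seq_of inordK. Qed.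

Lemma seq_evalE k (psi : cochain A k) x : psi x = seq_eval psi (seq_of x).
Proof. by rewrite /seq_eval seq_ofK. Qed.

Lemma eq_seq_eval k (psi : cochain A k) g h :
  (forall j, (j <= k)%N -> g j = h j) -> seq_eval psi g = seq_eval psi h.
Proof.
by move=> gh; congr psi; apply/funext => j; apply: gh; rewrite -ltnS.
Qed.

Lemma cochain_eqP k (psi phi : cochain A k) :
  (forall g, seq_eval psi g = seq_eval phi g) -> psi = phi.
Proof. by move=> h; apply/funext => x; rewrite !seq_evalE. Qed.

Lemma eq_dface k i g h j : (i <= k.+1)%N -> (j <= k)%N ->
  (forall l, (l <= k.+1)%N -> g l = h l) -> dface k i g j = dface k i h j.
Proof.
move=> ik jk gh; rewrite /dface /nface /nlast.
case: leqP => ik'; last by case: ifP => _; rewrite !gh // leqW.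
case: ltnP => ji; first by rewrite gh // leqW.
by case: eqP => [_|_]; rewrite !gh // ltnW.
Qed.

Lemma face_seq k i g : (i <= k)%N ->
  face i (fun j : 'I_k.+2 => g j) = (fun j : 'I_k.+1 => nface i g j).
Proof.
move=> ik; apply/funext => j; have jk := ltn_ord j; rewrite /face /nface.
case: ltnP => ji; first by rewrite inordK // ltnW.
case: eqP => _; first by rewrite !inordK // ltnS ltnW.
by rewrite inordK.
Qed.

Lemma last_face_seq k g :
  last_face (fun j : 'I_k.+2 => g j) = (fun j : 'I_k.+1 => nlast k g j).
Proof.
apply/funext => j; have := ltn_ord j; rewrite /last_face /nlast -val_eqE /= => jk.
by case: eqP => // _; rewrite inordK // ltnW.
Qed.

Lemma hochschild_seq k (psi : cochain A k) g :
  seq_eval (hochschild psi) g =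
  \sum_(0 <= i < k.+2) (-1) ^+ i * seq_eval psi (dface k i g).
Proof.
rewrite /seq_eval /hochschild big_nat_recr //= last_face_seq big_mkord.
rewrite /dface ltnn; congr (_ + _); apply: eq_bigr => i _.
by have := ltn_ord i; rewrite ltnS => ik; rewrite face_seq ?ik.
Qed.

Lemma rot_seq k g : (fun j : 'I_k.+1 => g (ordS j)) =
  (fun j : 'I_k.+1 => nrot k g j).
Proof.
apply/funext => j /=; rewrite /nrot; case: eqP => [->|/eqP jk].
  by rewrite modnn.
by have jk1 := ltn_ord j; rewrite modn_small //; lia.
Qed.

Lemma dface_dface k (psi : cochain A k) g i j : (i < j)%N -> (j <= k.+2)%N ->
  seq_eval psi (dface k i (dface k.+1 j g)) =
  seq_eval psi (dface k j.-1 (dface k.+1 i g)).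
Proof.
case: j => // j; rewrite ltnS [j.+1.-1]/= => ij jk; apply: eq_seq_eval => l lk.
have [jk1|] := leqP j k.
  by rewrite /dface ltnS jk1 (leq_trans ij jk1) (leqW (leq_trans ij jk1)) nface_nface.
move=> kj; have {jk kj} jE : j = k.+1 by lia.
move: ij; rewrite jE leq_eqVlt => /orP[/eqP->|ik].
  by rewrite /dface !ltnn leqnn nlast_nlast.
by rewrite /dface !ltnn -ltnS ik ltnW // nface_nlast.
Qed.

Lemma exchange_triangle (V : nmodType) n (H : nat -> nat -> V) :
  \sum_(0 <= j < n.+1) \sum_(j <= i < n) H j i =
  \sum_(0 <= i < n.+1) \sum_(0 <= j < i) H j i.-1.
Proof.
elim: n => [|n IH]; first by rewrite !big_nat1 !big_geq.
rewrite [LHS]big_nat_recr //= [X in _ + X]big_geq // addr0 [RHS]big_nat_recr //= -IH -big_split.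
by apply: eq_big_nat => j /andP[_ jn]; rewrite /= big_nat_recr.
Qed.

(** Every alternating sum of iterated faces is reduced to the faces
    [d_i d_j] with [i < j] by the simplicial identities. *)
Lemma simplicial_sum n (c G : nat -> nat -> R[i]) :
  (forall i j, (i < j)%N -> (j <= n)%N -> G j i = G i j.-1) ->
  \sum_(0 <= j < n.+1) \sum_(0 <= i < n) (-1) ^+ (i + j) * c j i * G j i =
  \sum_(0 <= j < n.+1) \sum_(0 <= i < j)
     (-1) ^+ (i + j) * (c j i - c i j.-1) * G j i.
Proof.
move=> GE; transitivity (\sum_(0 <= j < n.+1) \sum_(0 <= i < j) (-1) ^+ (i + j) * c j i * G j i
  + \sum_(0 <= j < n.+1) \sum_(j <= i < n) (-1) ^+ (i + j) * c j i * G j i).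
  rewrite -big_split /=; apply: eq_big_nat => j /andP[_ jn].
  by rewrite (big_cat_nat (leq0n j)).
rewrite (exchange_triangle n (fun j i => (-1) ^+ (i + j) * c j i * G j i)).
rewrite -big_split /=; apply: eq_big_nat => j /andP[_ jn].
rewrite -big_split /=; apply: eq_big_nat => i /andP[_ ij].
rewrite (GE i j) // (_ : (j.-1 + i)%N = (i + j).-1); last by lia.
have [m ->] : exists m, (i + j)%N = m.+1 by exists (i + j).-1; lia.
by rewrite /= exprS; ring.
Qed.

Lemma hochschild_hochschild k (psi : cochain A k) :
  hochschild (hochschild psi) = fun=> 0.
Proof.
apply: cochain_eqP => g; rewrite hochschild_seq.
pose G j i := seq_eval psi (dface k i (dface k.+1 j g)).
transitivity (\sum_(0 <= j < k.+3) \sum_(0 <= i < k.+2)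
    (-1) ^+ (i + j) * 1 * G j i).
  apply: eq_bigr => j _; rewrite hochschild_seq mulr_sumr; apply: eq_bigr => i _.
  by rewrite mulrA -exprD addnC mulr1.
rewrite (simplicial_sum (fun _ _ => 1)); last by move=> i j; apply: dface_dface.
by rewrite big1 // => j _; rewrite big1 // => i _; rewrite subrr mulr0 mul0r.
Qed.

Lemma hochschild_seq0 k (psi : cochain A k) g : hochschild psi = (fun=> 0) ->
  \sum_(0 <= i < k.+2) (-1) ^+ i * seq_eval psi (dface k i g) = 0.
Proof. by move=> h; rewrite -hochschild_seq h. Qed.

(** The operator [sum_i (-1)^i i d_i] is a homotopy for the periodicity
    operator: composed with the coboundary it gives [sum_(i<j) +- d_i d_j]. *)
Definition weighted_face k (psi : cochain A k) : cochain A k.+1 := fun x =>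
  \sum_(0 <= i < k.+2) i%:R * ((-1) ^+ i * seq_eval psi (dface k i (seq_of x))).

Lemma weighted_face_seq k (psi : cochain A k) g :
  seq_eval (weighted_face psi) g =
  \sum_(0 <= i < k.+2) i%:R * ((-1) ^+ i * seq_eval psi (dface k i g)).
Proof.
apply: eq_big_nat => i /andP[_ ik]; congr (_ * (_ * _)).
by apply: eq_seq_eval => j jk; apply: eq_dface => // l lk; rewrite seq_of_val.
Qed.

Definition double_face k (psi : cochain A k) g : R[i] :=
  \sum_(0 <= j < k.+2) \sum_(0 <= i < j)
    (-1) ^+ (i + j) * seq_eval psi (nface i (nface j g)).

Lemma hochschild_weighted_face k (psi : cochain A k) g :
  hochschild psi = (fun=> 0) ->
  seq_eval (hochschild (weighted_face psi)) g = double_face psi g.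
Proof.
move=> b0; pose G j i := seq_eval psi (dface k i (dface k.+1 j g)).
have GE i j : (i < j)%N -> (j <= k.+2)%N -> G j i = G i j.-1 by apply: dface_dface.
have G0 j : \sum_(0 <= i < k.+2) (-1) ^+ i * G j i = 0 by apply: hochschild_seq0.
have E1 : seq_eval (hochschild (weighted_face psi)) g =
    \sum_(0 <= j < k.+3) \sum_(0 <= i < k.+2) (-1) ^+ (i + j) * i%:R * G j i.
  rewrite hochschild_seq; apply: eq_bigr => j _.
  rewrite weighted_face_seq mulr_sumr; apply: eq_bigr => i _.
  by rewrite exprD -/(G j i); ring.
have E2 : 0 = \sum_(0 <= j < k.+3) \sum_(0 <= i < k.+2) (-1) ^+ (i + j) * j%:R * G j i.
  apply/esym/big1 => j _; rewrite -[RHS](mulr0 (j%:R * (-1) ^+ j)).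
  rewrite -[X in _ = _ * X](G0 j) mulr_sumr.
  by apply: eq_bigr => i _; rewrite exprD; ring.
rewrite -[LHS]addr0 {1}E2 E1.
rewrite (simplicial_sum (fun j i => i%:R)) // (simplicial_sum (fun j i => j%:R)) //.
rewrite -big_split /= /double_face big_nat_recr //= [X in _ + X](_ : _ = 0) ?addr0.
  apply: eq_big_nat => j /andP[_ jk]; rewrite -big_split /=.
  apply: eq_big_nat => i /andP[_ ij].
  have ik : (i <= k)%N by lia.
  have jk1 : (j <= k.+1)%N by lia.
  rewrite /G /dface ik jk1; move: (seq_eval _ _) ((-1) ^+ _) => z s.
  case: j ij {jk jk1} => // j _; rewrite [j.+1.-1]/= -[j.+1%:R]natr1; ring.
rewrite -big_split /= -[RHS](mulr0 ((-1) ^+ k.+2)) -[X in _ = _ * X](G0 k.+2) mulr_sumr.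
apply: eq_bigr => i _; rewrite exprD -[k.+2%:R]natr1.
by move: ((-1) ^+ i) ((-1) ^+ k.+2) (G k.+2 i) => x y z; ring.
Qed.

Definition rotation_invariant k (psi : cochain A k) : Prop :=
  forall g, seq_eval psi (nrot k g) = (-1) ^+ k * seq_eval psi g.

Lemma signMK k (z : R[i]) : (-1) ^+ k * ((-1) ^+ k * z) = z.
Proof. by rewrite mulrA -expr2 sqrr_sign mul1r. Qed.

Lemma cyclic_rotation k (psi : cochain A k) :
  cyclic_cochain psi <-> multilinear psi /\ rotation_invariant psi.
Proof.
split=> -[ml cy]; split=> //; [move=> g|move=> x].
  by rewrite /seq_eval -(rot_seq k g) (cy (fun j : 'I__ => g j)) signMK.
rewrite seq_evalE -[LHS](signMK k) -cy; congr (_ * _).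
rewrite /seq_eval -(rot_seq k (seq_of x)) /seq_of; congr psi.
by apply/funext => j; rewrite inord_val.
Qed.

(** Rotation shifts the index of a face, which the weight [i] turns into one
    more copy of [b psi], except that the last face returns as [d_0]. *)
Lemma rot_weighted_face k (psi : cochain A k) g : rotation_invariant psi ->
  (-1) ^+ k.+1 * seq_eval (weighted_face psi) (nrot k.+1 g) =
  seq_eval (weighted_face psi) g - seq_eval (hochschild psi) g
  + k.+2%:R * seq_eval psi (dface k 0 g).
Proof.
move=> cy; rewrite !weighted_face_seq hochschild_seq -sumrB.
rewrite big_nat_recr //= [in RHS]big_nat_recl //= mulrDr.
have -> : seq_eval psi (dface k k.+1 (nrot k.+1 g)) = seq_eval psi (dface k 0 g).
  by apply: eq_seq_eval => l; apply: nlast_rot.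
rewrite [_ * (k.+1%:R * _)]mulrCA signMK mul0r expr0 mul1r sub0r.
rewrite mulr_sumr (eq_big_nat _ _ (F2 := fun i =>
  i.+1%:R * ((-1) ^+ i.+1 * seq_eval psi (dface k i.+1 g))
  - (-1) ^+ i.+1 * seq_eval psi (dface k i.+1 g))); last first.
  move=> i /andP[_ ik].
  have -> : seq_eval psi (dface k i (nrot k.+1 g)) = (-1) ^+ k * seq_eval psi (dface k i.+1 g).
    by rewrite -cy; apply: eq_seq_eval => l lk; apply: nface_rot.
  rewrite -natr1 !exprS; move: (seq_eval _ _) ((-1) ^+ i) => P e.
  transitivity (- (i%:R * (e * ((-1) ^+ k * ((-1) ^+ k * P))))); first by ring.
  by rewrite signMK; ring.
by rewrite -[k.+2%:R]natr1; ring.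
Qed.

(** A rotation moves past every face except the last, which becomes [d_0]. *)
Lemma rot_hochschild k (f : cochain A k) g :
  (-1) ^+ k.+1 * seq_eval (hochschild f) (nrot k.+1 g) =
  \sum_(0 <= i < k.+1) (-1) ^+ i.+1 * ((-1) ^+ k * seq_eval f (nrot k (dface k i.+1 g)))
  + seq_eval f (dface k 0 g).
Proof.
rewrite hochschild_seq big_nat_recr //= mulrDr; congr (_ + _).
  rewrite mulr_sumr; apply: eq_big_nat => i /andP[_ ik].
  rewrite [X in _ = _ * (_ * X)](_ : _ = seq_eval f (dface k i (nrot k.+1 g))).
    by rewrite !exprS; ring.
  by apply: eq_seq_eval => l lk; rewrite nface_rot.
by rewrite signMK; apply: eq_seq_eval => l; apply: nlast_rot.
Qed.

Lemma rot_hochschild_cyclic k (psi : cochain A k) :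
  rotation_invariant psi -> rotation_invariant (hochschild psi).
Proof.
move=> cy g; rewrite -[LHS](signMK k.+1) rot_hochschild; congr (_ * _).
rewrite hochschild_seq [in RHS]big_nat_recl //= expr0 mul1r addrC; congr (_ + _).
by apply: eq_bigr => i _; rewrite cy signMK.
Qed.

(** The periodicity operator on a coboundary [b beta]: the cochain below is
    cyclic, because the failures of its two terms to be invariant under
    rotations are opposite multiples of [d_0 b beta], and its coboundary is
    that of the first term. *)
Definition periodicity_primitive k (beta : cochain A k) : cochain A k.+2 :=
  fun x => weighted_face (hochschild beta) x
    + k.+3%:R / k.+1%:R * hochschild (weighted_face beta) x.

Lemma rot_hochschild_weighted_face k (beta : cochain A k) g :
  rotation_invariant beta ->
  (-1) ^+ k.+2 * seq_eval (hochschild (weighted_face beta)) (nrot k.+2 g) =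
  seq_eval (hochschild (weighted_face beta)) g
  - k.+1%:R * seq_eval (hochschild beta) (dface k.+1 0 g).
Proof.
move=> cy; rewrite rot_hochschild.
set f := weighted_face beta; set psi := hochschild beta.
pose r i := seq_eval beta (dface k i (dface k.+1 0 g)).
have E i : (0 <= i < k.+2)%N ->
    (-1) ^+ i.+1 * ((-1) ^+ k.+1 * seq_eval f (nrot k.+1 (dface k.+1 i.+1 g))) =
    (-1) ^+ i.+1 * seq_eval f (dface k.+1 i.+1 g)
    - (-1) ^+ i.+1 * seq_eval psi (dface k.+1 i.+1 g)
    - k.+2%:R * ((-1) ^+ i * r i).
  move=> /andP[_ ik]; rewrite rot_weighted_face // dface_dface // -/(r i) exprS.
  by ring.
rewrite (eq_big_nat _ _ E) !sumrB -mulr_sumr.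
have -> : \sum_(0 <= i < k.+2) (-1) ^+ i * r i = seq_eval psi (dface k.+1 0 g).
  by rewrite hochschild_seq.
have := hochschild_seq0 g (hochschild_hochschild beta).
rewrite big_nat_recl //= expr0 mul1r -/psi => /eqP; rewrite addrC addr_eq0 => /eqP ->.
rewrite [in RHS]hochschild_seq [in RHS]big_nat_recl //= expr0 mul1r -[k.+2%:R]natr1; ring.
Qed.

Lemma periodicity_primitive_rot k (beta : cochain A k) :
  rotation_invariant beta -> rotation_invariant (periodicity_primitive beta).
Proof.
move=> cy g; rewrite -[LHS](signMK k.+2); congr (_ * _).
have E h : seq_eval (periodicity_primitive beta) h =
    seq_eval (weighted_face (hochschild beta)) h
    + k.+3%:R / k.+1%:R * seq_eval (hochschild (weighted_face beta)) h by [].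
rewrite !E mulrDr [_ * (k.+3%:R / _ * _)]mulrCA rot_hochschild_weighted_face //.
rewrite rot_weighted_face; last exact: rot_hochschild_cyclic.
rewrite (_ : seq_eval (hochschild (hochschild beta)) g = 0); last first.
  by rewrite hochschild_hochschild.
have k0 : k.+1%:R != 0 :> R[i] by rewrite pnatr_eq0.
by field.
Qed.

Definition nupd g j (a : A) : nat -> A := fun l => if l == j then a else g l.

Definition slot_linear k (f : (nat -> A) -> R[i]) : Prop :=
  forall g j, (j <= k)%N -> forall z a b,
    f (nupd g j (z *: a + b)) = z * f (nupd g j a) + f (nupd g j b).

Lemma multilinear_seq k (psi : cochain A k) :
  multilinear psi <-> slot_linear k (seq_eval psi).
Proof.
have E g (j : 'I_k.+1) a : (fun l : 'I_k.+1 => nupd g j a l) =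
    upd (fun l : 'I_k.+1 => g l) j a.
  by apply/funext => l; rewrite /nupd /upd -val_eqE.
split=> [ml g j jk z a b|sl x j z a b].
  have := ml (fun l : 'I_k.+1 => g l) (Ordinal (jk : (j < k.+1)%N)) z a b.
  by rewrite -!E.
have jk : (j <= k)%N by rewrite -ltnS.
have := sl (seq_of x) j jk z a b; rewrite /seq_eval !E.
by rewrite seq_ofK.
Qed.

(** Multilinearity passes to faces because an entry of [g] enters one entry
    of each face of [g], linearly. *)
Lemma dface_nupd k i g j : (i <= k.+1)%N -> (j <= k.+1)%N ->
  exists h l (L : A -> A), [/\ (l <= k)%N,
    forall z a b, L (z *: a + b) = z *: L a + L b
  & forall a m, (m <= k)%N -> dface k i (nupd g j a) m = nupd h l (L a) m].
Proof.
move=> ik jk; rewrite /dface; case: leqP => ik1.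
  have [ji|ij|ji] := ltngtP j i.
  - exists (nface i g), j, id; split=> // [|a m mk]; first by lia.
    rewrite /nupd; have [->|mj] := eqVneq m j; first by rewrite nface_lt // eqxx.
    have [mi|im|mi] := ltngtP m i.
    + by rewrite !nface_lt // (negbTE mj).
    + by rewrite !nface_gt // ifF //; lia.
    + by rewrite mi !nface_eq !ifF //; lia.
  - have [ji1|ji1] := eqVneq j i.+1.
      exists (nface i g), i, (amul (g i)); split=> // [z a b|a m mk]; first exact: amul_linr.
      rewrite /nupd ji1; have [mi|im|mi] := ltngtP m i.
      + by rewrite !nface_lt // ifF //; lia.
      + by rewrite !nface_gt // ifF //; lia.
      + by rewrite mi nface_eq eqxx ifF //; lia.
    exists (nface i g), j.-1, id; split=> // [|a m mk]; first by lia.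
    rewrite /nupd; have [mi|im|mi] := ltngtP m i.
    + by rewrite !nface_lt // !ifF //; lia.
    + by rewrite !nface_gt // (_ : (m.+1 == j) = (m == j.-1)) //; lia.
    + by rewrite mi !nface_eq !ifF //; lia.
  - exists (nface i g), i, (amul^~ (g i.+1)).
    split=> // [z a b|a m mk]; first exact: amul_linl.
    rewrite /nupd ji; have [mi|im|mi] := ltngtP m i.
    + by rewrite !nface_lt // ifF //; lia.
    + by rewrite !nface_gt // ifF //; lia.
    + by rewrite mi nface_eq eqxx ifF //; lia.
have [j0|j0] := eqVneq j 0%N.
  exists (nlast k g), 0%N, (amul (g k.+1)); split=> // [z a b|a m mk]; first exact: amul_linr.
  by rewrite j0 /nupd /nlast; case: eqP.
have [jk1|jk1] := eqVneq j k.+1.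
  exists (nlast k g), 0%N, (amul^~ (g 0%N)); split=> // [z a b|a m mk]; first exact: amul_linl.
  rewrite jk1 /nupd /nlast eqxx; case: eqP => [//|m0].
  by rewrite ifF //; lia.
exists (nlast k g), j, id; split=> // [|a m mk]; first by lia.
rewrite /nupd /nlast; have [->|m0] := eqVneq m 0%N; last by [].
by rewrite !ifF //; lia.
Qed.

Lemma slot_linear_dface k (psi : cochain A k) i : (i <= k.+1)%N ->
  multilinear psi -> slot_linear k.+1 (fun g => seq_eval psi (dface k i g)).
Proof.
move=> ik /multilinear_seq sl g j jk z a b.
have [h [l [L [lk lL E]]]] := dface_nupd g ik jk.
by rewrite !(eq_seq_eval _ (E _)) lL sl.
Qed.

Lemma slot_linear_sum k n (c : nat -> R[i]) (f : nat -> (nat -> A) -> R[i]) :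
  (forall i, (i < n)%N -> slot_linear k (f i)) ->
  slot_linear k (fun g => \sum_(0 <= i < n) c i * f i g).
Proof.
move=> sl g j jk z a b; rewrite mulr_sumr -big_split /=.
by apply: eq_big_nat => i /andP[_ ik]; rewrite sl //; ring.
Qed.

Lemma eq_slot_linear k f f' : f =1 f' -> slot_linear k f -> slot_linear k f'.
Proof. by move=> ff' sl g j jk z a b; rewrite -!ff' sl. Qed.

Lemma multilinear_hochschild k (psi : cochain A k) :
  multilinear psi -> multilinear (hochschild psi).
Proof.
move=> ml; apply/multilinear_seq.
apply: (eq_slot_linear (fun g => esym (hochschild_seq psi g))).
by apply: slot_linear_sum => i ik; apply: slot_linear_dface.
Qed.

Lemma multilinear_weighted_face k (psi : cochain A k) :
  multilinear psi -> multilinear (weighted_face psi).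
Proof.
move=> ml; apply/multilinear_seq.
apply: (@eq_slot_linear _ (fun g => \sum_(0 <= i < k.+2)
    (i%:R * (-1) ^+ i) * seq_eval psi (dface k i g))).
  by move=> g; rewrite weighted_face_seq; apply: eq_bigr => i _; rewrite mulrA.
by apply: slot_linear_sum => i ik; apply: slot_linear_dface.
Qed.

Lemma periodicity_primitive_cyclic k (beta : cochain A k) :
  cyclic_cochain beta -> cyclic_cochain (periodicity_primitive beta).
Proof.
move=> /cyclic_rotation[ml cy]; apply/cyclic_rotation; split; last first.
  exact: periodicity_primitive_rot.
have /multilinear_weighted_face m1 := multilinear_hochschild ml.
have /multilinear_hochschild m2 := multilinear_weighted_face ml.
by move=> x j z a b; rewrite /periodicity_primitive m1 m2; ring.
Qed.

Lemma hochschild_lin k (z : R[i]) (psi phi : cochain A k) x :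
  hochschild (fun y => z * psi y + phi y) x = z * hochschild psi x + hochschild phi x.
Proof.
rewrite /hochschild [z * (_ + _)]mulrDr mulr_sumr addrACA -big_split /=.
congr (_ + _); last by ring.
by apply: eq_bigr => i _; ring.
Qed.

Lemma hochschild_periodicity_primitive k (beta : cochain A k) g :
  seq_eval (hochschild (periodicity_primitive beta)) g =
  double_face (hochschild beta) g.
Proof.
rewrite -(hochschild_weighted_face g (hochschild_hochschild beta)) /seq_eval.
rewrite (_ : periodicity_primitive beta = fun x => k.+3%:R / k.+1%:R *
  hochschild (weighted_face beta) x + weighted_face (hochschild beta) x).
  by rewrite hochschild_lin hochschild_hochschild mulr0 add0r.
by apply/funext => x; rewrite /periodicity_primitive addrC.
Qed.

End CyclicCombinatorics.

(** * The periodicity operator as a sum of double faces *)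

Section PeriodicityFormula.
Context {R : realType} {A : algebra R}.
Implicit Types (g : nat -> A) (s cs ds : seq A) (w : Defs.form A).
Variables (r : nat) (psi : cochain A r).

(** Value of [psi] on the product of [w] by the differentials of the entries of
    [cs], which allows an induction on the differentials of [w]. *)
Definition form_value w cs : R[i] :=
  \sum_(t <- w) mcoef t * seq_eval psi (nth 0 ((mhead t).1 :: rev (mdiffs t) ++ cs)).

(** Moving the factor [b] to the left past the differentials, one at a time,
    merges two neighbours at each step, so the terms are the faces of one
    sequence. *)
Lemma form_value_muld w b cs : form_value (form_muld w b) cs = form_value w (b :: cs).
Proof.
rewrite /form_value big_map; apply: eq_bigr => t _ /=.
by rewrite rev_cons cat_rcons.
Qed.

Lemma form_value_scale z w cs : form_value (form_scale z w) cs = z * form_value w cs.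
Proof.
rewrite /form_value big_map mulr_sumr; apply: eq_bigr => t _ /=.
by rewrite mulrA.
Qed.

Lemma form_eval_foldl w cs : form_eval psi (foldl (@form_muld R A) w cs) = form_value w cs.
Proof.
elim: cs w => [|b cs IH] w /=; last by rewrite IH form_value_muld.
by apply: eq_bigr => t _; rewrite cats0.
Qed.

Lemma nface_nth_cat s a b cs l :
  nface (size s) (nth 0 (s ++ a :: b :: cs)) l = nth 0 (s ++ amul a b :: cs) l.
Proof.
have [ls|sl|->] := ltngtP l (size s).
- by rewrite nface_lt // !nth_cat ls.
- rewrite nface_gt // !nth_cat !ltnNge (ltnW sl) (leqW (ltnW sl)) /=.
  by rewrite subSn ?(ltnW sl) //; move: sl; rewrite -subn_gt0; case: (l - size s)%N.
- by rewrite nface_eq !nth_cat ltnn ltnNge leqnSn /= subnn subSn // subnn.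
Qed.

Lemma form_value_mul h ds b cs :
  form_value (monomial_mul (h, 0) ds b) cs =
  \sum_(0 <= i < (size ds).+1) (-1) ^+ (size ds - i) *
    seq_eval psi (nface i (nth 0 (h :: rev ds ++ b :: cs))).
Proof.
elim: ds b cs => [|a ds IH] b cs.
  rewrite /form_value big_seq1 big_nat1 /= expr0; congr (_ * _).
  rewrite scale0r addr0; apply: eq_seq_eval => -[|l] _.
    by rewrite nface_eq.
  by rewrite nface_gt.
rewrite [monomial_mul _ _ _]/= /form_value big_cons -/(form_value _ _).
rewrite form_value_scale form_value_muld IH [RHS]big_nat_recr //= subnn expr0.
rewrite [LHS]addrC; congr (_ + _ * _).
  rewrite mulr_sumr; apply: eq_big_nat => i /andP[_ ids].
  by rewrite subSn // exprS rev_cons cat_rcons mulrA.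
apply: eq_seq_eval => l _.
rewrite !rev_cons !cat_rcons -!cat_cons.
by rewrite -nface_nth_cat /= size_rev.
Qed.

Lemma form_eval_S_form g j : (0 < j)%N -> (j <= r.+1)%N ->
  form_eval psi (S_form (fun l : 'I_r.+3 => g l) j) =
  \sum_(0 <= i < j) (-1) ^+ (j.-1 - i) * seq_eval psi (nface i (nface j g)).
Proof.
move=> j0 jr; rewrite /S_form.
have gE m n : (m + n <= r.+3)%N ->
    [seq (fun l : 'I_r.+3 => g l) (inord k) | k <- iota m n] = [seq g k | k <- iota m n].
  move=> mn; apply/eq_in_map => k; rewrite mem_iota => /andP[_ kmn].
  by rewrite inordK // (leq_trans kmn).
rewrite !gE; [|by lia|by lia].
rewrite !inordK; [|by lia|by lia|by lia].
have muldE w cs : foldl (@form_muld R A) w cs =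
    [seq Mono (mcoef t) (mhead t) (catrev cs (mdiffs t)) | t <- w].
  elim: cs w => [|b cs IH] w /=; first by rewrite -[LHS]map_id; apply: eq_map => -[].
  by rewrite IH -map_comp.
rewrite form_eval_foldl muldE /form_mul /= cats0 form_value_scale mul1r.
rewrite form_value_mul catrevE cats0 size_rev size_map size_iota prednK // revK.
apply: eq_big_nat => i /andP[_ ij]; congr (_ * _); apply: eq_seq_eval => l lr.
have ir : (i <= r)%N by lia.
have := @eq_dface _ _ r i (nth 0 (g 0%N :: [seq g k | k <- iota 1 j.-1] ++
   amul (g j) (g j.+1) :: [seq g k | k <- iota j.+2 (r.+1 - j)])) (nface j g) l.
rewrite /dface ir; apply=> //; first exact: leqW.
move=> k kr.
rewrite (_ : _ :: _ = [seq nface j g k | k <- iota 0 (j + (r.+1 - j).+1)]).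
  by rewrite (nth_map 0%N) ?size_iota ?nth_iota //; lia.
rewrite iotaD map_cat add0n -[in iota 0 j](prednK j0) /= nface_eq nface_lt //.
congr (_ :: _ ++ _ :: _).
  apply/eq_in_map => n; rewrite mem_iota => nj; rewrite nface_lt //; lia.
rewrite -[j.+2]/(1 + j.+1)%N iotaDl -map_comp; apply/eq_in_map => n.
by rewrite mem_iota => /andP[nj _]; rewrite /= nface_gt // add1n.
Qed.

Lemma S_cochain_double_face g :
  seq_eval (S_cochain psi) g = - (2 * 'i * pi%:C) * double_face psi g.
Proof.
rewrite /seq_eval /S_cochain mulNr -mulrN; congr (_ * _).
rewrite /double_face [in RHS]big_nat_recl // [X in - (X + _)]big_geq // add0r -sumrN.
rewrite big_add1 /=; apply: eq_big_nat => j /andP[_ jr].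
rewrite form_eval_S_form // -sumrN; apply: eq_big_nat => i /andP[_ ij] /=.
rewrite (_ : (i + j.+1)%N = (j - i + i.*2).+1); last by lia.
by rewrite exprS exprD -muln2 mulnC exprM sqrrN expr1n expr1n; ring.
Qed.

End PeriodicityFormula.

(** * Cochains with split faces *)

Section SplitFaces.
Context {R : realType} {A : algebra R}.
Implicit Types (g h : nat -> A) (k : nat).

Lemma telescope (w : nat -> R[i]) n :
  \sum_(0 <= i < n) (-1) ^+ i * (w i.+1 + w i) = w 0%N - (-1) ^+ n * w n.
Proof.
elim: n => [|n IH]; first by rewrite big_geq // expr0 mul1r subrr.
by rewrite big_nat_recr //= IH exprS; ring.
Qed.

Lemma weighted_telescope (w : nat -> R[i]) n :
  \sum_(0 <= i < n) i%:R * ((-1) ^+ i * (w i.+1 + w i)) =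
  \sum_(0 <= i < n) (-1) ^+ i * w i - w 0%N - (n%:R - 1) * ((-1) ^+ n * w n).
Proof.
elim: n => [|n IH]; first by rewrite !big_geq // expr0; ring.
by rewrite !big_nat_recr //= IH exprS -[n.+1%:R]natr1; ring.
Qed.

Lemma sign_even q : ~~ odd q -> (-1) ^+ q = 1 :> R[i].
Proof. by move=> q0; rewrite -signr_odd (negbTE q0). Qed.

Lemma signS_even q : ~~ odd q -> (-1) ^+ q.+1 = -1 :> R[i].
Proof. by move=> q0; rewrite exprS sign_even // mulr1. Qed.

(** The shape shared by the characters of Fredholm modules: by the Leibniz
    rule, each face of the cochain [f] is the sum of two consecutive values of
    a family [w] indexed by the positions on a circle. *)
Record split_faces k (f : cochain A k) (w : nat -> (nat -> A) -> R[i]) : Prop := {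
  split_nface : forall i g, (i <= k)%N -> seq_eval f (nface i g) = w i.+1 g + w i g;
  split_nlast : forall g, seq_eval f (nlast k g) = w k.+1 g + w 0%N g;
  split_rot : forall i g, (i <= k)%N -> w i (nrot k.+1 g) = w i.+1 g;
  split_rot_last : forall g, w k.+1 (nrot k.+1 g) = w 0%N g;
  split_local : forall i g h, (i <= k.+1)%N ->
    (forall j, (j <= k.+1)%N -> g j = h j) -> w i g = w i h
}.

Variables (k : nat) (f : cochain A k) (w : nat -> (nat -> A) -> R[i]).
Hypotheses (k_even : ~~ odd k) (fw : split_faces f w).

Lemma hochschild_split : hochschild f = fun=> 0.
Proof.
apply: cochain_eqP => g; rewrite hochschild_seq big_nat_recr //=.
rewrite {2}/dface ltnn (split_nlast fw).
rewrite (eq_big_nat _ _ (F2 := fun i => (-1) ^+ i * (w i.+1 g + w i g))).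
  rewrite (telescope (w^~ g)) signS_even // mulN1r opprK [RHS](_ : _ = 0) //.
  by rewrite mulN1r addrC [w k.+1 g + _]addrC addNr.
by move=> i /andP[_ ik]; rewrite /dface -ltnS ik (split_nface fw).
Qed.

Definition alternating_cochain : cochain A k.+1 := fun x =>
  \sum_(0 <= i < k.+2) (-1) ^+ i * w i (seq_of x).

Lemma alternating_seq g :
  seq_eval alternating_cochain g = \sum_(0 <= i < k.+2) (-1) ^+ i * w i g.
Proof.
apply: eq_big_nat => i /andP[_ ik]; congr (_ * _).
by apply: (split_local fw) => // j jk; rewrite seq_of_val.
Qed.

Lemma alternating_rot : rotation_invariant alternating_cochain.
Proof.
move=> g; rewrite !alternating_seq big_nat_recr //= (split_rot_last fw).
rewrite signS_even // mulN1r [in RHS]big_nat_recl //= expr0 mul1r mulN1r opprD addrC.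
congr (_ + _); rewrite -sumrN; apply: eq_big_nat => i /andP[_ ik].
by rewrite (split_rot fw) // exprS; ring.
Qed.

Lemma weighted_face_split g : seq_eval (weighted_face f) g =
  seq_eval alternating_cochain g - k.+2%:R * w 0%N g.
Proof.
rewrite weighted_face_seq big_nat_recr //= /dface ltnn (split_nlast fw).
rewrite (eq_big_nat _ _ (F2 := fun i => i%:R * ((-1) ^+ i * (w i.+1 g + w i g)))).
  rewrite (weighted_telescope (w^~ g)) alternating_seq [in RHS]big_nat_recr //=.
  by rewrite signS_even // -[k.+2%:R]natr1 -[k.+1%:R]natr1; ring.
by move=> i /andP[_ ik]; rewrite -ltnS ik (split_nface fw).
Qed.

End SplitFaces.

(** * Traces of natural transformations *)

Section NaturalTransformations.
Context {R : realType} {X : rigid_cstar_tensor_category R}.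
Context {I : finType} {irr : I -> X} {H : hilb_functor X}.
Local Notation E := (hilb_hom H H).
Implicit Types s t : E.

Lemma hom_scaleAl (z : R[i]) s t : (z *: s) * t = z *: (s * t).
Proof. by apply: hilb_hom_eq => c x; rewrite ntZE !ntME ntZE. Qed.

Lemma hom_scaleAr (z : R[i]) s t : s * (z *: t) = z *: (s * t).
Proof.
apply: hilb_hom_eq => c x; rewrite ntZE !ntME ntZE.
have := nt_linear s z (t c x) 0; rewrite !addr0 => ->.
by rewrite (linear_map0 (@nt_linear _ _ _ _ s c)) addr0.
Qed.

Lemma hom_bop t c : exists a, bop a (t c).
Proof.
have [M tM] := nt_bounded t; exists `|M|; split=> // [|x]; first exact: nt_linear.
rewrite -nrm_le_norm (le_trans (tM c x)) //.
by rewrite ler_wpM2r // lecR ler_norm.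
Qed.

Variable N : nat.
Hypothesis N_gt0 : (0 < N)%N.

(** Only the values at simple objects enter the trace. *)
Definition Irr_ideal (k : nat) t : Prop := forall i, ideal N k (t (irr i)).

Lemma nt_mulE s t c : (s * t) c = fun x => s c (t c x).
Proof. by apply/funext => x; rewrite ntME. Qed.

Lemma nt_linE (z : R[i]) s t c : (z *: s + t) c = fun x => z *: s c x + t c x.
Proof. by apply/funext => x; rewrite ntDE ntZE. Qed.

Lemma Irr_ideal0 t : Irr_ideal 0 t.
Proof. by move=> i; have [a ha] := hom_bop t (irr i); apply: bop_ideal0 ha. Qed.

Lemma Irr_idealM k l s t : Irr_ideal k s -> Irr_ideal l t -> Irr_ideal (k + l) (s * t).
Proof. by move=> hs ht i; rewrite nt_mulE; apply: idealM. Qed.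

Lemma Irr_ideal_le k l t : (k <= l)%N -> Irr_ideal l t -> Irr_ideal k t.
Proof. by move=> kl ht i; apply: ideal_le (ht i). Qed.

Lemma Irr_idealMl k s t : Irr_ideal k t -> Irr_ideal k (s * t).
Proof. by move=> ht; have := Irr_idealM (Irr_ideal0 s) ht. Qed.

Lemma Irr_idealMr k s t : Irr_ideal k s -> Irr_ideal k (s * t).
Proof. by move=> hs; have := Irr_idealM hs (Irr_ideal0 t); rewrite addn0. Qed.

Lemma Irr_idealZ k z t : Irr_ideal k t -> Irr_ideal k (z *: t).
Proof. by move=> ht; rewrite -[t]mul1r -hom_scaleAl; apply: Irr_idealMl. Qed.

Lemma Irr_idealN k t : Irr_ideal k t -> Irr_ideal k (- t).
Proof. by rewrite -scaleN1r; apply: Irr_idealZ. Qed.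

Lemma Trace_lin z s t : Irr_ideal N s -> Irr_ideal N t ->
  Trace irr (z *: s + t) = z * Trace irr s + Trace irr t.
Proof.
move=> hs ht; rewrite /Trace mulr_sumr -big_split /=; apply: eq_bigr => i _.
have [a sa] := ideal_has_trace N_gt0 (hs i); have [b tb] := ideal_has_trace N_gt0 (ht i).
rewrite nt_linE (trace_eq (has_traceD (z := z) sa tb)).
by rewrite (trace_eq sa) (trace_eq tb).
Qed.

Lemma TraceD s t : Irr_ideal N s -> Irr_ideal N t ->
  Trace irr (s + t) = Trace irr s + Trace irr t.
Proof. by move=> hs ht; rewrite -{1}[s]scale1r Trace_lin // mul1r. Qed.

Lemma TraceZ z t : Irr_ideal N t -> Trace irr (z *: t) = z * Trace irr t.
Proof.
move=> ht; have := Trace_lin (z - 1) ht ht.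
by rewrite -{2}[t]scale1r -scalerDl subrK => ->; rewrite mulrBl mul1r subrK.
Qed.

Lemma TraceN t : Irr_ideal N t -> Trace irr (- t) = - Trace irr t.
Proof. by move=> ht; rewrite -scaleN1r TraceZ // mulN1r. Qed.

Lemma TraceB s t : Irr_ideal N s -> Irr_ideal N t ->
  Trace irr (s - t) = Trace irr s - Trace irr t.
Proof. by move=> hs ht; rewrite TraceD ?TraceN //; apply: Irr_idealN. Qed.

(** Only the total degree matters: neither factor may have a trace by itself. *)
Lemma TraceC k l s t : Irr_ideal k s -> Irr_ideal l t -> (N <= k + l)%N ->
  Trace irr (s * t) = Trace irr (t * s).
Proof.
move=> hs ht Nkl; wlog Nk : k l hs ht Nkl / (k <= N)%N.
  move=> W; case: (leqP k N) => kN; first exact: (W k l).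
  by apply: (W N 0%N); rewrite ?addn0 //;
  [apply: Irr_ideal_le hs; apply: ltnW|apply: Irr_ideal0].
have {}ht : Irr_ideal (N - k) t by apply: Irr_ideal_le ht; rewrite leq_subLR.
apply: eq_bigr => i _; rewrite !nt_mulE.
have [a [ha hb]] := ideal_traceC (subnKC Nk) (hs i) (ht i).
by rewrite (trace_eq ha) (trace_eq hb).
Qed.

Lemma schatten_Irr_ideal (p : R) t : 1 <= p -> p <= N%:R ->
  schatten irr p H t -> Irr_ideal 1 t.
Proof.
move=> p1 pN [ct ht] i; have [a ha] := hom_bop t (irr i).
apply: (schatten_ideal ha (ct _) p1 pN).
by apply: le_lt_trans ht; apply: ereal_sup_ubound; exists i.
Qed.

End NaturalTransformations.
Arguments TraceC {R X I irr H N} N_gt0 k l {s t}.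

(** * Words in commutators *)

Section Character.
Context {R : realType} {X : rigid_cstar_tensor_category R}.
Context {I : finType} {irr : I -> X} {A : algebra R} {p : R}.
Variable M : fredholm_module irr A p.
Local Notation E := (hilb_hom M M).
Local Notation F := (fm_F M).
Local Notation rho := (fm_rho M).
Local Notation Tr := (Trace irr).
Implicit Types (a b : A) (g h : nat -> A) (s t : E).

(* Locked, because unification would unfold it as a difference. *)
Definition parity : E := locked (grading M).
Local Notation eps := parity.

Lemma parityE : grading M = eps.
Proof. by rewrite /parity -lock. Qed.

Lemma parity2 : eps * eps = 1.
Proof.
have pp c x : gr_ppos M c (gr_ipos M c x) = x.
  by rewrite -hom_compE gr_pospos hom_idE.
have nn c x : gr_pneg M c (gr_ineg M c x) = x.
  by rewrite -hom_compE gr_negneg hom_idE.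
have pn c x : gr_ppos M c (gr_ineg M c x) = 0.
  by rewrite -hom_compE gr_posneg nt0E.
have np c x : gr_pneg M c (gr_ipos M c x) = 0.
  by rewrite -hom_compE gr_negpos nt0E.
have ntB (K L : hilb_functor X) (f : hilb_hom K L) c x y : f c (x - y) = f c x - f c y.
  by rewrite addrC -scaleN1r nt_linear scaleN1r addrC.
have i0 (K L : hilb_functor X) (f : hilb_hom K L) c : f c 0 = 0.
  by rewrite -(subrr 0) ntB subrr.
apply: hilb_hom_eq => c x.
rewrite -parityE ntME nt1E /grading !(ntDE, ntNE, hom_compE) !ntB.
rewrite pp nn pn np !i0 subr0 sub0r opprK -!hom_compE -ntDE gr_sum.
exact: hom_idE.
Qed.

Definition delta a : E := F * rho a - rho a * F.

Lemma rho_lin z a b : rho (z *: a + b) = z *: rho a + rho b.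
Proof. exact: fm_rho_linear. Qed.

Lemma delta_lin z a b : delta (z *: a + b) = z *: delta a + delta b.
Proof.
rewrite /delta rho_lin mulrDr mulrDl hom_scaleAr hom_scaleAl scalerBr opprD.
by rewrite addrACA.
Qed.

Lemma deltaM a b : delta (amul a b) = delta a * rho b + rho a * delta b.
Proof. by rewrite /delta fm_rho_mul mulrBl mulrBr !mulrA addrA subrK. Qed.

Lemma F_delta a : F * delta a = - (delta a * F).
Proof.
by rewrite /delta mulrBl mulrBr opprB !mulrA fm_F2 mul1r -(mulrA _ F F) fm_F2 mulr1.
Qed.

Lemma eps_F : eps * F = - (F * eps).
Proof. by rewrite -parityE fm_F_odd opprK. Qed.

Lemma eps_rho a : eps * rho a = rho a * eps.
Proof. by rewrite -parityE -fm_rho_even. Qed.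

Lemma eps_delta a : eps * delta a = - (delta a * eps).
Proof.
rewrite /delta mulrBr [in RHS]mulrBl !mulrA eps_F mulNr -(mulrA F) eps_rho.
rewrite -(mulrA (rho a) eps) eps_F mulrN !mulrA opprK opprB.
by rewrite addrC.
Qed.

(** Both [eps] and [F] anticommute with every [delta a], so [G] commutes with
    them: all traces below are traces of [G] times a word in the letters [delta]
    and [rho], and only the letters [rho] obstruct cyclic rotations of the word. *)
Definition epsF : E := locked (eps * F).
Local Notation G := epsF.

Lemma epsFE : G = eps * F.
Proof. by rewrite /epsF -lock. Qed.

Lemma epsF_delta a : delta a * G = G * delta a.
Proof.
rewrite epsFE mulrA -[delta a * eps]opprK -eps_delta mulNr.
by rewrite -!mulrA F_delta mulrN.
Qed.

Lemma rho_epsF a : rho a * G = G * rho a - eps * delta a.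
Proof. by rewrite /delta epsFE mulrBr !mulrA eps_rho opprB addrC subrK. Qed.

Definition delta_prod m n g : E := \prod_(m <= j < n) delta (g j).

Lemma delta_prod_nil m g : delta_prod m m g = 1.
Proof. by rewrite /delta_prod big_geq. Qed.

Lemma delta_prod_recl m n g : (m < n)%N ->
  delta_prod m n g = delta (g m) * delta_prod m.+1 n g.
Proof. by move=> mn; rewrite /delta_prod big_ltn. Qed.

Lemma delta_prod_recr m n g : (m <= n)%N ->
  delta_prod m n.+1 g = delta_prod m n g * delta (g n).
Proof. by move=> mn; rewrite /delta_prod big_nat_recr. Qed.

Lemma delta_prod_cat m n q g : (m <= n)%N -> (n <= q)%N ->
  delta_prod m q g = delta_prod m n g * delta_prod n q g.
Proof. by move=> mn nq; rewrite /delta_prod (big_cat_nat mn nq). Qed.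

Lemma eq_delta_prod m n g h : (forall j, (m <= j < n)%N -> g j = h j) ->
  delta_prod m n g = delta_prod m n h.
Proof. by move=> gh; apply: eq_big_nat => j mjn; rewrite gh. Qed.

Lemma delta_prod_shift m n g h : (forall j, (m <= j < n)%N -> h j = g j.+1) ->
  delta_prod m n h = delta_prod m.+1 n.+1 g.
Proof. by move=> gh; rewrite /delta_prod big_add1 /=; apply: eq_big_nat => j /gh ->. Qed.

Lemma anticomm_delta_prod (t : E) m n g : (forall a, t * delta a = - (delta a * t)) ->
  ~~ odd (n - m) -> t * delta_prod m n g = delta_prod m n g * t.
Proof.
move=> ta ev; have [nm|mn] := leqP n m; first by rewrite /delta_prod big_geq // mulr1 mul1r.
have [q nE] : exists q, n = (m + q.*2)%N.
  by exists (n - m)./2; rewrite even_halfK // subnKC // ltnW.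
rewrite nE {ev mn nE}; elim: q => [|q IH]; first by rewrite addn0 delta_prod_nil mulr1 mul1r.
rewrite doubleS !addnS !delta_prod_recr ?leqW ?leq_addr // !mulrA IH.
rewrite -!mulrA; congr (_ * _).
by rewrite mulrA ta mulNr -mulrA ta mulrN opprK.
Qed.

Lemma F_delta_prod m n g : ~~ odd (n - m) -> F * delta_prod m n g = delta_prod m n g * F.
Proof. by apply: anticomm_delta_prod; apply: F_delta. Qed.

Lemma eps_delta_prod m n g : ~~ odd (n - m) -> eps * delta_prod m n g = delta_prod m n g * eps.
Proof. by apply: anticomm_delta_prod; apply: eps_delta. Qed.

(** The Leibniz rule for [delta], inside a product. *)
Lemma delta_prod_face_eq m n i g : (m <= i)%N -> (i < n)%N ->
  delta_prod m n (nface i g) = delta_prod m i.+1 g * rho (g i.+1) * delta_prod i.+2 n.+1 g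
                     + delta_prod m i g * rho (g i) * delta_prod i.+1 n.+1 g.
Proof.
move=> mi i_n; rewrite (delta_prod_cat _ mi (ltnW i_n)) (delta_prod_recl _ i_n).
rewrite nface_eq deltaM.
rewrite (@eq_delta_prod m i _ g); last by move=> j /andP[_ ji]; rewrite nface_lt.
rewrite (@delta_prod_shift i.+1 n g); last by move=> j /andP[ij _]; rewrite nface_gt.
rewrite mulrDl mulrDr !mulrA -delta_prod_recr // -!mulrA; congr (_ + _).
by rewrite -(delta_prod_recl g) // ltnS.
Qed.

Lemma delta_prod_face_gt m n i g : (i < m)%N ->
  delta_prod m n (nface i g) = delta_prod m.+1 n.+1 g.
Proof.
move=> im; apply: delta_prod_shift => j /andP[mj _]; rewrite nface_gt //.
exact: leq_trans mj.
Qed.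

Lemma delta_prod_last m n k g : (0 < m)%N -> delta_prod m n (nlast k g) = delta_prod m n g.
Proof.
move=> m0; apply: eq_delta_prod => j /andP[mj _]; rewrite nlast_gt //.
exact: leq_trans mj.
Qed.

Variable N : nat.
Hypotheses (N_gt0 : (0 < N)%N) (p_ge1 : 1 <= p) (pN : p <= N%:R).
Local Notation J := (@Irr_ideal _ _ _ irr M N).

Lemma Irr_ideal_delta a : J 1 (delta a).
Proof. exact: (schatten_Irr_ideal p_ge1 pN (fm_summable M a)). Qed.

Lemma Irr_ideal_delta_prod m n g : J (n - m) (delta_prod m n g).
Proof.
have [nm|mn] := leqP n m; first by rewrite (eqP nm); apply: (Irr_ideal0 N_gt0).
rewrite -(subnKC (ltnW mn)); elim: (n - m)%N => [|q IH].
  by rewrite addn0 subnn; apply: (Irr_ideal0 N_gt0).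
rewrite addnS delta_prod_recr ?leq_addr // subSn ?leq_addr // -addn1.
by apply: Irr_idealM => //; apply: Irr_ideal_delta.
Qed.

(** By cyclicity, [Tr (eps t) = Tr (F eps t F)], and [F eps t F = - eps t]. *)
Lemma Tr_eps_F_comm t : J N t -> F * t = t * F -> Tr (eps * t) = 0.
Proof.
move=> Jt Ft.
have h : Tr (eps * t) = - Tr (eps * t).
  have Jet : J N (eps * t) by apply: Irr_idealMl.
  rewrite -{1}[eps * t]mul1r -(fm_F2 M) -mulrA.
  rewrite (TraceC N_gt0 0 N); [|exact: (Irr_ideal0 N_gt0)|exact: Irr_idealMl|by []].
  rewrite -!mulrA -Ft !mulrA -[F * eps]opprK -eps_F mulNr -(mulrA eps F F).
  by rewrite fm_F2 mulr1 mulNr (TraceN N_gt0).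
move/eqP: h; rewrite -addr_eq0 -mulr2n -mulr_natl mulf_eq0 pnatr_eq0 /=.
by move/eqP.
Qed.

(** The character up to a scalar. Since [delta] is a derivation, the faces of
    [phi] are sums of the traces [omit], in which one letter is [rho a_i] instead
    of [delta a_i]. *)
Definition phi k g : R[i] := Tr (G * delta_prod 0 k.+1 g).

Definition omit_word n i g : E := delta_prod 0 i g * rho (g i) * delta_prod i.+1 n g.

Definition omit k i g : R[i] := Tr (G * omit_word k.+2 i g).

Lemma Irr_ideal_omit_word n i g : (i < n)%N -> J n.-1 (omit_word n i g).
Proof.
move=> i_n; have Ji : J 0 (rho (g i)) := Irr_ideal0 N_gt0 _.
have := Irr_idealM (Irr_idealM (Irr_ideal_delta_prod 0 i g) Ji)
  (Irr_ideal_delta_prod i.+1 n g).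
by rewrite (_ : (i - 0 + 0 + (n - i.+1))%N = n.-1) //; lia.
Qed.

Section Degree.
Variable k : nat.
Hypotheses (Nk : (N <= k.+1)%N) (k_even : ~~ odd k).

Lemma Tr_omitD i j g : (i < k.+2)%N -> (j < k.+2)%N ->
  Tr (G * (omit_word k.+2 i g + omit_word k.+2 j g)) = omit k i g + omit k j g.
Proof.
move=> ik jk; rewrite /omit mulrDr (TraceD N_gt0) //;
  by apply: (Irr_ideal_le Nk); apply: (Irr_idealMl N_gt0); apply: (Irr_ideal_omit_word g).
Qed.

Lemma Tr_rho_move a (t : E) : J k.+1 t ->
  Tr (G * (t * rho a)) = Tr (G * (rho a * t)) - Tr (eps * (delta a * t)).
Proof.
move=> Jt; rewrite mulrA (TraceC N_gt0 k.+1 0);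
  [|exact: (Irr_idealMl N_gt0)|exact: (Irr_ideal0 N_gt0)|by rewrite addn0].
rewrite mulrA rho_epsF mulrBl (TraceB N_gt0) -?mulrA //.
  by apply: (Irr_ideal_le Nk); do 2 apply: (Irr_idealMl N_gt0).
by apply: (Irr_ideal_le Nk); do 2 apply: (Irr_idealMl N_gt0).
Qed.

(** The trace that separates the two sides contains an even number of letters
    [delta], so it vanishes by parity. *)
Lemma Tr_rho_rotate a (t : E) : J k.+1 t -> F * (delta a * t) = delta a * t * F ->
  Tr (G * (t * rho a)) = Tr (G * (rho a * t)).
Proof.
move=> Jt Ft; rewrite Tr_rho_move // [X in _ - X]Tr_eps_F_comm ?subr0 //.
by apply: (Irr_ideal_le Nk); apply: (Irr_idealMl N_gt0).
Qed.

Lemma Tr_delta_rotate a (t : E) : J k t ->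
  Tr (G * (t * delta a)) = Tr (G * (delta a * t)).
Proof.
move=> Jt; rewrite mulrA (TraceC N_gt0 k 1);
  [|exact: (Irr_idealMl N_gt0)|exact: Irr_ideal_delta|by rewrite addn1].
by rewrite !mulrA epsF_delta.
Qed.

Lemma F_delta_delta_prod a m g :
  F * (delta a * delta_prod m (m + k.+1) g) =
  delta a * delta_prod m (m + k.+1) g * F.
Proof.
rewrite [in delta_prod _ _ _]addnS delta_prod_recr ?leq_addr //.
rewrite mulrA F_delta mulNr -!mulrA [F * (_ * _)]mulrA F_delta_prod ?addKn //.
by rewrite -!mulrA F_delta !mulrN opprK.
Qed.

Lemma phi_nface i g : (i <= k)%N -> phi k (nface i g) = omit k i.+1 g + omit k i g.
Proof.
by move=> ik; rewrite /phi delta_prod_face_eq // Tr_omitD // ltnS // ltnW.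
Qed.

Lemma phi_nlast g : phi k (nlast k g) = omit k k.+1 g + omit k 0 g.
Proof.
rewrite /phi delta_prod_recl // delta_prod_last // {1}/nlast /= deltaM mulrDl mulrDr addrC.
have J1 : J k (delta_prod 1 k.+1 g).
  by have := Irr_ideal_delta_prod 1 k.+1 g; rewrite subn1.
have Jk1 : J k.+1 (delta_prod 0 k.+1 g).
  by have := Irr_ideal_delta_prod 0 k.+1 g; rewrite subn0.
have Ja : J k.+1 (delta (g k.+1) * rho (g 0%N) * delta_prod 1 k.+1 g).
  by rewrite -mulrA; exact: (Irr_idealM (Irr_ideal_delta _) (Irr_idealMl N_gt0 _ J1)).
have Jb : J k.+1 (rho (g k.+1) * delta (g 0%N) * delta_prod 1 k.+1 g).
  by rewrite -mulrA -delta_prod_recl //; exact: (Irr_idealMl N_gt0).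
rewrite (TraceD N_gt0 (Irr_ideal_le Nk (Irr_idealMl N_gt0 _ Jb))
  (Irr_ideal_le Nk (Irr_idealMl N_gt0 _ Ja))).
congr (_ + _).
  rewrite -mulrA -delta_prod_recl // -Tr_rho_rotate //.
    by rewrite /omit /omit_word delta_prod_nil mulr1.
  by have := F_delta_delta_prod (g k.+1) 0 g; rewrite add0n.
rewrite -[in LHS]mulrA -Tr_delta_rotate; last exact: (Irr_idealMl N_gt0).
by rewrite /omit /omit_word delta_prod_nil mul1r -[rho _ * _ * _]mulrA -delta_prod_recr.
Qed.

Lemma phi_rot g : phi k (nrot k g) = phi k g.
Proof.
rewrite /phi delta_prod_recr // (@delta_prod_shift 0 k g); last first.
  by move=> j /andP[_ jk]; rewrite nrot_lt.
rewrite nrot_eq Tr_delta_rotate; first by rewrite -(@delta_prod_recl 0 k.+1).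
by have := Irr_ideal_delta_prod 1 k.+1 g; rewrite subn1.
Qed.

Lemma omit_rot i g : (i <= k)%N -> omit k i (nrot k.+1 g) = omit k i.+1 g.
Proof.
move=> ik; rewrite /omit /omit_word.
rewrite (@delta_prod_shift 0 i g); last first.
  by move=> j /andP[_ ji]; rewrite nrot_lt // (leq_trans ji) // leqW.
rewrite (@delta_prod_recr i.+1 k.+1) // (@delta_prod_shift i.+1 k.+1 g); last first.
  by move=> j /andP[_ jk]; rewrite nrot_lt.
rewrite nrot_lt // nrot_eq [_ * (delta_prod _ _ _ * delta _)]mulrA Tr_delta_rotate.
  by rewrite (@delta_prod_recl 0 i.+1) // !mulrA.
have Ji : J 0 (rho (g i.+1)) := Irr_ideal0 N_gt0 _.
have := Irr_idealM (Irr_idealM (Irr_ideal_delta_prod 1 i.+1 g) Ji)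
  (Irr_ideal_delta_prod i.+2 k.+2 g).
by rewrite subn1 addn0 /= !subSS subnKC.
Qed.

Lemma omit_rot_last g : omit k k.+1 (nrot k.+1 g) = omit k 0 g.
Proof.
rewrite /omit /omit_word !delta_prod_nil mul1r mulr1.
rewrite (@delta_prod_shift 0 k.+1 g); last by move=> j /andP[_ jk]; rewrite nrot_lt.
rewrite nrot_eq Tr_rho_rotate //.
  by have := Irr_ideal_delta_prod 1 k.+2 g; rewrite subn1.
by have := F_delta_delta_prod (g 0%N) 1 g; rewrite add1n.
Qed.

Definition phi_cochain : cochain A k := fun x => phi k (seq_of x).

Lemma phi_cochain_seq g : seq_eval phi_cochain g = phi k g.
Proof.
rewrite /seq_eval /phi_cochain /phi (@eq_delta_prod 0 k.+1 _ g) // => j /andP[_ jk].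
by rewrite seq_of_val.
Qed.

Lemma eq_omit i g h : (i <= k.+1)%N ->
  (forall j, (j <= k.+1)%N -> g j = h j) -> omit k i g = omit k i h.
Proof.
move=> ik gh; rewrite /omit /omit_word.
rewrite (@eq_delta_prod 0 i g h) ?(@eq_delta_prod i.+1 k.+2 g h) ?gh //.
  by move=> j /andP[_ jk]; rewrite gh.
by move=> j /andP[_ ji]; rewrite gh // ltnW // (leq_trans ji).
Qed.

Lemma split_faces_phi : split_faces phi_cochain (omit k).
Proof.
split=> [i g ik|g|i g ik|g|i g h ik gh].
- by rewrite phi_cochain_seq phi_nface.
- by rewrite phi_cochain_seq phi_nlast.
- exact: omit_rot.
- exact: omit_rot_last.
- exact: eq_omit.
Qed.

End Degree.

Section Comparison.
Variable k : nat.
Hypotheses (Nk : (N <= k.+1)%N) (k_even : ~~ odd k).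

Lemma Tr_eps_delta_rotate a (t : E) : J k.+1 t ->
  Tr (eps * (delta a * t)) = - Tr (eps * (t * delta a)).
Proof.
move=> Jt; rewrite mulrA eps_delta mulNr -mulrA (TraceN N_gt0); last first.
  by apply: (Irr_ideal_le Nk); do 2 apply: (Irr_idealMl N_gt0).
rewrite [X in - X = _](TraceC N_gt0 0 k.+1);
  [|exact: (Irr_ideal0 N_gt0)|exact: (Irr_idealMl N_gt0)|exact: Nk].
by rewrite mulrA.
Qed.

(** [G delta a = eps rho a - G rho a F], and the two terms contribute equally
    because [F G = - eps]. *)
Lemma Tr_epsF_delta a (t : E) : J k.+1 t -> F * t = t * F ->
  Tr (G * (delta a * t)) = 2 * Tr (eps * (rho a * t)).
Proof.
move=> Jt Ft; have -> : G * (delta a * t) = eps * (rho a * t) - G * (rho a * t) * F.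
  rewrite /delta epsFE mulrBl mulrBr -!mulrA -Ft; congr (_ - _).
  by rewrite (mulrA F F) fm_F2 mul1r.
have J1 : J N (eps * (rho a * t)) by apply: (Irr_ideal_le Nk); do 2 apply: (Irr_idealMl N_gt0).
have J2 : J k.+1 (G * (rho a * t)) by do 2 apply: (Irr_idealMl N_gt0).
rewrite (TraceB N_gt0) //; last by apply: (Irr_ideal_le Nk); apply: (Irr_idealMr N_gt0).
rewrite [X in _ - X = _](TraceC N_gt0 k.+1 0);
  [|exact: J2|exact: (Irr_ideal0 N_gt0)|by rewrite addn0].
have FG : F * G = - eps.
  by rewrite epsFE mulrA -[F * eps]opprK -eps_F mulNr -mulrA fm_F2 mulr1.
rewrite [F * (G * _)]mulrA FG.
by rewrite mulNr (TraceN N_gt0) // opprK mulr_natl mulr2n.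
Qed.

Definition omit0_cochain : cochain A k.+1 := fun x => omit k 0 (seq_of x).

Lemma omit0_seq g : seq_eval omit0_cochain g = omit k 0 g.
Proof. by apply: eq_omit => // j jk; rewrite seq_of_val. Qed.

Lemma omit0E g : omit k 0 g = Tr (G * (rho (g 0%N) * delta_prod 1 k.+2 g)).
Proof. by rewrite /omit /omit_word delta_prod_nil mul1r. Qed.

(* The faces of the word of [omit k 0] split into these words. *)
Definition omit2_word i g : E :=
  rho (g 0%N) * (delta_prod 1 i g * rho (g i) * delta_prod i.+1 k.+3 g).

Lemma Irr_ideal_omit2_word i g : (0 < i < k.+3)%N -> J k.+1 (omit2_word i g).
Proof.
move=> ik; apply: (Irr_idealMl N_gt0).
have Ji : J 0 (rho (g i)) := Irr_ideal0 N_gt0 _.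
have := Irr_idealM (Irr_idealM (Irr_ideal_delta_prod 1 i g) Ji)
  (Irr_ideal_delta_prod i.+1 k.+3 g).
by rewrite (_ : (i - 1 + 0 + (k.+3 - i.+1))%N = k.+1) //; lia.
Qed.

Lemma omit0_nface0 g : omit k 0 (nface 0 g) = Tr (G * omit2_word 1 g).
Proof.
rewrite omit0E nface_eq delta_prod_face_gt // fm_rho_mul.
by rewrite /omit2_word delta_prod_nil mul1r !mulrA.
Qed.

Lemma omit0_nface i g : (i <= k)%N ->
  omit k 0 (nface i.+1 g) = Tr (G * omit2_word i.+2 g) + Tr (G * omit2_word i.+1 g).
Proof.
move=> ik; rewrite omit0E nface_lt // delta_prod_face_eq // !mulrDr (TraceD N_gt0) //;
  by apply: (Irr_ideal_le Nk); apply: (Irr_idealMl N_gt0);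
  apply: Irr_ideal_omit2_word; rewrite /= !ltnS ?(leqW ik).
Qed.

Lemma Tr_omit2_last g : Tr (G * omit2_word k.+2 g) =
  omit k 0 (nlast k.+1 g) - Tr (eps * (delta (g k.+2) * (rho (g 0%N) * delta_prod 1 k.+2 g))).
Proof.
have nl0 : nlast k.+1 g 0 = amul (g k.+2) (g 0%N) by [].
rewrite omit0E nl0 delta_prod_last // fm_rho_mul.
rewrite /omit2_word delta_prod_nil mulr1 [_ * (delta_prod _ _ _ * _)]mulrA (Tr_rho_move Nk).
  by rewrite -[rho _ * rho _ * _]mulrA.
by apply: (Irr_idealMl N_gt0); have := Irr_ideal_delta_prod 1 k.+2 g; rewrite subn1.
Qed.

Lemma phi_double g : phi k.+2 g = 2 * Tr (eps * (rho (g 0%N) * delta_prod 1 k.+3 g)).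
Proof.
rewrite /phi delta_prod_recl // Tr_epsF_delta //.
  by apply: (Irr_ideal_le (leqnSn k.+1)); have := Irr_ideal_delta_prod 1 k.+3 g; rewrite subn1.
by apply: F_delta_prod; rewrite subn1 /= negbK.
Qed.

(** The coboundary of the first of the terms [omit k i] is, up to a scalar, the
    character in the next even degree: this is where the two characters are
    compared. *)
Lemma hochschild_omit0 g :
  seq_eval (hochschild omit0_cochain) g = - 2^-1 * phi k.+2 g.
Proof.
pose w i := Tr (G * omit2_word i.+1 g).
pose z := Tr (eps * (delta (g k.+2) * (rho (g 0%N) * delta_prod 1 k.+2 g))).
have zE : z = - (2^-1 * phi k.+2 g).
  rewrite phi_double mulKf ?pnatr_eq0 // /z Tr_eps_delta_rotate.
    by rewrite -mulrA -delta_prod_recr.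
  by apply: (Irr_idealMl N_gt0); have := Irr_ideal_delta_prod 1 k.+2 g; rewrite subn1.
have lastE : seq_eval omit0_cochain (nlast k.+1 g) = w k.+1 + z.
  by rewrite omit0_seq /w Tr_omit2_last subrK.
have firstE : seq_eval omit0_cochain (nface 0 g) = w 0%N.
  by rewrite omit0_seq omit0_nface0.
have midE i : (i <= k)%N -> seq_eval omit0_cochain (nface i.+1 g) = w i.+1 + w i.
  by move=> ik; rewrite omit0_seq omit0_nface.
rewrite mulNr -zE; move: w z {zE} lastE firstE midE => w z lastE firstE midE.
rewrite hochschild_seq big_nat_recr //= {2}/dface ltnn lastE.
rewrite big_nat_recl //= firstE expr0 mul1r exprS signS_even // mulrNN !mul1r.
rewrite (eq_big_nat _ _ (F2 := fun i => - ((-1) ^+ i * (w i.+1 + w i)))).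
  by rewrite sumrN telescope signS_even //; ring.
by move=> i /andP[_ ik]; rewrite /dface ik midE // exprS; ring.
Qed.

Lemma double_face_phi g :
  double_face (@phi_cochain k) g =
  seq_eval (hochschild (@alternating_cochain R A k (omit k))) g
  + k.+2%:R / 2 * phi k.+2 g.
Proof.
have sf := split_faces_phi Nk k_even.
rewrite -hochschild_weighted_face; last exact: hochschild_split sf.
have -> : weighted_face (@phi_cochain k) = fun x =>
    - k.+2%:R * omit0_cochain x + @alternating_cochain R A k (omit k) x.
  apply: cochain_eqP => h; rewrite (weighted_face_split k_even sf) -omit0_seq.
  by rewrite /seq_eval mulNr [RHS]addrC.
rewrite /seq_eval hochschild_lin -!/(seq_eval _ g) hochschild_omit0.
move: (seq_eval _ _) (phi _ _) => x y.
have two0 : 2 != 0 :> R[i] by rewrite pnatr_eq0.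
by field.
Qed.

Lemma delta_prod_nupd_out m n g j a : (j < m)%N || (n <= j)%N ->
  delta_prod m n (nupd g j a) = delta_prod m n g.
Proof.
move=> jo; apply: eq_delta_prod => l /andP[ml ln]; rewrite /nupd ifF //.
by apply/eqP => lj; move: jo; rewrite -lj ltnNge ml leqNgt ln.
Qed.

Lemma delta_prod_nupd m n g j z a b : (m <= j < n)%N ->
  delta_prod m n (nupd g j (z *: a + b)) =
  z *: delta_prod m n (nupd g j a) + delta_prod m n (nupd g j b).
Proof.
move=> /andP[mj jn].
have E c : delta_prod m n (nupd g j c) = delta_prod m j g * (delta c * delta_prod j.+1 n g).
  rewrite (delta_prod_cat _ mj (ltnW jn)) (delta_prod_recl _ jn).
  rewrite !delta_prod_nupd_out ?leqnn ?orbT ?ltnSn //.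
  by rewrite /nupd eqxx.
by rewrite !E delta_lin mulrDl mulrDr hom_scaleAl hom_scaleAr.
Qed.

Lemma slot_linear_phi : slot_linear k (phi k).
Proof.
move=> g j jk z a b; rewrite /phi delta_prod_nupd // mulrDr hom_scaleAr (Trace_lin N_gt0) //;
  by apply: (Irr_ideal_le Nk); apply: (Irr_idealMl N_gt0);
  have := Irr_ideal_delta_prod 0 k.+1; rewrite subn0; apply.
Qed.

Lemma omit_word_nupd n i g j z a b : (i < n)%N -> (j < n)%N ->
  omit_word n i (nupd g j (z *: a + b)) =
  z *: omit_word n i (nupd g j a) + omit_word n i (nupd g j b).
Proof.
move=> i_n jn; rewrite /omit_word; have [ji|ij|ji] := ltngtP j i.
- rewrite delta_prod_nupd // !(@delta_prod_nupd_out i.+1) ?(leqW ji) //.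
  by rewrite /nupd gtn_eqF // !mulrDl !hom_scaleAl.
- rewrite (@delta_prod_nupd i.+1 n) ?ij ?jn // !(@delta_prod_nupd_out 0 i) ?(ltnW ij) ?orbT //.
  by rewrite /nupd ltn_eqF // !mulrDr hom_scaleAr.
- rewrite ji !delta_prod_nupd_out ?leqnn ?ltnSn ?orbT //.
  by rewrite /nupd eqxx rho_lin mulrDr mulrDl hom_scaleAr hom_scaleAl.
Qed.

Lemma slot_linear_omit i : (i <= k.+1)%N -> slot_linear k.+1 (omit k i).
Proof.
move=> ik g j jk z a b; rewrite /omit omit_word_nupd // mulrDr hom_scaleAr.
by rewrite (Trace_lin N_gt0) //; apply: (Irr_ideal_le Nk);
  apply: (Irr_idealMl N_gt0); exact: (@Irr_ideal_omit_word k.+2 i _ ik).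
Qed.

Lemma cyclic_alternating : cyclic_cochain (@alternating_cochain R A k (omit k)).
Proof.
have sf := split_faces_phi Nk k_even.
apply/cyclic_rotation; split; last exact: alternating_rot sf.
apply/multilinear_seq; apply: eq_slot_linear (fun g => esym (alternating_seq sf g)) _.
by apply: slot_linear_sum => i ik; apply: slot_linear_omit.
Qed.

Lemma cocycle_phi : cyclic_cocycle (@phi_cochain k).
Proof.
split; last exact: hochschild_split (split_faces_phi Nk k_even).
apply/cyclic_rotation; split; last first.
  by move=> g; rewrite !phi_cochain_seq phi_rot // sign_even // mul1r.
apply/multilinear_seq; apply: eq_slot_linear (fun g => esym (@phi_cochain_seq k g)) _.
exact: slot_linear_phi.
Qed.

End Comparison.

End Character.

(** * Characters and periodicity *)

Section CharacterFormula.
Context {R : realType} {X : rigid_cstar_tensor_category R}.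
Context {I : finType} {irr : I -> X} {A : algebra R} {p : R}.
Variable M : fredholm_module irr A p.
Local Notation E := (hilb_hom M M).
Local Notation F := (fm_F M).
Local Notation eps := (parity M).
Local Notation rho := (fm_rho M).
Implicit Types t : E.

Lemma even_partE t : eps * t = t * eps -> even_part t = t.
Proof.
move=> et; rewrite /even_part parityE et -mulrA parity2 mulr1.
rewrite -[t + t]mulr2n -[t *+ 2]scaler_nat.
by rewrite scalerA mulVf ?scale1r // pnatr_eq0.
Qed.

Lemma odd_partE t : eps * t = t * eps -> odd_part t = 0.
Proof.
by move=> et; rewrite /odd_part parityE et -mulrA parity2 mulr1 subrr scaler0.
Qed.

Lemma graded_comm_even t : eps * t = t * eps -> graded_comm t = F * t - t * F.
Proof.
move=> et; rewrite /graded_comm even_partE // odd_partE //.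
by rewrite mulr0 mul0r !addr0.
Qed.

Lemma qdiff_rho a : qdiff (rho a) = 'i *: delta M a.
Proof. by rewrite /qdiff graded_comm_even // eps_rho. Qed.

Lemma prod_qdiff n g :
  \prod_(j < n) qdiff (rho (g j.+1)) = 'i ^+ n *: delta_prod M 1 n.+1 g.
Proof.
elim: n => [|n IH]; first by rewrite big_ord0 expr0 scale1r delta_prod_nil.
rewrite big_ord_recr /= IH qdiff_rho [in RHS]delta_prod_recr //.
by rewrite hom_scaleAl hom_scaleAr scalerA exprSr.
Qed.

Variable N : nat.
Hypotheses (N_gt0 : (0 < N)%N) (p_ge1 : 1 <= p) (pN : p <= N%:R).

(** The factor [1/2 (-1)^m] comes from [Tr_s] and from the [2m] factors [i] in
    the differentials [i [F, _]]. *)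
Definition character_coef (m : nat) : R[i] :=
  (2 * 'i * pi%:C) ^+ m * m`!%:R * (2^-1 * (-1) ^+ m).

Lemma character_coefS m :
  character_coef m.+1 = - (2 * 'i * pi%:C) * m.+1%:R * character_coef m.
Proof. by rewrite /character_coef factS natrM !exprS; ring. Qed.

(** The product of the differentials is even, so [F] commutes with it and the
    commutator in [Tr_s] only sees [rho (a_0)], which becomes [delta a_0]. *)
Lemma character_phi m : (N <= m.*2.+1)%N ->
  character M m = fun x => character_coef m * phi_cochain M x.
Proof.
move=> Nm; apply: cochain_eqP => g; rewrite {1}/seq_eval /character.
rewrite [RHS](_ : _ = character_coef m * phi M m.*2 g); last first.
  by rewrite /seq_eval -(phi_cochain_seq M m.*2 g).
rewrite /character_coef -!mulrA; congr (_ * (_ * _)).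
rewrite prod_qdiff /Tr_s hom_scaleAr.
have ev : ~~ odd (m.*2.+1 - 1) by rewrite subn1 /= odd_double.
set P := delta_prod M 1 m.*2.+1 g.
have eT : eps * (rho (g 0%N) * P) = rho (g 0%N) * P * eps.
  by rewrite mulrA eps_rho -!mulrA eps_delta_prod.
rewrite graded_comm_even; last by rewrite hom_scaleAr hom_scaleAl eT.
rewrite hom_scaleAr hom_scaleAl -scalerBr hom_scaleAr.
have -> : F * (rho (g 0%N) * P) - rho (g 0%N) * P * F = delta_prod M 0 m.*2.+1 g.
  by rewrite (@delta_prod_recl _ _ _ _ _ _ M 0) // /delta mulrBl -!mulrA -F_delta_prod.
rewrite parityE -epsFE (TraceZ N_gt0); last first.
  apply: (Irr_ideal_le Nm); apply: (Irr_idealMl N_gt0).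
  by have := Irr_ideal_delta_prod M N_gt0 p_ge1 pN 0 m.*2.+1 g; rewrite subn0.
by rewrite -muln2 mulnC exprM sqrCi.
Qed.

Lemma cyclic_cochain_lin k z (f h : cochain A k) :
  cyclic_cochain f -> cyclic_cochain h -> cyclic_cochain (fun x => z * f x + h x).
Proof.
move=> [mf cf] [mh ch]; split=> [x j w a b|x].
  by rewrite mf mh; ring.
by rewrite (cf x) (ch x); ring.
Qed.

Lemma cyclic_cochain0 k : cyclic_cochain (fun=> 0 : R[i]) (k := k) (A := A).
Proof. by split=> [x j w a b|x]; rewrite ?mulr0 ?addr0. Qed.

Lemma hochschild_scale k z (f : cochain A k) :
  hochschild (fun x => z * f x) = fun x => z * hochschild f x.
Proof.
apply/funext => x; rewrite /hochschild [RHS]mulrDr mulr_sumr.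
by congr (_ + _); [apply: eq_bigr => i _|]; ring.
Qed.

Lemma cyclic_cocycle_scale k z (f : cochain A k) :
  cyclic_cocycle f -> cyclic_cocycle (fun x => z * f x).
Proof.
move=> [[mf cf] bf]; split.
  by split=> [x j w a b|x]; rewrite ?mf 1?cf; ring.
by rewrite hochschild_scale bf; apply/funext => x; rewrite mulr0.
Qed.

Lemma cyclic_cocycle_character m : (N <= m.*2.+1)%N ->
  cyclic_cocycle (character M m).
Proof.
move=> Nm; rewrite character_phi //; apply: cyclic_cocycle_scale.
exact: (cocycle_phi M N_gt0 p_ge1 pN Nm (negbT (odd_double m))).
Qed.

Lemma double_face_lin k z (f h : cochain A k) g :
  double_face (fun x => z * f x + h x) g = z * double_face f g + double_face h g.
Proof.
rewrite /double_face mulr_sumr -big_split /=; apply: eq_bigr => j _.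
rewrite mulr_sumr -big_split /=; apply: eq_bigr => i _.
by rewrite /seq_eval; ring.
Qed.

Lemma double_face_scale k z (f : cochain A k) g :
  double_face (fun x => z * f x) g = z * double_face f g.
Proof.
rewrite /double_face mulr_sumr; apply: eq_bigr => j _.
by rewrite mulr_sumr; apply: eq_bigr => i _; rewrite /seq_eval; ring.
Qed.

Lemma character_S m : (N <= m.*2.+1)%N ->
  exists V : cochain A m.*2.+1, cyclic_cochain V /\
    forall g, seq_eval (character M m.+1) g =
      seq_eval (S_cochain (character M m)) g + seq_eval (hochschild V) g.
Proof.
move=> Nm; have ev := negbT (odd_double m).
pose V0 := @alternating_cochain R A m.*2 (omit M m.*2).
pose c := 2 * 'i * pi%:C * character_coef m.
exists (fun x => c * V0 x + 0); split=> [|g].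
  apply: cyclic_cochain_lin; last exact: cyclic_cochain0.
  exact: (cyclic_alternating M N_gt0 p_ge1 pN Nm ev).
rewrite S_cochain_double_face (character_phi Nm).
rewrite double_face_scale (double_face_phi M N_gt0 p_ge1 pN Nm ev).
rewrite (@character_phi m.+1); last by apply: (leq_trans Nm); rewrite doubleS !ltnS ltnW.
rewrite [LHS](_ : _ = character_coef m.+1 * phi M m.*2.+2 g); last first.
  by rewrite /seq_eval -(phi_cochain_seq M m.*2.+2 g).
rewrite [X in _ = _ + X](_ : _ = c * seq_eval (hochschild V0) g); last first.
  rewrite (_ : (fun x => _) = fun x => c * V0 x); last by apply/funext => x; rewrite addr0.
  by rewrite hochschild_scale.
have e2 : m.*2.+2%:R = m.+1%:R * 2 :> R[i] by rewrite -doubleS -muln2 natrM.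
rewrite character_coefS /c e2 -/V0.
move: (seq_eval _ _) (phi _ _ _) (character_coef _) => x y z.
have two0 : 2 != 0 :> R[i] by rewrite pnatr_eq0.
by field.
Qed.

End CharacterFormula.

(** Periodicity on classes: representatives differ by coboundaries, and the
    operator maps coboundaries of cyclic cochains to coboundaries of cyclic
    cochains. *)
Lemma cohomology_class_S (R : realType) (A : algebra R) k
    (tau : cochain A k) (tau' : cochain A k.+2) (V : cochain A k.+1) :
  cyclic_cochain V ->
  (forall g, seq_eval tau' g =
     seq_eval (S_cochain tau) g + seq_eval (hochschild V) g) ->
  cohomology_class tau' = S_class (cohomology_class tau).
Proof.
move=> cV tauE; apply/seteqP; split=> x.
- case=> beta cb bE; exists tau.
    case: (k) tau {tau' V cV tauE x beta cb bE} => [|k'] t.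
      by apply/funext => y /=; rewrite subrr.
    exists (fun=> 0); first exact: cyclic_cochain0.
    apply/funext => y /=; rewrite subrr /hochschild mulr0 addr0 big1 // => i _.
    by rewrite mulr0.
  exists (fun y => 1 * beta y + V y); first exact: cyclic_cochain_lin.
  apply: cochain_eqP => g; rewrite /seq_eval hochschild_lin bE mul1r /=.
  have := tauE g; rewrite /seq_eval => ->; ring.
- case=> psi psi_tau [beta cb bE].
  have [theta ct tE] : exists2 theta : cochain A k.+1, cyclic_cochain theta &
      forall g, double_face psi g = double_face tau g + seq_eval (hochschild theta) g.
    move: psi_tau {bE beta cb tauE V cV}; rewrite /cohomology_class /=.
    case: k tau tau' psi x => [|k'] tau tau' psi x.
      move=> h; exists (fun=> 0); first exact: cyclic_cochain0.
      move=> g; have -> : psi = tau.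
        apply/funext => y; apply/eqP; rewrite -subr_eq0.
        by apply/eqP/(congr1 (fun f => f y) h).
      rewrite /seq_eval /hochschild mulr0 addr0 big1 ?addr0 // => i _.
      by rewrite mulr0.
    case=> b cb bE; exists (periodicity_primitive b).
      exact: periodicity_primitive_cyclic.
    move=> g; rewrite hochschild_periodicity_primitive.
    have -> : psi = fun y => 1 * hochschild b y + tau y.
      by apply/funext => y; rewrite bE /= mul1r subrK.
    by rewrite double_face_lin mul1r addrC.
  exists (fun y => - (2 * 'i * pi%:C) * theta y + (-1 * V y + beta y)).
    by do 2 apply: cyclic_cochain_lin => //.
  apply: cochain_eqP => g; rewrite /seq_eval !hochschild_lin bE /=.
  have := tauE g; rewrite /seq_eval => ->.
  have := S_cochain_double_face psi g; have := S_cochain_double_face tau g.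
  by rewrite /seq_eval => -> ->; rewrite tE /seq_eval; ring.
Qed.

Theorem theorem5p1 (R : realType) (X : rigid_cstar_tensor_category R)
    (I : finType) (irr : I -> X) (irrP : is_Irr irr)
    (A : algebra R) (p : R) (p_ge1 : 1 <= p)
    (M : fredholm_module irr A p) (m : nat) (mp : p - 1 <= m.*2%:R) :
  [/\ cyclic_cocycle (character M m),
      cyclic_cocycle (character M m.+1)
    & chern_character M m.+1 = S_class (chern_character M m)].
Proof.
have pN : p <= m.*2.+1%:R by rewrite -natr1 -lerBlDr.
split.
- exact: (@cyclic_cocycle_character _ _ _ _ _ _ M m.*2.+1).
- apply: (@cyclic_cocycle_character _ _ _ _ _ _ M m.*2.+1) => //.
  by rewrite doubleS !ltnS ltnW.
have [V [cV VE]] := @character_S _ _ _ _ _ _ M m.*2.+1 (ltn0Sn _) p_ge1 pN m (leqnn _).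
exact: cohomology_class_S cV VE.
Qed.
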